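(* Let $K$ be a Helson set on $\mathbb{T}$. Then there is a function $g \in A(\mathbb{T})$, vanishing on $K$, which is a cyclic vector in $A_p(\mathbb{T})$ for every $p$ with $1 < p < \infty$.
   Context: $\mathbb{T} = \mathbb{R}/2\pi\mathbb{Z}$ is the circle group. For $1 \le p \le \infty$, $A_p(\mathbb{T})$ is the Banach space of Schwartz distributions $S$ on $\mathbb{T}$ whose Fourier coefficients $\widehat{S} = \{\widehat{S}(n)\}_{n \in \mathbb{Z}}$ belong to $\ell^p(\mathbb{Z})$, with norm $\|S\|_{A_p} := \|\widehat{S}\|_{\ell^p}$; $A(\mathbb{T}) = A_1(\mathbb{T})$ is the Wiener algebra. An element $f \in A_p(\mathbb{T})$, $1 \le p < \infty$, is called a cyclic vector in $A_p(\mathbb{T})$ (with respect to multiplication by exponentials) if the set $\{P(t) f(t)\}$, where $P$ goes through all trigonometric polynomials, is dense in $A_p(\mathbb{T})$. A measure on $\mathbb{T}$ means a finite complex Borel measure; $\int |d\mu|$ is its total variation and $\widehat{\mu}(n)$ its Fourier coefficients. A compact set $K \subset \mathbb{T}$ is called a Helson set if it satisfies any one of the following equivalent conditions: (i) every continuous function on $K$ admits an extension to a function in $A(\mathbb{T})$; (ii) there is $\delta_1(K) > 0$ such that $\sup_{n \in \mathbb{Z}} |\widehat{\mu}(n)| \geq \delta_1(K) \int |d\mu|$ for every measure $\mu$ supported by $K$; (iii) there is $\delta_2(K) > 0$ such that $\limsup_{|n| \to \infty} |\widehat{\mu}(n)| \geq \delta_2(K) \int |d\mu|$ for every measure $\mu$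 supported by $K$. *)

(* Defs.v *)
(* A function on the circle R/2piZ is a 2pi-periodic function on R, and a subset
   of the circle is a 2pi-periodic subset of R. *)
From Stdlib Require Import Reals ZArith.
From Coquelicot Require Import Coquelicot.
Open Scope R_scope.

Definition periodic {X : Type} (f : R -> X) : Prop :=
  forall t, f (t + 2 * PI) = f t.

Definition periodic_set (K : R -> Prop) : Prop :=
  forall t, K (t + 2 * PI) <-> K t.

(* The exponential e^{int}. *)
Definition expi (n : Z) (t : R) : C := (cos (IZR n * t), sin (IZR n * t)).

(* The symmetric partial sum of f(n) over -N <= n <= N. *)
Definition zsum {G : AbelianMonoid} (f : Z -> G) (N : nat) : G :=
  sum_n (fun k : nat => f (Z.of_nat k - Z.of_nat N)%Z) (2 * N).

Definition trig_poly (N : nat) (a : Z -> C) (t : R) : C :=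
  zsum (fun n => Cmult (a n) (expi n t)) N.

(* x^p for x >= 0 and p > 0; the guard is needed since Rpower 0 p = 1. *)
Definition rpow (x p : R) : R :=
  if Req_EM_T x 0 then 0 else Rpower x p.

(* ell^p(Z) for 0 < p < oo: the partial sums are nondecreasing in N, so their
   convergence is the summability of |c(n)|^p over Z. *)
Definition lp_partial (p : R) (c : Z -> C) (N : nat) : R :=
  zsum (fun n => rpow (Cmod (c n)) p) N.

Definition in_lp (p : R) (c : Z -> C) : Prop :=
  ex_finite_lim_seq (lp_partial p c).

(* Meaningful only when in_lp p c holds. *)
Definition lp_norm (p : R) (c : Z -> C) : R :=
  rpow (real (Lim_seq (lp_partial p c))) (/ p).

Definition smooth (phi : R -> C) : Prop :=
  forall (k : nat) (t : R),
    ex_derive_n (fun s => Re (phi s)) k t /\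
    ex_derive_n (fun s => Im (phi s)) k t.

Definition CDerive_n (phi : R -> C) (k : nat) (t : R) : C :=
  (Derive_n (fun s => Re (phi s)) k t, Derive_n (fun s => Im (phi s)) k t).

Definition test_function (phi : R -> C) : Prop := periodic phi /\ smooth phi.

(* Schwartz distributions on the circle.  A functional is given on all functions
   R -> C, but only its values on test functions matter. The third clause is
   continuity for the topology of C^oo(T), i.e. a bound by finitely many of the
   seminorms sup |phi^(k)|. *)
Definition is_distribution (S : (R -> C) -> C) : Prop :=
  (forall phi psi, test_function phi -> test_function psi ->
     S (fun t => Cplus (phi t) (psi t)) = Cplus (S phi) (S psi)) /\
  (forall (a : C) phi, test_function phi ->
     S (fun t => Cmult a (phi t)) = Cmult a (S phi)) /\
  (exists (B : R) (m : nat), forall phi (M : R), test_function phi ->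
     (forall (k : nat) (t : R), (k <= m)%nat -> Cmod (CDerive_n phi k t) <= M) ->
     Cmod (S phi) <= B * M).

Definition fourier (S : (R -> C) -> C) (n : Z) : C := S (expi (- n)).

Definition distr_sub (S1 S2 : (R -> C) -> C) : (R -> C) -> C :=
  fun phi => Cminus (S1 phi) (S2 phi).

Definition distr_mul (P : R -> C) (S : (R -> C) -> C) : (R -> C) -> C :=
  fun phi => S (fun t => Cmult (P t) (phi t)).

(* The distribution phi |-> (1/2pi) int_0^{2pi} f phi induced by a continuous
   function f. *)
Definition distr_of (f : R -> C) : (R -> C) -> C :=
  fun phi => Cmult (RtoC (/ (2 * PI)))
    (RInt (V := C_R_CompleteNormedModule)
       (fun t => Cmult (f t) (phi t)) 0 (2 * PI)).

(* Membership in A_p(T) and its norm, for 1 <= p < oo. *)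
Definition in_Ap (p : R) (S : (R -> C) -> C) : Prop :=
  is_distribution S /\ in_lp p (fourier S).

Definition Ap_norm (p : R) (S : (R -> C) -> C) : R := lp_norm p (fourier S).

(* Elements of A(T) = A_1(T) seen as functions: distributions with summable
   Fourier coefficients are induced by a unique continuous function. *)
Definition in_A (f : R -> C) : Prop :=
  periodic f /\ (forall t, continuous f t) /\ in_Ap 1 (distr_of f).

Definition cyclic_vector (p : R) (f : (R -> C) -> C) : Prop :=
  in_Ap p f /\
  forall S, in_Ap p S -> forall eps : R, 0 < eps ->
    exists (N : nat) (a : Z -> C),
      Ap_norm p (distr_sub (distr_mul (trig_poly N a) f) S) < eps.

(* A closed periodic subset of R is a compact subset of the circle; every
   continuous function on it must extend to a function in A(T). *)
Definition Helson_set (K : R -> Prop) : Prop :=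
  periodic_set K /\ closed K /\
  forall phi : R -> C, periodic phi -> continuous_on K phi ->
    exists f : R -> C, in_A f /\ (forall t, K t -> f t = phi t).

(* Main.v *)
(* Since K is a Helson set, continuous functions on K bounded by 1 extend to A(T) with a uniform
   norm bound (Baire).  Extend the functions X_w / (1 + |X_w|^2), where X_w is a normalised
   exponential sum with random signs w and frequencies j (2N + 1), and average against the
   conjugates of the X_w: this gives h in A(T), equal to 1 on K, of bounded norm, with little mass
   on the frequencies |n| <= N.  Iterating and averaging, h can be taken "flat": h = 1 on K,
   ||h||_A <= B and sup |hat h(n)| as small as we please.

   Now g = sum_j 2^{-j-1} |1 - h_j|^2 vanishes on K.  Put v_n = 2^{-n} + sum_{j<n} 2^{-j-1} |1 - h_j|^2.
   As v_n >= 2^{-n} it has an approximate inverse P_n in A(T) (Wiener), and g - v_n has bounded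
   norm and coefficients controlled by those of the h_j with j >= n.  If the h_j are chosen flat
   enough in terms of ||P_n||_A for n <= j, then P_n g -> 1 in every A_p with p > 1, because
   ||a||_p^p <= ||a||_oo^{p-1} ||a||_1. *)
Require Import Defs.
From Stdlib Require Import Reals ZArith Lra Lia Classical ClassicalEpsilon FunctionalExtensionality.
From Coquelicot Require Import Coquelicot.
Open Scope R_scope.

(** * Sums over the integers *)

(** The sums [X_w] cannot serve as data on [K]: their supremum may reach the square root of the
    number m of frequencies, while X / (1 + |X|^2) never exceeds 1/2 in modulus. The price is the
    factor |X_w|^2 / (1 + |X_w|^2), which vanishes with [X_w]. Only its mean over the signs is
    bounded below, by 1/8 through second and fourth moments; dividing the data by this mean makes
    the averaged product equal to 1 on [K]. The gain comes from the spacing 2N + 1: the m translates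
    of [-N, N] are disjoint, so all terms of [X_w] together are charged one norm of the extension,
    and the normalisation by sqrt m makes this small. As m depends on the Helson constant alone, the
    norm of h does not depend on N. This uniformity drives the recursion: h_n is chosen after P_n,
    whose norm is uncontrolled, and yet the series for g must converge in A. The coefficients of g -
    v_n are made smaller than a constant times L^{-(n+1)}, L being a bound for the norm of P_n. The
    exponent grows with n because interpolation raises this bound to the power p - 1 only, and p - 1
    may be arbitrarily small. *)

Notation zsumR := (@zsum R_AbelianMonoid : (Z -> R) -> nat -> R).
Notation zsumC := (@zsum C_AbelianMonoid : (Z -> C) -> nat -> C).

(** Sums over [C_AbelianMonoid] yield equations at its carrier; they are retyped in [C] so that
    [ring] recognises them. *)
Ltac Cring := match goal with |- @eq _ ?x ?y => change (@eq C x y); ring end.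

Lemma zsum_ext {G : AbelianMonoid} (u v : Z -> G) (N : nat) :
  (forall n, (Z.abs n <= Z.of_nat N)%Z -> u n = v n) -> zsum u N = zsum v N.
Proof.
  intros H. apply sum_n_ext_loc. intros k Hk. apply H. lia.
Qed.

Lemma zsumR_le (u v : Z -> R) (N : nat) :
  (forall n, (Z.abs n <= Z.of_nat N)%Z -> u n <= v n) -> zsumR u N <= zsumR v N.
Proof.
  intros H. unfold zsum. rewrite !sum_n_Reals. apply sum_Rle. intros k Hk. apply H. lia.
Qed.

Lemma zsumR_plus (u v : Z -> R) (N : nat) :
  zsumR (fun n => u n + v n) N = zsumR u N + zsumR v N.
Proof. exact (sum_n_plus (G := R_AbelianMonoid) _ _ _). Qed.

Lemma zsumR_scal (c : R) (u : Z -> R) (N : nat) :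
  zsumR (fun n => c * u n) N = c * zsumR u N.
Proof. exact (sum_n_mult_l (K := R_Ring) c _ _). Qed.

Lemma zsumR_const (c : R) (N : nat) : zsumR (fun _ => c) N = (2 * INR N + 1) * c.
Proof. unfold zsum. rewrite sum_n_const, S_INR, mult_INR. simpl. ring. Qed.

Lemma zsumR_nonneg (u : Z -> R) (N : nat) : (forall n, 0 <= u n) -> 0 <= zsumR u N.
Proof.
  intros H. apply Rle_trans with (zsumR (fun _ => 0) N).
  - rewrite zsumR_const. lra.
  - apply zsumR_le. intros; apply H.
Qed.

Lemma zsum_switch {G : AbelianMonoid} (u : Z -> Z -> G) (M N : nat) :
  zsum (fun n => zsum (u n) M) N = zsum (fun k => zsum (fun n => u n k) N) M.
Proof. exact (sum_n_switch (fun i j => u (Z.of_nat i - Z.of_nat N)%Z (Z.of_nat j - Z.of_nat M)%Z) _ _). Qed.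

Lemma zsumC_plus (u v : Z -> C) (N : nat) :
  zsumC (fun n => Cplus (u n) (v n)) N = Cplus (zsumC u N) (zsumC v N).
Proof. exact (sum_n_plus (G := C_AbelianMonoid) _ _ _). Qed.

Lemma zsumC_scal (c : C) (u : Z -> C) (N : nat) :
  zsumC (fun n => Cmult c (u n)) N = Cmult c (zsumC u N).
Proof. exact (sum_n_mult_l (K := C_Ring) c _ _). Qed.

Lemma Cmod_zsum (u : Z -> C) (N : nat) : Cmod (zsumC u N) <= zsumR (fun n => Cmod (u n)) N.
Proof.
  unfold zsum. generalize (2 * N)%nat as m; intros m. induction m as [|m IH].
  - rewrite !sum_O. apply Rle_refl.
  - rewrite !sum_Sn. eapply Rle_trans; [apply Cmod_triangle|].
    apply Rplus_le_compat; [exact IH|apply Rle_refl].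
Qed.

(** A translate of [-N, N] is no longer symmetric, so shifts and disjoint windows are handled on
    half-open intervals [lo, lo + n). *)
Fixpoint rsum (u : Z -> R) (lo : Z) (n : nat) : R :=
  match n with O => 0 | S n => rsum u lo n + u (lo + Z.of_nat n)%Z end.

Lemma zsum_rsum (u : Z -> R) (N : nat) : zsumR u N = rsum u (- Z.of_nat N) (S (2 * N)).
Proof.
  unfold zsum. generalize (2 * N)%nat as m; intros m. induction m as [|m IH].
  - rewrite sum_O. simpl. rewrite Rplus_0_l. f_equal. lia.
  - rewrite sum_Sn, IH.
    change (rsum u (- Z.of_nat N) (S m) + u (Z.of_nat (S m) - Z.of_nat N)%Z =
      rsum u (- Z.of_nat N) (S m) + u (- Z.of_nat N + Z.of_nat (S m))%Z).
    f_equal. f_equal. ring.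
Qed.

Lemma rsum_app (u : Z -> R) (lo : Z) (m n : nat) :
  rsum u lo (m + n) = rsum u lo m + rsum u (lo + Z.of_nat m) n.
Proof.
  induction n as [|n IH].
  - rewrite Nat.add_0_r. simpl. ring.
  - rewrite Nat.add_succ_r. simpl. rewrite IH.
    replace (lo + Z.of_nat (m + n))%Z with (lo + Z.of_nat m + Z.of_nat n)%Z by (rewrite Nat2Z.inj_add; ring). ring.
Qed.

Lemma rsum_shift (u : Z -> R) (k lo : Z) (n : nat) :
  rsum (fun j => u (j + k)%Z) lo n = rsum u (lo + k) n.
Proof.
  induction n as [|n IH]; simpl; [reflexivity|]. rewrite IH. f_equal. f_equal. lia.
Qed.

Lemma rsum_nonneg (u : Z -> R) (lo : Z) (n : nat) : (forall j, 0 <= u j) -> 0 <= rsum u lo n.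
Proof.
  intros H. induction n as [|n IH]; simpl; [lra|]. specialize (H (lo + Z.of_nat n)%Z). lra.
Qed.

Lemma rsum_sub (u : Z -> R) (lo lo' : Z) (n n' : nat) :
  (forall j, 0 <= u j) -> (lo' <= lo)%Z ->
  (lo + Z.of_nat n <= lo' + Z.of_nat n')%Z -> rsum u lo n <= rsum u lo' n'.
Proof.
  intros Hu H1 H2.
  destruct (Nat.eq_dec n 0) as [->|Hn]; [apply rsum_nonneg; exact Hu|].
  set (p := Z.to_nat (lo - lo')).
  replace n' with (p + (n + (n' - n - p)))%nat by lia.
  rewrite !rsum_app.
  replace (lo' + Z.of_nat p)%Z with lo by lia.
  pose proof (rsum_nonneg u lo' p Hu).
  pose proof (rsum_nonneg u (lo + Z.of_nat n) (n' - n - p) Hu). lra.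
Qed.

(** Bounding all partial sums replaces the norm: no limit has to be formed, and the bound passes to
    limits of coefficients. *)
Definition l1 (a : Z -> C) (B : R) : Prop := forall N, zsumR (fun n => Cmod (a n)) N <= B.

Lemma l1_rsum (a : Z -> C) (B : R) (lo : Z) (n : nat) :
  l1 a B -> rsum (fun j => Cmod (a j)) lo n <= B.
Proof.
  intros H.
  eapply Rle_trans; [|apply (H (Z.to_nat (Z.abs lo) + n)%nat)].
  rewrite zsum_rsum. apply rsum_sub; [intros; apply Cmod_ge_0| lia | lia].
Qed.

Lemma l1_shift_window (a : Z -> C) (B : R) (k : Z) (N : nat) :
  l1 a B -> zsumR (fun n => Cmod (a (n + k)%Z)) N <= B.
Proof.
  intros H. rewrite zsum_rsum. rewrite (rsum_shift (fun j => Cmod (a j))). apply l1_rsum, H.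
Qed.

Lemma l1_ge0 (a : Z -> C) (B : R) : l1 a B -> 0 <= B.
Proof.
  intros H. apply Rle_trans with (2 := H O). apply zsumR_nonneg. intros; apply Cmod_ge_0.
Qed.

Lemma l1_coef (a : Z -> C) (B : R) (n : Z) : l1 a B -> Cmod (a n) <= B.
Proof.
  intros H. apply Rle_trans with (2 := l1_rsum a B n 1 H). simpl. rewrite Z.add_0_r. lra.
Qed.

Lemma zsumR_mono (u : Z -> R) (M N : nat) :
  (forall n, 0 <= u n) -> (M <= N)%nat -> zsumR u M <= zsumR u N.
Proof.
  intros Hu H. rewrite !zsum_rsum. apply rsum_sub; [exact Hu|lia|lia].
Qed.

Lemma l1_le (a : Z -> C) (B D : R) : B <= D -> l1 a B -> l1 a D.
Proof. intros H Ha N. specialize (Ha N). lra. Qed.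

Lemma l1_dom (a b : Z -> C) (B : R) :
  (forall n, Cmod (b n) <= Cmod (a n)) -> l1 a B -> l1 b B.
Proof.
  intros H Ha N. apply Rle_trans with (2 := Ha N). apply zsumR_le. intros; apply H.
Qed.

Lemma l1_plus (a b : Z -> C) (B D : R) :
  l1 a B -> l1 b D -> l1 (fun n => Cplus (a n) (b n)) (B + D).
Proof.
  intros Ha Hb N. specialize (Ha N). specialize (Hb N).
  apply Rle_trans with (zsumR (fun n => Cmod (a n) + Cmod (b n)) N).
  - apply zsumR_le. intros; apply Cmod_triangle.
  - rewrite zsumR_plus. lra.
Qed.

Lemma l1_scal (c : C) (a : Z -> C) (B : R) :
  l1 a B -> l1 (fun n => Cmult c (a n)) (Cmod c * B).
Proof.
  intros Ha N. specialize (Ha N).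
  apply Rle_trans with (zsumR (fun n => Cmod c * Cmod (a n)) N).
  - apply zsumR_le. intros; rewrite Cmod_mult; lra.
  - rewrite zsumR_scal. apply Rmult_le_compat_l; [apply Cmod_ge_0|exact Ha].
Qed.

Lemma Rle_eps (x y : R) : (forall e, 0 < e -> x <= y + e) -> x <= y.
Proof.
  intros H. destruct (Rle_dec x y) as [|n]; [assumption|].
  specialize (H ((x - y) / 2) ltac:(lra)). lra.
Qed.

Lemma zsum_lim_le (b : Z -> C) (B : R) (N : nat) :
  (forall e, 0 < e -> exists a : Z -> C, zsumR (fun n => Cmod (a n)) N <= B /\
      forall n, Cmod (Cminus (b n) (a n)) <= e) ->
  zsumR (fun n => Cmod (b n)) N <= B.
Proof.
  intros H. apply Rle_eps. intros e He.
  pose proof (pos_INR N) as HN.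
  destruct (H (e / (2 * INR N + 1))) as [a [Ha Hb]].
  { apply Rdiv_lt_0_compat; lra. }
  apply Rle_trans with (zsumR (fun n => Cmod (a n) + e / (2 * INR N + 1)) N).
  - apply zsumR_le. intros n _.
    replace (b n) with (Cplus (a n) (Cminus (b n) (a n))) by ring.
    eapply Rle_trans; [apply Cmod_triangle|]. specialize (Hb n). lra.
  - rewrite zsumR_plus, zsumR_const.
    replace ((2 * INR N + 1) * (e / (2 * INR N + 1))) with e by (field; lra). lra.
Qed.

(** As in Fatou's lemma: a partial sum sees finitely many coefficients, so uniform closeness of the
    coefficients suffices. *)
Lemma l1_lim (b : Z -> C) (B : R) :
  (forall e, 0 < e -> exists a : Z -> C, l1 a B /\ forall n, Cmod (Cminus (b n) (a n)) <= e) ->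
  l1 b B.
Proof.
  intros H N. apply zsum_lim_le. intros e He.
  destruct (H e He) as [a [Ha Hb]]. exists a. split; [apply Ha|exact Hb].
Qed.

Lemma l1_tail (a : Z -> C) (B e : R) :
  l1 a B -> 0 < e ->
  exists N, forall M, zsumR (fun n => Cmod (a n)) M <= zsumR (fun n => Cmod (a n)) N + e.
Proof.
  intros Ha He. set (u := zsumR (fun n => Cmod (a n))).
  destruct (completeness (fun x => exists M, x = u M)) as [l [Hl1 Hl2]].
  - exists B. intros x [M ->]. apply Ha.
  - exists (u O). exists O. reflexivity.
  - apply NNPP. intros Hn.
    assert (Hb : l <= l - e); [|lra].
    apply Hl2. intros x [M ->].
    destruct (Rle_dec (u M) (l - e)) as [|Hc]; [assumption|exfalso].
    apply Hn. exists M. intros M'.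
    assert (u M' <= l) by (apply Hl1; exists M'; reflexivity).
    fold (u M') (u M). lra.
Qed.

(** * Continuity and means *)

Definition cont (f : R -> C) : Prop := forall t, continuous f t.

Lemma continuous_eps (f : R -> C) (t : R) :
  (forall e, 0 < e -> exists d, 0 < d /\ forall s, Rabs (s - t) < d -> Cmod (Cminus (f s) (f t)) < e) ->
  continuous f t.
Proof.
  intros H. apply filterlim_locally. intros [e He].
  destruct (H e He) as [d [Hd Hs]].
  exists (mkposreal d Hd). intros s Hst. apply C_NormedModule_mixin_compat1.
  apply Hs, Hst.
Qed.

Lemma cont_pair (f : R -> C) :
  (forall t, continuous (fun s => Re (f s)) t) -> (forall t, continuous (fun s => Im (f s)) t) ->
  cont f.
Proof.
  intros H1 H2 t.
  apply (continuous_ext (fun s => (Re (f s), Im (f s)))); [intros s; symmetry; apply surjective_pairing|].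
  apply (continuous_comp_2 (fun s => Re (f s)) (fun s => Im (f s)) (fun x y : R => (x, y))).
  - apply H1.
  - apply H2.
  - apply (continuous_ext (fun z => z)); [intros [x y]; reflexivity|]. apply continuous_id.
Qed.

Lemma cont_Re (f : R -> C) : cont f -> forall t, continuous (fun s => Re (f s)) t.
Proof.
  intros H t. apply (continuous_comp f (fun z : R * R => fst z)); [apply H|apply continuous_fst].
Qed.

Lemma cont_Im (f : R -> C) : cont f -> forall t, continuous (fun s => Im (f s)) t.
Proof.
  intros H t. apply (continuous_comp f (fun z : R * R => snd z)); [apply H|apply continuous_snd].
Qed.

Lemma cont_plus (f g : R -> C) : cont f -> cont g -> cont (fun t => Cplus (f t) (g t)).
Proof.
  intros Hf Hg. apply cont_pair; intros t.
  - apply (continuous_plus (fun s => Re (f s)) (fun s => Re (g s))); apply cont_Re; assumption.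
  - apply (continuous_plus (fun s => Im (f s)) (fun s => Im (g s))); apply cont_Im; assumption.
Qed.

Lemma cont_mult (f g : R -> C) : cont f -> cont g -> cont (fun t => Cmult (f t) (g t)).
Proof.
  intros Hf Hg. apply cont_pair; intros t.
  - apply (continuous_minus (fun s => Re (f s) * Re (g s)) (fun s => Im (f s) * Im (g s)));
      apply (continuous_mult (K := R_AbsRing)); try apply cont_Re; try apply cont_Im; assumption.
  - apply (continuous_plus (fun s => Re (f s) * Im (g s)) (fun s => Im (f s) * Re (g s)));
      apply (continuous_mult (K := R_AbsRing)); try apply cont_Re; try apply cont_Im; assumption.
Qed.

Lemma cont_const (c : C) : cont (fun _ => c).
Proof. intros t. apply continuous_const. Qed.

Lemma cont_RtoC (u : R -> R) : (forall t, continuous u t) -> cont (fun t => RtoC (u t)).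
Proof.
  intros H. apply cont_pair; intros t; [apply H|apply continuous_const].
Qed.

Lemma cont_conj (f : R -> C) : cont f -> cont (fun t => Cconj (f t)).
Proof.
  intros Hf. apply cont_pair; intros t.
  - exact (cont_Re f Hf t).
  - apply (continuous_opp (V := R_NormedModule) (fun s => Im (f s)) t), cont_Im, Hf.
Qed.

Lemma cont_expi (n : Z) : cont (expi n).
Proof.
  apply cont_pair; intros t.
  - apply (continuous_comp (fun s => IZR n * s) cos).
    + apply (continuous_mult (K := R_AbsRing)); [apply continuous_const|apply continuous_id].
    + apply continuous_cos.
  - apply (continuous_comp (fun s => IZR n * s) sin).
    + apply (continuous_mult (K := R_AbsRing)); [apply continuous_const|apply continuous_id].
    + apply continuous_sin.
Qed.

Lemma cont_ext (f g : R -> C) : (forall t, f t = g t) -> cont f -> cont g.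
Proof. intros H Hf. replace g with f; [exact Hf|]. apply functional_extensionality, H. Qed.

Lemma cont_delta (f : R -> C) (t e : R) : cont f -> 0 < e ->
  exists d, 0 < d /\ forall s, Rabs (s - t) < d -> Cmod (Cminus (f s) (f t)) < e.
Proof.
  intros Hf He.
  (* Balls of [C] as a product space are squares; the square of half-side e / sqrt 2 lies in the
     disc of radius e. *)
  assert (He2 : 0 < e / sqrt 2).
  { apply Rdiv_lt_0_compat; [exact He|apply sqrt_lt_R0; lra]. }
  pose proof (proj1 (filterlim_locally f (f t)) (Hf t) (mkposreal _ He2)) as [d Hd].
  exists d. split; [apply cond_pos|]. intros s Hs.
  pose proof (C_NormedModule_mixin_compat2 _ _ _ (Hd s Hs)) as H.
  simpl in H. replace (sqrt 2 * (e / sqrt 2)) with e in H; [exact H|].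
  field. apply Rgt_not_eq, sqrt_lt_R0; lra.
Qed.

Lemma cont_zsum (u : Z -> R -> C) (N : nat) :
  (forall n, cont (u n)) -> cont (fun t => zsumC (fun n => u n t) N).
Proof.
  intros H. unfold zsum. generalize (2 * N)%nat as m; intros m. induction m as [|m IH].
  - apply (cont_ext (u (Z.of_nat 0 - Z.of_nat N)%Z)); [intros; rewrite sum_O; reflexivity|apply H].
  - apply (cont_ext (fun t => Cplus (sum_n (G := C_AbelianMonoid) (fun k => u (Z.of_nat k - Z.of_nat N)%Z t) m)
       (u (Z.of_nat (S m) - Z.of_nat N)%Z t))).
    + intros t. rewrite sum_Sn. reflexivity.
    + apply cont_plus; [exact IH|apply H].
Qed.

Lemma cont_unif_lim (f : R -> C) :
  (forall e, 0 < e -> exists g, cont g /\ forall t, Cmod (Cminus (f t) (g t)) <= e) -> cont f.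
Proof.
  intros H t. apply continuous_eps. intros e He.
  destruct (H (e / 4)) as [g [Hg Hfg]]; [lra|].
  destruct (cont_delta g t (e / 4) Hg) as [d [Hd Hs]]; [lra|].
  exists d. split; [exact Hd|]. intros s Hst.
  replace (Cminus (f s) (f t)) with
    (Cplus (Cminus (f s) (g s)) (Cplus (Cminus (g s) (g t)) (Copp (Cminus (f t) (g t))))) by ring.
  eapply Rle_lt_trans; [apply Cmod_triangle|].
  eapply Rle_lt_trans; [apply Rplus_le_compat_l, Cmod_triangle|].
  rewrite Cmod_opp. pose proof (Hfg s). pose proof (Hfg t). pose proof (Hs s Hst). lra.
Qed.

(** Written so that [distr_of f phi] unfolds to the mean of the product of [f] and [phi]. *)
Definition mean (f : R -> C) : C :=
  Cmult (RtoC (/ (2 * PI))) (RInt (V := C_R_CompleteNormedModule) f 0 (2 * PI)).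

Lemma twoPI_pos : 0 < 2 * PI.
Proof. pose proof PI_RGT_0. lra. Qed.

Lemma mean_is (f : R -> C) (l : C) :
  is_RInt (V := C_R_NormedModule) f 0 (2 * PI) l -> mean f = Cmult (RtoC (/ (2 * PI))) l.
Proof.
  intros H. unfold mean. f_equal. apply (is_RInt_unique (V := C_R_CompleteNormedModule)). exact H.
Qed.

Lemma cont_int (f : R -> C) (a b : R) : cont f ->
  is_RInt (V := C_R_NormedModule) f a b (RInt (fun t => Re (f t)) a b, RInt (fun t => Im (f t)) a b).
Proof.
  intros Hf.
  apply (is_RInt_fct_extend_pair (U := R_NormedModule) (V := R_NormedModule)).
  - apply (RInt_correct (V := R_CompleteNormedModule)), (ex_RInt_continuous (V := R_CompleteNormedModule)).
    intros; apply cont_Re; assumption.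
  - apply (RInt_correct (V := R_CompleteNormedModule)), (ex_RInt_continuous (V := R_CompleteNormedModule)).
    intros; apply cont_Im; assumption.
Qed.

Lemma mean_pair (f : R -> C) : cont f ->
  mean f = Cmult (RtoC (/ (2 * PI)))
    (RInt (fun t => Re (f t)) 0 (2 * PI), RInt (fun t => Im (f t)) 0 (2 * PI)).
Proof. intros Hf. apply mean_is, cont_int, Hf. Qed.

Lemma mean_ext (f g : R -> C) : (forall t, f t = g t) -> mean f = mean g.
Proof. intros H. replace g with f; [reflexivity|]. apply functional_extensionality, H. Qed.

Lemma mean_plus (f g : R -> C) : cont f -> cont g ->
  mean (fun t => Cplus (f t) (g t)) = Cplus (mean f) (mean g).
Proof.
  intros Hf Hg.
  rewrite (mean_pair f Hf), (mean_pair g Hg).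
  rewrite (mean_is (fun t => Cplus (f t) (g t)) _ (is_RInt_plus (V := C_R_NormedModule) _ _ _ _ _ _ (cont_int f 0 (2 * PI) Hf) (cont_int g 0 (2 * PI) Hg))).
  rewrite <- Cmult_plus_distr_l. reflexivity.
Qed.

(** The integral lives in [C] as a real normed module, so complex homogeneity is assembled from real
    scalars and the factor [Ci]. *)
Lemma mean_rscal (c : R) (f : R -> C) : cont f ->
  mean (fun t => Cmult (RtoC c) (f t)) = Cmult (RtoC c) (mean f).
Proof.
  intros Hf. rewrite (mean_pair f Hf).
  rewrite (mean_is (fun t => Cmult (RtoC c) (f t)) (Cmult (RtoC c) (RInt (fun t => Re (f t)) 0 (2 * PI), RInt (fun t => Im (f t)) 0 (2 * PI)))).
  - ring.
  - pose proof (is_RInt_scal (V := C_R_NormedModule) _ _ _ c _ (cont_int f 0 (2 * PI) Hf)) as H.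
    replace (Cmult (RtoC c) (RInt (fun t => Re (f t)) 0 (2 * PI), RInt (fun t => Im (f t)) 0 (2 * PI))) with
     (scal (V := C_R_NormedModule) c (RInt (fun t => Re (f t)) 0 (2 * PI), RInt (fun t => Im (f t)) 0 (2 * PI))).
    + apply (is_RInt_ext (V := C_R_NormedModule)) with (2 := H). intros x _.
      apply injective_projections; simpl; unfold scal; simpl; unfold mult; simpl; ring.
    + apply injective_projections; simpl; unfold scal; simpl; unfold mult; simpl; ring.
Qed.

Lemma mean_iscal (f : R -> C) : cont f -> mean (fun t => Cmult Ci (f t)) = Cmult Ci (mean f).
Proof.
  intros Hf. rewrite (mean_pair f Hf).
  rewrite (mean_pair (fun t => Cmult Ci (f t))).
  2:{ apply cont_mult; [apply cont_const|exact Hf]. }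
  set (I1 := RInt (fun t => Re (f t)) 0 (2 * PI)).
  set (I2 := RInt (fun t => Im (f t)) 0 (2 * PI)).
  replace (RInt (fun t => Re (Ci * f t)%C) 0 (2 * PI)) with (- I2).
  replace (RInt (fun t => Im (Ci * f t)%C) 0 (2 * PI)) with I1.
  - apply injective_projections; simpl; ring.
  - apply RInt_ext. intros; unfold Re, Im; simpl. ring.
  - unfold I2. change (- RInt (fun t => Im (f t)) 0 (2 * PI)) with (opp (RInt (fun t => Im (f t)) 0 (2 * PI))).
    rewrite <- (RInt_opp (V := R_CompleteNormedModule)).
    + apply RInt_ext. intros; unfold Re, Im, opp; simpl. ring.
    + apply (ex_RInt_continuous (V := R_CompleteNormedModule)). intros; apply cont_Im; assumption.
Qed.

Lemma mean_scal (c : C) (f : R -> C) : cont f ->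
  mean (fun t => Cmult c (f t)) = Cmult c (mean f).
Proof.
  intros Hf.
  rewrite (mean_ext _ (fun t => Cplus (Cmult (RtoC (Re c)) (f t)) (Cmult (RtoC (Im c)) (Cmult Ci (f t))))).
  - assert (Hc : forall (k : C) g, cont g -> cont (fun t => Cmult k (g t))).
    { intros; apply cont_mult; [apply cont_const|assumption]. }
    rewrite mean_plus, !mean_rscal, mean_iscal; auto.
    destruct c as [x y]. apply injective_projections; simpl; ring.
  - intros t. destruct c as [x y]. apply injective_projections; simpl; ring.
Qed.

Lemma mean_zsum (u : Z -> R -> C) (N : nat) :
  (forall n, cont (u n)) -> mean (fun t => zsumC (fun n => u n t) N) = zsumC (fun n => mean (u n)) N.
Proof.
  intros H. unfold zsum. generalize (2 * N)%nat as m; intros m.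
  assert (Hc : forall m, cont (fun t => sum_n (G := C_AbelianMonoid) (fun k => u (Z.of_nat k - Z.of_nat N)%Z t) m)).
  { clear m. intros m. induction m as [|m IH].
    - apply (cont_ext (u (Z.of_nat 0 - Z.of_nat N)%Z)); [intros; rewrite sum_O; reflexivity|apply H].
    - apply (cont_ext (fun t => Cplus (sum_n (G := C_AbelianMonoid) (fun k => u (Z.of_nat k - Z.of_nat N)%Z t) m)
         (u (Z.of_nat (S m) - Z.of_nat N)%Z t))).
      + intros t. rewrite sum_Sn. reflexivity.
      + apply cont_plus; [exact IH|apply H]. }
  induction m as [|m IH].
  - rewrite sum_O. apply mean_ext. intros t. rewrite sum_O. reflexivity.
  - rewrite sum_Sn, <- IH. rewrite (mean_ext _ (fun t => Cplus (sum_n (G := C_AbelianMonoid) (fun k => u (Z.of_nat k - Z.of_nat N)%Z t) m)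
         (u (Z.of_nat (S m) - Z.of_nat N)%Z t))).
    + rewrite mean_plus; [reflexivity|apply Hc|apply H].
    + intros t. rewrite sum_Sn. reflexivity.
Qed.

Lemma mean_conj (f : R -> C) : cont f -> mean (fun t => Cconj (f t)) = Cconj (mean f).
Proof.
  intros Hf. rewrite (mean_pair f Hf), (mean_pair _ (cont_conj f Hf)).
  rewrite Cmult_conj.
  replace (RInt (fun t => Im (Cconj (f t))) 0 (2 * PI)) with (- RInt (fun t => Im (f t)) 0 (2 * PI)).
  - change (fun t => Re (Cconj (f t))) with (fun t => Re (f t)).
    apply injective_projections; simpl; ring.
  - change (- RInt (fun t => Im (f t)) 0 (2 * PI)) with (opp (RInt (fun t => Im (f t)) 0 (2 * PI))).
    rewrite <- (RInt_opp (V := R_CompleteNormedModule)); [reflexivity|].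
    apply (ex_RInt_continuous (V := R_CompleteNormedModule)). intros; apply cont_Im; assumption.
Qed.

Lemma mean_const (c : C) : mean (fun _ => c) = c.
Proof.
  rewrite (mean_pair _ (cont_const c)). rewrite !RInt_const.
  destruct c as [x y]. pose proof PI_RGT_0.
  apply injective_projections; simpl; unfold scal; simpl; unfold mult; simpl; field; lra.
Qed.

(* After rotating the mean to the positive axis only a real integral has to be bounded. *)
Lemma mean_bound (f : R -> C) (B : R) : cont f -> (forall t, Cmod (f t) <= B) -> Cmod (mean f) <= B.
Proof.
  intros Hf HB.
  assert (HB0 : 0 <= B) by (apply Rle_trans with (2 := HB 0); apply Cmod_ge_0).
  destruct (Req_EM_T (Cmod (mean f)) 0) as [->|Hn]; [exact HB0|].
  assert (Hp : 0 < Cmod (mean f)) by (pose proof (Cmod_ge_0 (mean f)); lra).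
  set (c := Cconj (mean f)).
  assert (Hcf : cont (fun t => Cmult c (f t))) by (apply cont_mult; [apply cont_const|exact Hf]).
  assert (H : Re (mean (fun t => Cmult c (f t))) = Cmod (mean f) ^ 2).
  { rewrite mean_scal by exact Hf. unfold c. rewrite Cmult_comm, <- Cmod2_conj. 
    reflexivity. }
  rewrite (mean_pair _ Hcf) in H. rewrite re_scal_l in H. unfold Re at 1 in H; cbn [fst] in H.
  assert (HI : RInt (fun t => Re (Cmult c (f t))) 0 (2 * PI) <= (2 * PI) * (Cmod (mean f) * B)).
  { apply (is_RInt_le (fun t => Re (Cmult c (f t))) (fun _ => Cmod (mean f) * B) 0 (2 * PI)).
    - pose proof twoPI_pos; lra.
    - apply (RInt_correct (V := R_CompleteNormedModule)), (ex_RInt_continuous (V := R_CompleteNormedModule)).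
      intros; apply cont_Re; assumption.
    - replace (2 * PI * (Cmod (mean f) * B)) with (scal (2 * PI - 0) (Cmod (mean f) * B)) by (unfold scal; simpl; unfold mult; simpl; ring).
      apply (is_RInt_const (V := R_NormedModule)).
    - intros t _. eapply Rle_trans; [apply Rle_abs|]. eapply Rle_trans; [apply re_le_Cmod|].
      rewrite Cmod_mult. unfold c. rewrite Cmod_conj. apply Rmult_le_compat_l; [apply Cmod_ge_0|apply HB]. }
  apply Rmult_le_reg_l with (Cmod (mean f)); [exact Hp|].
  replace (Cmod (mean f) * Cmod (mean f)) with (Cmod (mean f) ^ 2) by ring.
  rewrite <- H. pose proof twoPI_pos.
  apply Rmult_le_reg_l with (2 * PI); [assumption|]. rewrite <- Rmult_assoc, Rinv_r by lra. lra.
Qed.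

(** * Exponentials and periodicity *)

Lemma expi_plus (m n : Z) (t : R) : expi (m + n) t = Cmult (expi m t) (expi n t).
Proof.
  unfold expi. rewrite plus_IZR, Rmult_plus_distr_r, cos_plus, sin_plus.
  apply injective_projections; simpl; ring.
Qed.

Lemma expi_0 (t : R) : expi 0 t = 1%C.
Proof. unfold expi. rewrite Rmult_0_l, cos_0, sin_0. reflexivity. Qed.

Lemma expi_opp (n : Z) (t : R) : expi (- n) t = Cconj (expi n t).
Proof.
  unfold expi, Cconj; simpl. rewrite opp_IZR, Ropp_mult_distr_l_reverse, cos_neg, sin_neg. reflexivity.
Qed.

Lemma Cmod_expi (n : Z) (t : R) : Cmod (expi n t) = 1.
Proof.
  unfold expi, Cmod; simpl. rewrite !Rmult_1_r. 
  pose proof (sin2_cos2 (IZR n * t)) as H. unfold Rsqr in H.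
  rewrite Rplus_comm, H. apply sqrt_1.
Qed.

Lemma periodic_Z (f : R -> C) (t : R) (n : Z) : periodic f -> f (t + IZR n * (2 * PI)) = f t.
Proof.
  intros H.
  assert (Hn : forall (k : nat) s, f (s + INR k * (2 * PI)) = f s).
  { intros k. induction k as [|k IH]; intros s.
    - simpl. f_equal. ring.
    - rewrite S_INR. replace (s + (INR k + 1) * (2 * PI)) with (s + INR k * (2 * PI) + 2 * PI) by ring.
      rewrite H. apply IH. }
  destruct (Z_le_gt_dec 0 n) as [Hz|Hz].
  - rewrite <- (Z2Nat.id n Hz), <- INR_IZR_INZ. apply Hn.
  - rewrite <- (Hn (Z.to_nat (- n))). rewrite INR_IZR_INZ, Z2Nat.id by lia. rewrite opp_IZR.
    f_equal. ring.
Qed.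

Lemma periodic_expi (n : Z) : periodic (expi n).
Proof.
  intros t. unfold expi.
  assert (H : forall k : Z, cos (IZR n * t + IZR k * (2 * PI)) = cos (IZR n * t) /\
      sin (IZR n * t + IZR k * (2 * PI)) = sin (IZR n * t)).
  { intros k.
    assert (Hp : periodic (fun s => (cos s, sin s) : C)).
    { intros s. rewrite cos_plus, sin_plus, cos_2PI, sin_2PI. f_equal; ring. }
    pose proof (periodic_Z _ (IZR n * t) k Hp) as E. simpl in E. injection E; auto. }
  destruct (H n) as [H1 H2]. rewrite Rmult_plus_distr_l, H1, H2. reflexivity.
Qed.

Lemma mean_expi (n : Z) : n <> 0%Z -> mean (expi n) = 0%C.
Proof.
  intros Hn. assert (Hr : IZR n <> 0) by (apply eq_IZR_contrapositive; exact Hn).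
  rewrite (mean_is _ (0, 0)); [apply injective_projections; simpl; ring|].
  pose proof (periodic_expi n 0) as HP. rewrite Rplus_0_l in HP. 
  unfold expi in HP. injection HP as Hc Hs.
  apply (is_RInt_fct_extend_pair (U := R_NormedModule) (V := R_NormedModule)).
  - replace 0 with (minus (sin (IZR n * (2 * PI)) / IZR n) (sin (IZR n * 0) / IZR n)) at 2.
    2:{ rewrite Hs. unfold minus, plus, opp; simpl. ring. }
    apply (is_RInt_derive (V := R_CompleteNormedModule) (fun t => sin (IZR n * t) / IZR n)).
    + intros x _. simpl. auto_derive; [auto|]. field. exact Hr.
    + intros x _. apply (cont_Re _ (cont_expi n)).
  - replace 0 with (minus (- cos (IZR n * (2 * PI)) / IZR n) (- cos (IZR n * 0) / IZR n)) at 2.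
    2:{ rewrite Hc. unfold minus, plus, opp; simpl. ring. }
    apply (is_RInt_derive (V := R_CompleteNormedModule) (fun t => - cos (IZR n * t) / IZR n)).
    + intros x _. simpl. auto_derive; [auto|]. field. exact Hr.
    + intros x _. apply (cont_Im _ (cont_expi n)).
Qed.

(** * Fourier coefficients *)

(** Raising [N] shifts the enumeration and adds a term at each end, so a first summand is peeled off
    as well as a last one. *)
Lemma zsum_S {G : AbelianMonoid} (u : Z -> G) (N : nat) :
  zsum u (S N) = plus (zsum u N) (plus (u (- Z.of_nat (S N))%Z) (u (Z.of_nat (S N)))).
Proof.
  assert (Hs : forall (v : nat -> G) m, sum_n v (S m) = plus (v O) (sum_n (fun k => v (S k)) m)).
  { intros v m. induction m as [|m IH].
    - rewrite sum_Sn, !sum_O. reflexivity.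
    - rewrite sum_Sn, IH, sum_Sn, plus_assoc. reflexivity. }
  unfold zsum. replace (2 * S N)%nat with (S (S (2 * N))) by lia.
  rewrite sum_Sn, Hs.
  rewrite (plus_comm (u _) (sum_n _ _)), <- plus_assoc. f_equal.
  - apply sum_n_ext. intros k. f_equal. lia.
  - f_equal; f_equal; lia.
Qed.

Definition cut {G : AbelianMonoid} (N : nat) (u : Z -> G) (n : Z) : G :=
  if Z_le_dec (Z.abs n) (Z.of_nat N) then u n else zero.

Lemma cut_in {G : AbelianMonoid} (N : nat) (u : Z -> G) (n : Z) :
  (Z.abs n <= Z.of_nat N)%Z -> cut N u n = u n.
Proof. intros H. unfold cut. destruct Z_le_dec; [reflexivity|contradiction]. Qed.

Lemma cut_out {G : AbelianMonoid} (N : nat) (u : Z -> G) (n : Z) :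
  (Z.of_nat N < Z.abs n)%Z -> cut N u n = zero.
Proof. intros H. unfold cut. destruct Z_le_dec; [lia|reflexivity]. Qed.

Lemma zsum_cut {G : AbelianMonoid} (u : Z -> G) (N M : nat) :
  (N <= M)%nat -> zsum (cut N u) M = zsum u N.
Proof.
  intros H. induction H as [|M HM IH].
  - apply zsum_ext. intros n Hn. apply cut_in, Hn.
  - rewrite zsum_S, IH, !cut_out by lia. rewrite !plus_zero_r. reflexivity.
Qed.

Lemma Cmod_sub_sym (x y : C) : Cmod (Cminus x y) = Cmod (Cminus y x).
Proof. rewrite <- Cmod_opp. f_equal. ring. Qed.

Lemma Cmod_tri3 (x y z : C) : Cmod (Cminus x z) <= Cmod (Cminus x y) + Cmod (Cminus y z).
Proof.
  replace (Cminus x z) with (Cplus (Cminus x y) (Cminus y z)) by ring. apply Cmod_triangle.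
Qed.

(** Completeness for uniform convergence of bare functions; continuity and periodicity of the limit
    are recovered separately. *)
Lemma unif_complete (F : nat -> R -> C) :
  (forall e, 0 < e -> exists N, forall M, (N <= M)%nat -> forall t, Cmod (Cminus (F M t) (F N t)) <= e) ->
  exists f, forall e, 0 < e -> exists N, forall M, (N <= M)%nat -> forall t,
    Cmod (Cminus (f t) (F M t)) <= e.
Proof.
  intros HF.
  assert (Hc : forall (g : C -> R), (forall x y, Rabs (g x - g y) <= Cmod (Cminus x y)) ->
    forall t, ex_finite_lim_seq (fun M => g (F M t))).
  { intros g Hg t. apply ex_lim_seq_cauchy_corr. intros [e He].
    destruct (HF (e / 3)) as [N HN]; [lra|]. exists N. intros n m Hn Hm. simpl.
    eapply Rle_lt_trans; [apply Hg|].
    eapply Rle_lt_trans; [apply (Cmod_tri3 _ (F N t))|].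
    rewrite (Cmod_sub_sym (F N t)). pose proof (HN n Hn t). pose proof (HN m Hm t). lra. }
  set (f := fun t => (real (Lim_seq (fun M => Re (F M t))), real (Lim_seq (fun M => Im (F M t)))) : C).
  exists f.
  assert (Hp : forall t e, 0 < e -> exists N, forall M, (N <= M)%nat -> Cmod (Cminus (f t) (F M t)) <= e).
  { intros t e He.
    assert (H1 : ex_finite_lim_seq (fun M => Re (F M t))).
    { apply (Hc Re). intros x y. eapply Rle_trans; [|apply re_le_Cmod]. simpl. apply Rle_refl. }
    assert (H2 : ex_finite_lim_seq (fun M => Im (F M t))).
    { apply (Hc Im). intros x y. eapply Rle_trans; [|apply Rle_trans with (2 := Rmax_Cmod _); apply Rmax_r].
      simpl. apply Rle_refl. }
    apply Lim_seq_correct' in H1. apply Lim_seq_correct' in H2.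
    apply is_lim_seq_spec in H1. apply is_lim_seq_spec in H2.
    assert (He2 : 0 < e / 2) by lra.
    destruct (H1 (mkposreal _ He2)) as [N1 HN1]. destruct (H2 (mkposreal _ He2)) as [N2 HN2].
    exists (max N1 N2). intros M HM.
    specialize (HN1 M ltac:(lia)). specialize (HN2 M ltac:(lia)). simpl in HN1, HN2.
    rewrite Cmod_sub_sym. unfold f.
    replace (Cminus (F M t) (real (Lim_seq (fun M => Re (F M t))), real (Lim_seq (fun M => Im (F M t)))))
      with (Cplus (RtoC (Re (F M t) - real (Lim_seq (fun M => Re (F M t)))))
         (Cmult Ci (RtoC (Im (F M t) - real (Lim_seq (fun M => Im (F M t))))))).
    - eapply Rle_trans; [apply Cmod_triangle|]. rewrite Cmod_mult, Cmod_Ci, !Cmod_R. lra.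
    - destruct (F M t) as [x y]. apply injective_projections; simpl; unfold Re, Im; simpl; ring. }
  intros e He. destruct (HF (e / 2)) as [N HN]; [lra|]. exists N. intros M HM t.
  apply Rle_eps. intros e' He'.
  destruct (Hp t e' He') as [N' HN'].
  pose proof (HN' (max N N') ltac:(lia)) as Ha.
  pose proof (HN (max N N') ltac:(lia) t) as Hb. pose proof (HN M HM t) as Hd.
  pose proof (Cmod_tri3 (f t) (F (max N N') t) (F M t)) as H1.
  pose proof (Cmod_tri3 (F (max N N') t) (F N t) (F M t)) as H2.
  rewrite (Cmod_sub_sym (F N t) (F M t)) in H2. lra.
Qed.

(** Convertible to [fourier (distr_of f) n], so bounds on coefficients transfer to distributions
    without a rewriting step. *)
Definition hat (f : R -> C) (n : Z) : C := mean (fun t => Cmult (f t) (expi (- n) t)).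

Lemma cont_hat (f : R -> C) (n : Z) : cont f -> cont (fun t => Cmult (f t) (expi n t)).
Proof. intros H. apply cont_mult; [exact H|apply cont_expi]. Qed.

Lemma hat_ext (f g : R -> C) (n : Z) : (forall t, f t = g t) -> hat f n = hat g n.
Proof. intros H. apply mean_ext. intros t. rewrite H. reflexivity. Qed.

Lemma hat_plus (f g : R -> C) (n : Z) : cont f -> cont g ->
  hat (fun t => Cplus (f t) (g t)) n = Cplus (hat f n) (hat g n).
Proof.
  intros Hf Hg. unfold hat. rewrite <- mean_plus by (apply cont_hat; assumption).
  apply mean_ext. intros t. ring.
Qed.

Lemma hat_scal (c : C) (f : R -> C) (n : Z) : cont f ->
  hat (fun t => Cmult c (f t)) n = Cmult c (hat f n).
Proof.
  intros Hf. unfold hat. rewrite <- mean_scal by (apply cont_hat; assumption).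
  apply mean_ext. intros t. ring.
Qed.

Lemma hat_minus (f g : R -> C) (n : Z) : cont f -> cont g ->
  hat (fun t => Cminus (f t) (g t)) n = Cminus (hat f n) (hat g n).
Proof.
  intros Hf Hg.
  rewrite (hat_ext _ (fun t => Cplus (f t) (Cmult (RtoC (-1)) (g t)))).
  - rewrite hat_plus, hat_scal; [ring|assumption|assumption|].
    apply cont_mult; [apply cont_const|assumption].
  - intros t. ring.
Qed.

Lemma hat_bound (f : R -> C) (B : R) (n : Z) : cont f -> (forall t, Cmod (f t) <= B) ->
  Cmod (hat f n) <= B.
Proof.
  intros Hf HB. apply mean_bound; [apply cont_hat, Hf|].
  intros t. rewrite Cmod_mult, Cmod_expi, Rmult_1_r. apply HB.
Qed.

Lemma hat_shift (k : Z) (f : R -> C) (n : Z) :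
  hat (fun t => Cmult (expi k t) (f t)) n = hat f (n - k).
Proof.
  apply mean_ext. intros t. replace (- (n - k))%Z with (k + - n)%Z by ring.
  rewrite expi_plus. ring.
Qed.

Lemma hat_conj (f : R -> C) (n : Z) : cont f ->
  hat (fun t => Cconj (f t)) n = Cconj (hat f (- n)).
Proof.
  intros Hf. unfold hat. rewrite <- mean_conj by (apply cont_hat; assumption).
  apply mean_ext. intros t. rewrite Cmult_conj, expi_opp, Z.opp_involutive. reflexivity.
Qed.

Lemma hat_const (c : C) (n : Z) : hat (fun _ => c) n = if Z.eq_dec n 0 then c else 0%C.
Proof.
  unfold hat. rewrite mean_scal by apply cont_expi.
  destruct Z.eq_dec as [->|Hn].
  - rewrite (mean_ext _ (fun _ => 1%C)); [rewrite mean_const; ring|intros; apply expi_0].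
  - change (mean (fun t => expi (- n) t)) with (mean (expi (- n))).
    rewrite mean_expi by lia. ring.
Qed.

Lemma hat_expi (k n : Z) : hat (expi k) n = if Z.eq_dec n k then 1%C else 0%C.
Proof.
  rewrite (hat_ext _ (fun t => Cmult (expi k t) 1%C)) by (intros; ring).
  rewrite hat_shift, hat_const. destruct (Z.eq_dec (n - k) 0), (Z.eq_dec n k); try reflexivity; lia.
Qed.

Lemma cont_trig (N : nat) (a : Z -> C) : cont (trig_poly N a).
Proof.
  unfold trig_poly. apply (cont_zsum (fun n t => Cmult (a n) (expi n t))).
  intros n. apply cont_mult; [apply cont_const|apply cont_expi].
Qed.

Lemma trig_mult (N : nat) (a : Z -> C) (f : R -> C) (t : R) :
  Cmult (trig_poly N a t) (f t) = zsumC (fun k => Cmult (a k) (Cmult (expi k t) (f t))) N.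
Proof.
  unfold trig_poly. rewrite Cmult_comm, <- zsumC_scal. apply zsum_ext. intros n _. Cring.
Qed.

Lemma hat_trig_mult (N : nat) (a : Z -> C) (f : R -> C) (n : Z) : cont f ->
  hat (fun t => Cmult (trig_poly N a t) (f t)) n =
  zsumC (fun k => Cmult (a k) (hat f (n - k))) N.
Proof.
  intros Hf. unfold hat at 1.
  rewrite (mean_ext _ (fun t => zsumC (fun k => Cmult (a k) (Cmult (expi k t) (f t) * expi (- n) t)) N)).
  - rewrite (mean_zsum (fun k t => Cmult (a k) (Cmult (expi k t) (f t) * expi (- n) t))).
    + apply zsum_ext. intros k _. rewrite mean_scal.
      * rewrite <- hat_shift. reflexivity.
      * apply cont_hat, cont_mult; [apply cont_expi|exact Hf].
    + intros k. apply cont_mult; [apply cont_const|]. apply cont_hat, cont_mult; [apply cont_expi|exact Hf].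
  - intros t. rewrite trig_mult, Cmult_comm, <- zsumC_scal. apply zsum_ext. intros; Cring.
Qed.

Lemma zsumC_0 (u : Z -> C) (N : nat) :
  (forall n, (Z.abs n <= Z.of_nat N)%Z -> u n = RtoC 0) -> zsumC u N = RtoC 0.
Proof.
  intros H. rewrite (zsum_ext _ (fun n => Cmult (RtoC 0) (u n))).
  - rewrite zsumC_scal. Cring.
  - intros n Hn. rewrite (H n Hn). Cring.
Qed.

Lemma zsumC_single (u : Z -> C) (n : Z) (N : nat) :
  (forall k, k <> n -> u k = 0%C) ->
  zsumC u N = if Z_le_dec (Z.abs n) (Z.of_nat N) then u n else 0%C.
Proof.
  intros H. induction N as [|N IH].
  - unfold zsum. simpl. rewrite sum_O. simpl. destruct Z_le_dec as [Hn|Hn].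
    + f_equal. lia.
    + apply H. lia.
  - rewrite zsum_S, IH.
    destruct (Z_le_dec (Z.abs n) (Z.of_nat N)) as [H1|H1], (Z_le_dec (Z.abs n) (Z.of_nat (S N))) as [H2|H2]; try lia.
    + rewrite (H (- Z.of_nat (S N))%Z), (H (Z.of_nat (S N))) by lia.
      change (Cplus (u n) (Cplus 0 0) = u n). ring.
    + destruct (Z_le_dec 0 n).
      * replace n with (Z.of_nat (S N)) by lia. rewrite (H (- Z.of_nat (S N))%Z) by lia.
        change (Cplus 0 (Cplus 0 (u (Z.of_nat (S N)))) = u (Z.of_nat (S N))). ring.
      * replace n with (- Z.of_nat (S N))%Z by lia. rewrite (H (Z.of_nat (S N))%Z) by lia.
        change (Cplus 0 (Cplus (u (- Z.of_nat (S N))%Z) 0) = u (- Z.of_nat (S N))%Z). ring.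
    + rewrite (H (- Z.of_nat (S N))%Z), (H (Z.of_nat (S N))) by lia.
      change (Cplus 0 (Cplus 0 0) = 0%C). ring.
Qed.

Lemma hat_trig (N : nat) (a : Z -> C) (n : Z) :
  hat (trig_poly N a) n = cut (G := C_AbelianMonoid) N a n.
Proof.
  rewrite (hat_ext _ (fun t => Cmult (trig_poly N a t) 1%C)) by (intros; ring).
  rewrite hat_trig_mult by apply cont_const.
  rewrite (zsumC_single _ n).
  - unfold cut. destruct Z_le_dec; [|reflexivity]. rewrite hat_const.
    destruct Z.eq_dec; [ring|lia].
  - intros k Hk. rewrite hat_const. destruct Z.eq_dec; [lia|ring].
Qed.

Lemma periodic_trig (N : nat) (a : Z -> C) : periodic (trig_poly N a).
Proof. intros t. apply zsum_ext. intros n _. rewrite periodic_expi. reflexivity. Qed.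

Lemma period_reduce (t : R) : exists n : Z, 0 <= t + IZR n * (2 * PI) <= 2 * PI.
Proof.
  pose proof twoPI_pos as H.
  destruct (archimed (t / (2 * PI))) as [H1 H2].
  exists (- (up (t / (2 * PI)) - 1))%Z.
  assert (E : t = t / (2 * PI) * (2 * PI)) by (field; lra).
  rewrite opp_IZR, minus_IZR.
  set (x := t / (2 * PI)) in *. set (k := IZR (up x)) in *.
  replace (t + - (k - 1) * (2 * PI)) with ((x - k + 1) * (2 * PI)) by (rewrite E at 1; ring).
  split; [apply Rmult_le_pos; lra|].
  rewrite <- (Rmult_1_l (2 * PI)) at 2. apply Rmult_le_compat_r; lra.
Qed.

Lemma continuous_Cmod2 (f : R -> C) : cont f -> forall t, continuous (fun s => Cmod (f s) ^ 2) t.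
Proof.
  intros Hf t.
  apply (continuous_ext (fun s => Re (f s) * Re (f s) + Im (f s) * Im (f s))).
  - intros s. rewrite Cmod2_alt. simpl. ring.
  - apply (continuous_plus (V := R_NormedModule));
      apply (continuous_mult (K := R_AbsRing)); try apply cont_Re; try apply cont_Im; assumption.
Qed.

Lemma cont_bounded (f : R -> C) : periodic f -> cont f -> exists B, forall t, Cmod (f t) <= B.
Proof.
  intros Hp Hf.
  destruct (continuity_ab_maj (fun s => Cmod (f s) ^ 2) 0 (2 * PI)) as [x [Hx _]].
  - pose proof twoPI_pos; lra.
  - intros c _. apply continuity_pt_filterlim, continuous_Cmod2, Hf.
  - exists (Cmod (f x)). intros t. destruct (period_reduce t) as [n Hn].
    rewrite <- (periodic_Z f t n Hp). specialize (Hx _ Hn). simpl in Hx.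
    apply Rsqr_incr_0; [unfold Rsqr; lra|apply Cmod_ge_0|apply Cmod_ge_0].
Qed.

(** * Uniqueness and balls of the Wiener algebra *)

Lemma cos_le_away (d x : R) : 0 <= d -> d <= x -> x <= 2 * PI - d -> cos x <= cos d.
Proof.
  intros H0 H1 H2. destruct (Rle_dec x PI) as [Hx|Hx].
  - apply cos_decr_1; lra.
  - replace (cos x) with (cos (2 * PI - x)).
    + apply cos_decr_1; lra.
    + rewrite cos_minus, cos_2PI, sin_2PI. ring.
Qed.

Lemma cos_Rabs (x : R) : cos (Rabs x) = cos x.
Proof. unfold Rabs. destruct Rcase_abs; [apply cos_neg|reflexivity]. Qed.

Lemma pow_large (m K eta : R) : 0 < m -> 0 < eta -> exists n, K < m * (1 + eta) ^ n.
Proof.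
  intros Hm He.
  destruct (Pow_x_infinity (1 + eta)) with (b := (Rabs K + 1) / m) as [n Hn].
  - rewrite Rabs_pos_eq; lra.
  - exists n. specialize (Hn n (le_n n)). rewrite Rabs_pos_eq in Hn by (apply pow_le; lra).
    apply Rge_le in Hn.
    apply Rmult_le_compat_l with (r := m) in Hn; [|lra].
    replace (m * ((Rabs K + 1) / m)) with (Rabs K + 1) in Hn by (field; lra).
    pose proof (Rle_abs K). lra.
Qed.

Lemma RInt_ge_const (u : R -> R) (a b c : R) : a <= b ->
  (forall t, continuous u t) -> (forall t, a <= t <= b -> c <= u t) -> c * (b - a) <= RInt u a b.
Proof.
  intros Hab Hu Hc.
  apply (is_RInt_le (fun _ => c) u a b).
  - exact Hab.
  - replace (c * (b - a)) with (scal (b - a) c) by (unfold scal; simpl; unfold mult; simpl; ring).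
    apply (is_RInt_const (V := R_NormedModule)).
  - apply (RInt_correct (V := R_CompleteNormedModule)), (ex_RInt_continuous (V := R_CompleteNormedModule)).
    intros; apply Hu.
  - intros t Ht. apply Hc. lra.
Qed.

Lemma cont_pow (f : R -> C) (n : nat) : cont f -> cont (fun t => Cpow (f t) n).
Proof.
  intros Hf. induction n as [|n IH]; [exact (cont_const (RtoC 1))|exact (cont_mult f _ Hf IH)].
Qed.

(* Integrating against [q^n] with [q t = 1 + cos (t - t0) - cos d], which exceeds 1 near [t0]
   only, picks out the value at [t0]. *)
Lemma hat_zero_interior (f : R -> C) (t0 : R) : periodic f -> cont f -> (forall n, hat f n = 0%C) ->
  0 < t0 < 2 * PI -> f t0 = 0%C.
Proof.
  intros Hp Hf H0 Ht0. apply NNPP. intros Hn.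
  (* This rotation makes the value at [t0] real and positive, so real parts suffice below. *)
  set (F := fun t => Cmult (Cconj (f t0)) (f t)).
  assert (HF : cont F) by (apply cont_mult; [apply cont_const|exact Hf]).
  assert (HF0 : forall n, hat F n = 0%C).
  { intros n. unfold F. rewrite hat_scal, H0 by exact Hf. ring. }
  assert (Hpos : 0 < Re (F t0)).
  { unfold F. rewrite Cmult_comm, <- Cmod2_conj. unfold Re; simpl.
    apply Cmod_gt_0 in Hn. apply Rmult_lt_0_compat; lra. }
  set (m := Re (F t0) / 2). assert (Hm : 0 < m) by (unfold m; lra).
  destruct (cont_delta F t0 m HF Hm) as [d0 [Hd0 Hd]].
  set (d := Rmin d0 (Rmin t0 (2 * PI - t0)) / 2).
  assert (Hdp : 0 < d /\ d < d0 /\ d < t0 /\ d < 2 * PI - t0).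
  { assert (0 < Rmin d0 (Rmin t0 (2 * PI - t0))) by (repeat apply Rmin_glb_lt; lra).
    pose proof (Rmin_l d0 (Rmin t0 (2 * PI - t0))). pose proof (Rmin_r d0 (Rmin t0 (2 * PI - t0))).
    pose proof (Rmin_l t0 (2 * PI - t0)). pose proof (Rmin_r t0 (2 * PI - t0)). unfold d. lra. }
  clearbody d. destruct Hdp as [Hd1 [Hd2 [Hd3 Hd4]]].
  destruct (cont_bounded F) as [B HB]; [|exact HF|].
  { intros t. unfold F. rewrite Hp. reflexivity. }
  set (q := fun t => 1 + cos (t - t0) - cos d).
  assert (Hqc : forall t, continuous q t).
  { intros t. apply (ex_derive_continuous (V := R_NormedModule)). unfold q. auto_derive. exact I. }
  assert (Hqe : forall t, RtoC (q t) = Cplus (RtoC (1 - cos d))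
      (Cplus (Cmult (Cmult (/ 2) (expi (-1) t0)) (expi 1 t)) (Cmult (Cmult (/ 2) (expi 1 t0)) (expi (-1) t)))).
  { intros t. unfold q, expi. rewrite cos_minus.
    replace (-1 * t0) with (- t0) by ring. replace (-1 * t) with (- t) by ring.
    rewrite !Rmult_1_l, !cos_neg, !sin_neg.
    apply injective_projections; simpl; field. }
  (* [q] is a trigonometric polynomial of degree one: multiplying by it combines shifted
     coefficients, all of which vanish. *)
  assert (Hqn : forall n, cont (fun t => Cmult (Cpow (RtoC (q t)) n) (F t)) /\
     forall k, hat (fun t => Cmult (Cpow (RtoC (q t)) n) (F t)) k = 0%C).
  { intros n. induction n as [|n [IHc IH]].
    - split.
      + apply cont_mult; [exact (cont_const (RtoC 1))|exact HF].
      + intros k. rewrite <- (HF0 k). apply hat_ext. intros t. simpl. ring.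
    - split.
      + apply cont_mult; [|exact HF]. apply (cont_pow (fun t => RtoC (q t))), cont_RtoC, Hqc.
      + intros k.
        set (G := fun t => Cmult (Cpow (RtoC (q t)) n) (F t)) in *.
        assert (HcG : forall j, cont (fun t => Cmult (expi j t) (G t))).
        { intros j. apply cont_mult; [apply cont_expi|exact IHc]. }
        assert (Hsc : forall (c : C) g, cont g -> cont (fun t => Cmult c (g t))).
        { intros c g Hg. apply cont_mult; [apply cont_const|exact Hg]. }
        rewrite (hat_ext _ (fun t => Cplus (Cmult (RtoC (1 - cos d)) (G t))
           (Cplus (Cmult (Cmult (/ 2) (expi (-1) t0)) (Cmult (expi 1 t) (G t)))
              (Cmult (Cmult (/ 2) (expi 1 t0)) (Cmult (expi (-1) t) (G t)))))).
        * rewrite hat_plus, hat_plus, !hat_scal, !hat_shift, !IH; auto; [ring|].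
          apply cont_plus; auto.
        * intros t. unfold G. simpl Cpow. rewrite Hqe. ring. }
  set (eta := cos (d / 2) - cos d).
  assert (Heta : 0 < eta).
  { assert (cos d < cos (d / 2)); [|unfold eta; lra]. apply cos_decreasing_1; lra. }
  (* On the interval of length [d] centred at [t0] the integrand will be at least m (1 + eta)^n;
     this has to beat the loss elsewhere, at most 2 pi B. *)
  destruct (pow_large (m * d) (2 * PI * B) eta) as [n Hbig]; [apply Rmult_lt_0_compat; lra|exact Heta|].
  set (u := fun t => q t ^ n * Re (F t)).
  assert (Hre : forall t, Re (Cmult (Cpow (RtoC (q t)) n) (F t)) = u t).
  { intros t. rewrite <- RtoC_pow. rewrite re_scal_l. reflexivity. }
  assert (Huc : forall t, continuous u t).
  { intros t. apply (continuous_ext (fun t => Re (Cmult (Cpow (RtoC (q t)) n) (F t)))); [exact Hre|].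
    apply cont_Re, Hqn. }
  assert (Hint : RInt u 0 (2 * PI) = 0).
  { destruct (Hqn n) as [Hc Hz]. specialize (Hz 0%Z). unfold hat in Hz.
    rewrite (mean_ext _ (fun t => Cmult (Cpow (RtoC (q t)) n) (F t))) in Hz.
    2:{ intros t. simpl Z.opp. rewrite expi_0. ring. }
    rewrite (mean_pair _ Hc) in Hz. apply (f_equal Re) in Hz. rewrite re_scal_l in Hz.
    unfold Re at 1 in Hz; cbn [fst] in Hz. unfold Re at 2 in Hz; simpl in Hz.
    rewrite (RInt_ext _ u) in Hz by (intros; apply Hre).
    apply Rmult_integral in Hz. destruct Hz as [Hz|Hz]; [|exact Hz].
    pose proof twoPI_pos as Hpi. apply Rinv_neq_0_compat in Hz; [destruct Hz|lra]. }
  assert (HB0 : 0 <= B) by (apply Rle_trans with (2 := HB 0); apply Cmod_ge_0).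
  assert (Hnear : forall t, Rabs (t - t0) <= d -> 1 <= q t /\ m <= Re (F t)).
  { intros t Ht. split.
    - unfold q. rewrite <- cos_Rabs. assert (cos d <= cos (Rabs (t - t0))); [|lra].
      apply cos_decr_1; pose proof (Rabs_pos (t - t0)); lra.
    - specialize (Hd t ltac:(lra)).
      assert (Hr : Rabs (Re (Cminus (F t) (F t0))) < m) by (eapply Rle_lt_trans; [apply re_le_Cmod|exact Hd]).
      change (Re (Cminus (F t) (F t0))) with (Re (F t) - Re (F t0)) in Hr.
      apply Rabs_def2 in Hr. unfold m in *. lra. }
  (* Near [t0] the integrand is nonnegative, and away from it |q| <= 1; the lower bound is therefore
     free of [n]. *)
  assert (Hlow : forall t, 0 <= t <= 2 * PI -> - B <= u t).
  { intros t Ht. destruct (Rle_dec (Rabs (t - t0)) d) as [Hc|Hc].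
    - destruct (Hnear t Hc) as [H1 H2]. assert (0 <= u t); [|lra].
      apply Rmult_le_pos; [apply pow_le|]; lra.
    - assert (Hq1 : Rabs (q t) <= 1).
      { apply Rabs_le. unfold q. rewrite <- (cos_Rabs (t - t0)).
        assert (cos (Rabs (t - t0)) <= cos d).
        { apply cos_le_away; [lra|lra|]. apply Rabs_le. lra. }
        pose proof (COS_bound (Rabs (t - t0))). pose proof (COS_bound d). lra. }
      assert (Hab : Rabs (u t) <= B).
      { unfold u. rewrite Rabs_mult, <- RPow_abs. rewrite <- (Rmult_1_l B).
        apply Rmult_le_compat; [apply pow_le, Rabs_pos|apply Rabs_pos| |].
        - rewrite <- (pow1 n). apply pow_incr. split; [apply Rabs_pos|exact Hq1].
        - eapply Rle_trans; [apply re_le_Cmod|apply HB]. }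
      apply Rabs_le_between in Hab. lra. }
  assert (Hhigh : forall t, t0 - d / 2 <= t <= t0 + d / 2 -> m * (1 + eta) ^ n <= u t).
  { intros t Ht.
    assert (Hc : Rabs (t - t0) <= d / 2) by (apply Rabs_le; lra).
    destruct (Hnear t ltac:(lra)) as [H1 H2]. unfold u. rewrite Rmult_comm.
    assert (Hq2 : 1 + eta <= q t).
    { unfold q, eta. rewrite <- (cos_Rabs (t - t0)).
      assert (cos (d / 2) <= cos (Rabs (t - t0))); [|lra].
      apply cos_decr_1; pose proof (Rabs_pos (t - t0)); lra. }
    apply Rmult_le_compat; [apply pow_le; lra|lra| |lra].
    apply pow_incr. lra. }
  assert (Hex : forall a b, ex_RInt (V := R_NormedModule) u a b).
  { intros a b. apply (ex_RInt_continuous (V := R_CompleteNormedModule)). intros; apply Huc. }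
  rewrite <- (RInt_Chasles (V := R_CompleteNormedModule) u 0 (t0 - d / 2) (2 * PI)) in Hint by apply Hex.
  rewrite <- (RInt_Chasles (V := R_CompleteNormedModule) u (t0 - d / 2) (t0 + d / 2) (2 * PI)) in Hint by apply Hex.
  unfold plus in Hint; simpl in Hint.
  pose proof (RInt_ge_const u 0 (t0 - d / 2) (- B) ltac:(lra) Huc ltac:(intros; apply Hlow; lra)) as I1.
  pose proof (RInt_ge_const u (t0 - d / 2) (t0 + d / 2) _ ltac:(lra) Huc Hhigh) as I2.
  pose proof (RInt_ge_const u (t0 + d / 2) (2 * PI) (- B) ltac:(lra) Huc ltac:(intros; apply Hlow; lra)) as I3.
  assert (0 <= B * d) by (apply Rmult_le_pos; lra).
  nra.
Qed.

Lemma hat_zero (f : R -> C) : periodic f -> cont f -> (forall n, hat f n = 0%C) -> forall t, f t = 0%C.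
Proof.
  intros Hp Hf H0 t. destruct (period_reduce t) as [n Hn].
  rewrite <- (periodic_Z f t n Hp).
  set (s := t + IZR n * (2 * PI)) in *. clearbody s. pose proof twoPI_pos as Hpi.
  (* The kernel argument needs a neighbourhood of the point inside [0, 2 pi]; the endpoint is
     reached by continuity. *)
  assert (H00 : f 0 = 0%C).
  { apply NNPP. intros Hne. apply Cmod_gt_0 in Hne.
    destruct (cont_delta f 0 (Cmod (f 0)) Hf Hne) as [d [Hd Hs]].
    set (r := Rmin d (2 * PI) / 2).
    assert (Hr : 0 < r /\ r < d /\ r < 2 * PI).
    { pose proof (Rmin_l d (2 * PI)). pose proof (Rmin_r d (2 * PI)).
      assert (0 < Rmin d (2 * PI)) by (apply Rmin_glb_lt; lra). unfold r. lra. }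
    specialize (Hs r). rewrite (hat_zero_interior f r Hp Hf H0) in Hs by lra.
    rewrite Cmod_sub_sym in Hs.
    replace (Cminus (f 0) 0) with (f 0) in Hs by ring.
    rewrite Rminus_0_r, Rabs_pos_eq in Hs by lra. lra. }
  destruct (Req_EM_T s 0) as [->|H1]; [exact H00|].
  destruct (Req_EM_T s (2 * PI)) as [->|H2].
  - rewrite <- (Rplus_0_l (2 * PI)), Hp. exact H00.
  - apply hat_zero_interior; auto. lra.
Qed.

(** The closed ball of radius [B] in A(T). All estimates carry such an explicit radius in place of
    the norm. *)
Definition Aball (f : R -> C) (B : R) : Prop := periodic f /\ cont f /\ l1 (hat f) B.

Lemma trig_close (a : Z -> C) (N M : nat) (t : R) : (N <= M)%nat ->
  Cmod (Cminus (trig_poly M a t) (trig_poly N a t)) <=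
  zsumR (fun n => Cmod (a n)) M - zsumR (fun n => Cmod (a n)) N.
Proof.
  intros H. unfold trig_poly.
  rewrite <- (zsum_cut _ N M H), <- (zsum_cut (fun n => Cmod (a n)) N M H).
  replace (Cminus (zsumC (fun n => Cmult (a n) (expi n t)) M)
     (zsumC (cut (G := C_AbelianMonoid) N (fun n => Cmult (a n) (expi n t))) M)) with
    (zsumC (fun n => Cplus (Cmult (a n) (expi n t))
       (Cmult (RtoC (-1)) (cut (G := C_AbelianMonoid) N (fun n => Cmult (a n) (expi n t)) n))) M).
  2:{ rewrite zsumC_plus, zsumC_scal. Cring. }
  eapply Rle_trans; [apply Cmod_zsum|].
  apply Rle_trans with (zsumR (fun n => Cmod (a n) + (-1) * cut (G := R_AbelianMonoid) N (fun n => Cmod (a n)) n) M).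
  - apply zsumR_le. intros n Hn. unfold cut. destruct Z_le_dec.
    + replace (Cplus (Cmult (a n) (expi n t)) (Cmult (RtoC (-1)) (Cmult (a n) (expi n t)))) with (RtoC 0) by ring.
      rewrite Cmod_0. lra.
    + change (Cmod (Cplus (Cmult (a n) (expi n t)) (Cmult (RtoC (-1)) (RtoC 0))) <= Cmod (a n) + (-1) * 0).
      rewrite Cmult_0_r, Cplus_0_r, Cmod_mult, Cmod_expi. lra.
  - rewrite zsumR_plus, zsumR_scal. right. ring.
Qed.

Lemma periodic_lim (f : R -> C) :
  (forall e, 0 < e -> exists g, periodic g /\ forall t, Cmod (Cminus (f t) (g t)) <= e) -> periodic f.
Proof.
  intros H t. apply NNPP. intros Hn.
  assert (Hc : 0 < Cmod (Cminus (f (t + 2 * PI)) (f t))).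
  { apply Cmod_gt_0. intros E. apply Hn. replace (f (t + 2 * PI)) with (Cplus (Cminus (f (t + 2 * PI)) (f t)) (f t)) by ring.
    rewrite E. ring. }
  destruct (H (Cmod (Cminus (f (t + 2 * PI)) (f t)) / 3)) as [g [Hg Hd]]; [lra|].
  pose proof (Hd t) as H1. pose proof (Hd (t + 2 * PI)) as H2. rewrite Hg in H2.
  pose proof (Cmod_tri3 (f (t + 2 * PI)) (g t) (f t)) as H3. rewrite (Cmod_sub_sym (g t)) in H3. lra.
Qed.

Lemma hat_close (f g : R -> C) (e : R) (n : Z) : cont f -> cont g ->
  (forall t, Cmod (Cminus (f t) (g t)) <= e) -> Cmod (Cminus (hat f n) (hat g n)) <= e.
Proof.
  intros Hf Hg H. rewrite <- hat_minus by assumption. apply hat_bound; [|exact H].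
  apply (cont_ext (fun t => Cplus (f t) (Cmult (RtoC (-1)) (g t)))); [intros; ring|].
  apply cont_plus; [exact Hf|]. apply cont_mult; [apply cont_const|exact Hg].
Qed.

(** Each coefficient is continuous for the sup norm and l1 bounds survive limits of coefficients, so
    functions built as uniform limits stay in the ball without convergence in A(T). *)
Lemma Aball_lim (f : R -> C) (B : R) :
  (forall e, 0 < e -> exists g, Aball g B /\ forall t, Cmod (Cminus (f t) (g t)) <= e) -> Aball f B.
Proof.
  intros H.
  assert (Hc : cont f).
  { apply cont_unif_lim. intros e He. destruct (H e He) as [g [[_ [Hg _]] Hd]]. exists g; auto. }
  split; [|split].
  - apply periodic_lim. intros e He. destruct (H e He) as [g [[Hg _] Hd]]. exists g; auto.
  - exact Hc.
  - apply l1_lim. intros e He. destruct (H e He) as [g [[_ [Hg Hl]] Hd]]. exists (hat g).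
    split; [exact Hl|]. intros n. apply hat_close; assumption.
Qed.

(** Summability gives the partial sums a uniform limit [F] with the same coefficients as [f];
    uniqueness then identifies [F] with [f]. *)
Lemma Aball_inversion (f : R -> C) (B e : R) : Aball f B -> 0 < e ->
  exists N, forall M, (N <= M)%nat -> forall t, Cmod (Cminus (f t) (trig_poly M (hat f) t)) <= e.
Proof.
  intros [Hp [Hc Hl]] He.
  destruct (unif_complete (fun M => trig_poly M (hat f))) as [F HF].
  { intros e' He'. destruct (l1_tail _ _ e' Hl He') as [N HN]. exists N. intros M HM t.
    eapply Rle_trans; [apply trig_close, HM|]. specialize (HN M). lra. }
  assert (HFc : cont F).
  { apply cont_unif_lim. intros e' He'. destruct (HF e' He') as [N HN].
    exists (trig_poly N (hat f)). split; [apply cont_trig|apply HN, le_n]. }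
  assert (HFp : periodic F).
  { apply periodic_lim. intros e' He'. destruct (HF e' He') as [N HN].
    exists (trig_poly N (hat f)). split; [apply periodic_trig|apply HN, le_n]. }
  assert (HFh : forall n, hat F n = hat f n).
  { intros n. apply NNPP. intros Hn.
    assert (Hpos : 0 < Cmod (Cminus (hat F n) (hat f n))).
    { apply Cmod_gt_0. intros E. apply Hn.
      replace (hat F n) with (Cplus (Cminus (hat F n) (hat f n)) (hat f n)) by ring. rewrite E. ring. }
    destruct (HF (Cmod (Cminus (hat F n) (hat f n)) / 2)) as [N HN]; [lra|].
    set (M := max N (Z.to_nat (Z.abs n))).
    pose proof (hat_close F (trig_poly M (hat f)) _ n HFc (cont_trig _ _) (HN M ltac:(lia))) as Hh.
    rewrite hat_trig, cut_in in Hh by lia. lra. }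
  assert (HFf : forall t, Cminus (F t) (f t) = 0%C).
  { apply hat_zero.
    - intros t. rewrite HFp, Hp. reflexivity.
    - apply (cont_ext (fun t => Cplus (F t) (Cmult (RtoC (-1)) (f t)))); [intros; ring|].
      apply cont_plus; [exact HFc|]. apply cont_mult; [apply cont_const|exact Hc].
    - intros n. rewrite hat_minus, HFh by assumption. ring. }
  destruct (HF e He) as [N HN]. exists N. intros M HM t.
  replace (f t) with (F t); [apply HN, HM|].
  replace (F t) with (Cplus (Cminus (F t) (f t)) (f t)) by ring. rewrite HFf. ring.
Qed.

Lemma Cmod_trig (N : nat) (a : Z -> C) (B t : R) : l1 a B -> Cmod (trig_poly N a t) <= B.
Proof.
  intros H. eapply Rle_trans; [apply Cmod_zsum|]. apply Rle_trans with (2 := H N).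
  apply zsumR_le. intros n _. rewrite Cmod_mult, Cmod_expi. lra.
Qed.

Lemma Aball_sup (f : R -> C) (B : R) : Aball f B -> forall t, Cmod (f t) <= B.
Proof.
  intros H t. apply Rle_eps. intros e He. destruct (Aball_inversion f B e H He) as [N HN].
  specialize (HN N (le_n N) t). destruct H as [_ [_ Hl]].
  pose proof (Cmod_trig N (hat f) B t Hl).
  replace (f t) with (Cplus (Cminus (f t) (trig_poly N (hat f) t)) (trig_poly N (hat f) t)) by ring.
  eapply Rle_trans; [apply Cmod_triangle|]. lra.
Qed.

Lemma Aball_ext (f g : R -> C) (B : R) : (forall t, f t = g t) -> Aball f B -> Aball g B.
Proof. intros H Hf. replace g with f; [exact Hf|]. apply functional_extensionality, H. Qed.

Lemma Aball_le (f : R -> C) (B D : R) : B <= D -> Aball f B -> Aball f D.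
Proof. intros H [Hp [Hc Hl]]. split; [|split]; auto. apply (l1_le _ B D H Hl). Qed.

Lemma Aball_ge0 (f : R -> C) (B : R) : Aball f B -> 0 <= B.
Proof. intros [_ [_ H]]. apply (l1_ge0 _ _ H). Qed.

Lemma Aball_cont (f : R -> C) (B : R) : Aball f B -> cont f.
Proof. intros [_ [H _]]. exact H. Qed.

Lemma Aball_plus (f g : R -> C) (B D : R) : Aball f B -> Aball g D ->
  Aball (fun t => Cplus (f t) (g t)) (B + D).
Proof.
  intros [Hp [Hc Hl]] [Hp' [Hc' Hl']]. split; [|split].
  - intros t. rewrite Hp, Hp'. reflexivity.
  - apply cont_plus; assumption.
  - apply (l1_dom (fun n => Cplus (hat f n) (hat g n))); [|apply l1_plus; assumption].
    intros n. rewrite hat_plus by assumption. apply Rle_refl.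
Qed.

Lemma Aball_scal (c : C) (f : R -> C) (B : R) : Aball f B ->
  Aball (fun t => Cmult c (f t)) (Cmod c * B).
Proof.
  intros [Hp [Hc Hl]]. split; [|split].
  - intros t. rewrite Hp. reflexivity.
  - apply cont_mult; [apply cont_const|assumption].
  - apply (l1_dom (fun n => Cmult c (hat f n))); [|apply l1_scal; assumption].
    intros n. rewrite hat_scal by assumption. apply Rle_refl.
Qed.

Lemma Aball_minus (f g : R -> C) (B D : R) : Aball f B -> Aball g D ->
  Aball (fun t => Cminus (f t) (g t)) (B + D).
Proof.
  intros Hf Hg. apply (Aball_ext (fun t => Cplus (f t) (Cmult (RtoC (-1)) (g t)))); [intros; ring|].
  apply Aball_plus; [exact Hf|]. replace D with (Cmod (RtoC (-1)) * D).
  - apply Aball_scal, Hg.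
  - rewrite Cmod_R, Rabs_left by lra. ring.
Qed.

Lemma zsumR_opp (u : Z -> R) (N : nat) : zsumR (fun n => u (- n)%Z) N = zsumR u N.
Proof.
  induction N as [|N IH].
  - unfold zsum. simpl. rewrite !sum_O. reflexivity.
  - rewrite !zsum_S, IH. unfold plus; simpl. rewrite (Rplus_comm (u (Z.pos (Pos.of_succ_nat N)))).
    reflexivity.
Qed.

Lemma Aball_conj (f : R -> C) (B : R) : Aball f B -> Aball (fun t => Cconj (f t)) B.
Proof.
  intros [Hp [Hc Hl]]. split; [|split].
  - intros t. rewrite Hp. reflexivity.
  - apply cont_conj, Hc.
  - intros N. rewrite (zsum_ext _ (fun n => Cmod (hat f (- n)))).
    + rewrite (zsumR_opp (fun n => Cmod (hat f n))). apply Hl.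
    + intros n _. rewrite hat_conj by exact Hc. apply Cmod_conj.
Qed.

Lemma Aball_trig (N : nat) (a : Z -> C) :
  Aball (trig_poly N a) (zsumR (fun n => Cmod (a n)) N).
Proof.
  split; [apply periodic_trig|split; [apply cont_trig|]].
  intros M.
  rewrite (zsum_ext _ (cut (G := R_AbelianMonoid) N (fun n => Cmod (a n)))).
  - rewrite <- (zsum_cut (fun n => Cmod (a n)) N (max M N)) by lia.
    apply zsumR_mono; [|lia]. intros n. unfold cut. destruct Z_le_dec; [apply Cmod_ge_0|apply Rle_refl].
  - intros n _. rewrite hat_trig. unfold cut. destruct Z_le_dec; [reflexivity|apply Cmod_0].
Qed.

Lemma Aball_const (c : C) : Aball (fun _ => c) (Cmod c).
Proof.
  replace (Cmod c) with (zsumR (fun _ => Cmod c) O) by (rewrite zsumR_const; simpl; ring).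
  apply (Aball_ext (trig_poly 0 (fun _ => c))); [|apply Aball_trig].
  intros t. unfold trig_poly, zsum. simpl. rewrite sum_O. simpl. rewrite expi_0. Cring.
Qed.

Lemma Aball_close_trig (f : R -> C) (B e : R) : Aball f B -> 0 < e ->
  exists N, Aball (fun t => Cminus (f t) (trig_poly N (hat f) t)) e.
Proof.
  intros [Hp [Hc Hl]] He. destruct (l1_tail _ _ e Hl He) as [N HN]. exists N.
  split; [|split].
  - intros t. rewrite Hp, periodic_trig. reflexivity.
  - apply (cont_ext (fun t => Cplus (f t) (Cmult (RtoC (-1)) (trig_poly N (hat f) t)))); [intros; ring|].
    apply cont_plus; [exact Hc|]. apply cont_mult; [apply cont_const|apply cont_trig].
  - intros M. apply Rle_trans with (zsumR (fun n => Cmod (hat f n) + (-1) * cut (G := R_AbelianMonoid) N (fun n => Cmod (hat f n)) n) (max N M)).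
    + apply Rle_trans with (zsumR (fun n => Cmod (hat f n) + (-1) * cut (G := R_AbelianMonoid) N (fun n => Cmod (hat f n)) n) M).
      * apply zsumR_le. intros n _. rewrite hat_minus, hat_trig by (assumption || apply cont_trig).
        unfold cut. destruct Z_le_dec.
        -- replace (Cminus (hat f n) (hat f n)) with (RtoC 0) by ring. rewrite Cmod_0. lra.
        -- change (Cmod (Cminus (hat f n) (RtoC 0)) <= Cmod (hat f n) + (-1) * 0).
           replace (Cminus (hat f n) 0) with (hat f n) by ring. lra.
      * apply zsumR_mono; [|lia]. intros n. unfold cut. destruct Z_le_dec; [lra|].
        change (zero (G := R_AbelianMonoid)) with 0. pose proof (Cmod_ge_0 (hat f n)). lra.
    + rewrite zsumR_plus, zsumR_scal, (zsum_cut (fun n => Cmod (hat f n))) by lia. specialize (HN (max N M)). lra.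
Qed.

(** * Products *)

(** With the first factor truncated, these are exactly the coefficients of a trigonometric
    polynomial times a function. Infinite convolutions are reached only as limits of such sums. *)
Definition conv (N : nat) (a b : Z -> C) (n : Z) : C := zsumC (fun k => Cmult (a k) (b (n - k)%Z)) N.

(** The hypothesis concerns only shifts by |k| <= M on the window [N]; this covers both a global
    norm bound and a bound of [b] on a larger window. *)
Lemma conv_l1 (M N : nat) (a b : Z -> C) (D : R) :
  (forall k, (Z.abs k <= Z.of_nat M)%Z -> zsumR (fun n => Cmod (b (n - k)%Z)) N <= D) ->
  zsumR (fun n => Cmod (conv M a b n)) N <= zsumR (fun k => Cmod (a k)) M * D.
Proof.
  intros H.
  apply Rle_trans with (zsumR (fun n => zsumR (fun k => Cmod (a k) * Cmod (b (n - k)%Z)) M) N).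
  { apply zsumR_le. intros n _. eapply Rle_trans; [apply Cmod_zsum|].
    apply zsumR_le. intros k _. rewrite Cmod_mult. apply Rle_refl. }
  rewrite (zsum_switch (G := R_AbelianMonoid)).
  rewrite Rmult_comm, <- zsumR_scal. apply zsumR_le. intros k Hk.
  rewrite zsumR_scal, Rmult_comm. apply Rmult_le_compat_r; [apply Cmod_ge_0|apply H, Hk].
Qed.

Lemma conv_sup (M : nat) (a b : Z -> C) (s : R) (n : Z) :
  (forall k, Cmod (b k) <= s) -> Cmod (conv M a b n) <= zsumR (fun k => Cmod (a k)) M * s.
Proof.
  intros H. eapply Rle_trans; [apply Cmod_zsum|].
  rewrite Rmult_comm, <- zsumR_scal. apply zsumR_le. intros k _.
  rewrite Cmod_mult, Rmult_comm. apply Rmult_le_compat_r; [apply Cmod_ge_0|apply H].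
Qed.

Lemma hat_mult_approx (f g : R -> C) (B D e : R) : Aball f B -> Aball g D -> 0 < e ->
  exists N, forall n, Cmod (Cminus (hat (fun t => Cmult (f t) (g t)) n) (conv N (hat f) (hat g) n)) <= e.
Proof.
  intros Hf Hg He. pose proof (Aball_ge0 _ _ Hg) as HD.
  destruct (Aball_inversion f B (e / (D + 1)) Hf) as [N HN].
  { apply Rdiv_lt_0_compat; lra. }
  exists N. intros n. unfold conv. rewrite <- hat_trig_mult by apply (Aball_cont _ _ Hg).
  apply hat_close.
  - apply cont_mult; [apply (Aball_cont _ _ Hf)|apply (Aball_cont _ _ Hg)].
  - apply cont_mult; [apply cont_trig|apply (Aball_cont _ _ Hg)].
  - intros t.
    replace (Cminus (Cmult (f t) (g t)) (Cmult (trig_poly N (hat f) t) (g t))) with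
      (Cmult (Cminus (f t) (trig_poly N (hat f) t)) (g t)) by ring.
    rewrite Cmod_mult. specialize (HN N (le_n N) t). pose proof (Aball_sup _ _ Hg t) as Hs.
    apply Rle_trans with (e / (D + 1) * (D + 1)); [|right; field; lra].
    apply Rmult_le_compat; [apply Cmod_ge_0|apply Cmod_ge_0|exact HN|lra].
Qed.

Lemma l1_shift (b : Z -> C) (D : R) (k : Z) (N : nat) :
  l1 b D -> zsumR (fun n => Cmod (b (n - k)%Z)) N <= D.
Proof. intros H. apply (l1_shift_window b D (- k) N H). Qed.

Lemma Aball_mult (f g : R -> C) (B D : R) : Aball f B -> Aball g D ->
  Aball (fun t => Cmult (f t) (g t)) (B * D).
Proof.
  intros Hf Hg. split; [|split].
  - intros t. rewrite (proj1 Hf), (proj1 Hg). reflexivity.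
  - apply cont_mult; [apply (Aball_cont _ _ Hf)|apply (Aball_cont _ _ Hg)].
  - apply l1_lim. intros e He. destruct (hat_mult_approx f g B D e Hf Hg He) as [N HN].
    exists (conv N (hat f) (hat g)). split; [|exact HN].
    intros M. eapply Rle_trans; [apply (conv_l1 N M (hat f) (hat g) D)|].
    + intros k _. apply l1_shift, (proj2 (proj2 Hg)).
    + apply Rmult_le_compat_r; [apply (Aball_ge0 _ _ Hg)|apply (proj2 (proj2 Hf))].
Qed.

(** Young's inequality for l1 against l-infinity: flatness of [g] survives multiplication by an
    element of A(T), at the cost of its norm. *)
Lemma hat_mult_sup (f g : R -> C) (B D s : R) (n : Z) : Aball f B -> Aball g D ->
  (forall k, Cmod (hat g k) <= s) -> Cmod (hat (fun t => Cmult (f t) (g t)) n) <= B * s.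
Proof.
  intros Hf Hg Hs. apply Rle_eps. intros e He.
  assert (Hs0 : 0 <= s) by (apply Rle_trans with (2 := Hs 0%Z); apply Cmod_ge_0).
  destruct (hat_mult_approx f g B D e Hf Hg He) as [N HN]. specialize (HN n).
  pose proof (conv_sup N (hat f) (hat g) s n Hs) as H.
  assert (H1 : zsumR (fun k => Cmod (hat f k)) N * s <= B * s).
  { apply Rmult_le_compat_r; [exact Hs0|apply (proj2 (proj2 Hf))]. }
  replace (hat (fun t => Cmult (f t) (g t)) n) with
    (Cplus (Cminus (hat (fun t => Cmult (f t) (g t)) n) (conv N (hat f) (hat g) n)) (conv N (hat f) (hat g) n)) by ring.
  eapply Rle_trans; [apply Cmod_triangle|]. lra.
Qed.

(** * Recursive choices and telescoping limits *)

Lemma dependent_choice {T : Type} (P : nat -> T -> Prop) (Q : nat -> T -> T -> Prop) (x0 : T) :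
  P O x0 -> (forall n x, P n x -> exists y, P (S n) y /\ Q n x y) ->
  exists s : nat -> T, s O = x0 /\ forall n, P n (s n) /\ Q n (s n) (s (S n)).
Proof.
  intros H0 H.
  (* Moving the existential outside the invariant makes the successor a total function; [x0] is the
     default where the invariant fails. *)
  assert (Hn : forall n x, exists y, P n x -> P (S n) y /\ Q n x y).
  { intros n x. destruct (classic (P n x)) as [Hp|Hp].
    - destruct (H n x Hp) as [y Hy]. exists y. auto.
    - exists x0. contradiction. }
  set (next := fun n x => proj1_sig (constructive_indefinite_description _ (Hn n x))).
  assert (Hnext : forall n x, P n x -> P (S n) (next n x) /\ Q n x (next n x)).
  { intros n x. unfold next. destruct constructive_indefinite_description as [y Hy]. exact Hy. }
  set (s := fix s n := match n with O => x0 | S k => next k (s k) end).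
  exists s. split; [reflexivity|].
  assert (HP : forall n, P n (s n)).
  { intros n. induction n as [|n IH]; [exact H0|]. apply Hnext, IH. }
  intros n. split; [apply HP|]. apply Hnext, HP.
Qed.

(** [rho j] is the budget left at stage j: each increment is paid by a drop of [rho], so everything
    after stage j costs at most [rho j]. *)
Lemma unif_telescope (F : nat -> R -> C) (rho : nat -> R) :
  (forall j, 0 <= rho j) -> (forall e, 0 < e -> exists j, rho j <= e) ->
  (forall j t, Cmod (Cminus (F (S j) t) (F j t)) <= rho j - rho (S j)) ->
  exists f, forall j t, Cmod (Cminus (f t) (F j t)) <= rho j.
Proof.
  intros H0 Hlim H.
  assert (Htel : forall N M t, (N <= M)%nat -> Cmod (Cminus (F M t) (F N t)) <= rho N - rho M).
  { intros N M t HM. induction HM as [|M HM IH].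
    - replace (Cminus (F N t) (F N t)) with (RtoC 0) by ring. rewrite Cmod_0. lra.
    - pose proof (Cmod_tri3 (F (S M) t) (F M t) (F N t)). specialize (H M t). lra. }
  destruct (unif_complete F) as [f Hf].
  { intros e He. destruct (Hlim e He) as [N HN]. exists N. intros M HM t.
    specialize (Htel N M t HM). specialize (H0 M). lra. }
  exists f. intros j t. apply Rle_eps. intros e He. destruct (Hf e He) as [N HN].
  specialize (HN (max N j) ltac:(lia) t). specialize (Htel j (max N j) t ltac:(lia)).
  pose proof (Cmod_tri3 (f t) (F (max N j) t) (F j t)). specialize (H0 (max N j)). lra.
Qed.

Lemma half_pow_small (c e : R) : 0 < e -> exists j, c * (1 / 2) ^ j <= e.
Proof.
  intros He.
  destruct (pow_lt_1_zero (1 / 2)) with (y := e / (Rabs c + 1)) as [N HN].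
  - rewrite Rabs_pos_eq; lra.
  - apply Rdiv_lt_0_compat; [lra|]. pose proof (Rabs_pos c). lra.
  - exists N. specialize (HN N (le_n N)). rewrite Rabs_pos_eq in HN by (apply pow_le; lra).
    pose proof (Rabs_pos c). pose proof (Rle_abs c).
    assert (0 <= (1 / 2) ^ N) by (apply pow_le; lra).
    apply Rle_trans with ((Rabs c + 1) * (e / (Rabs c + 1))); [|right; field; lra].
    apply Rle_trans with ((Rabs c + 1) * (1 / 2) ^ N);
      [apply Rmult_le_compat_r; lra|apply Rmult_le_compat_l; lra].
Qed.

(** * Extension from a Helson set with a norm bound *)

Lemma rpow_1 (x : R) : 0 <= x -> rpow x 1 = x.
Proof.
  intros H. unfold rpow. destruct Req_EM_T as [->|Hn]; [reflexivity|]. apply Rpower_1. lra.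
Qed.

Lemma rpow_nonneg (x p : R) : 0 <= rpow x p.
Proof. unfold rpow. destruct Req_EM_T; [lra|]. unfold Rpower. left. apply exp_pos. Qed.

Lemma lp_partial_incr (p : R) (c : Z -> C) (N : nat) : lp_partial p c N <= lp_partial p c (S N).
Proof. apply zsumR_mono; [intros; apply rpow_nonneg|lia]. Qed.

Lemma lp_partial_bound (p : R) (c : Z -> C) (N : nat) : in_lp p c ->
  lp_partial p c N <= real (Lim_seq (lp_partial p c)).
Proof.
  intros H. apply (is_lim_seq_incr_compare (lp_partial p c)).
  - apply Lim_seq_correct', H.
  - apply lp_partial_incr.
Qed.

Lemma in_lp_bounded (p : R) (c : Z -> C) (B : R) : (forall N, lp_partial p c N <= B) -> in_lp p c.
Proof.
  intros H. apply (ex_finite_lim_seq_incr _ B); [apply lp_partial_incr|exact H].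
Qed.

Lemma lp_partial_1 (c : Z -> C) (N : nat) : lp_partial 1 c N = zsumR (fun n => Cmod (c n)) N.
Proof. apply zsum_ext. intros n _. apply rpow_1, Cmod_ge_0. Qed.

Lemma in_A_Aball (f : R -> C) : in_A f -> exists B, Aball f B.
Proof.
  intros [Hp [Hc [_ Hl]]]. exists (real (Lim_seq (lp_partial 1 (hat f)))).
  split; [exact Hp|split; [exact Hc|]]. intros N. rewrite <- lp_partial_1. apply lp_partial_bound, Hl.
Qed.

(** A continuous function on the compact set, represented by a periodic function on the line whose
    continuity is asked along [K] only. *)
Definition continuous_data (K : R -> Prop) (phi : R -> C) : Prop := periodic phi /\ continuous_on K phi.

Lemma continuous_on_eps (K : R -> Prop) (f : R -> C) :
  (forall t e, K t -> 0 < e -> exists d, 0 < d /\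
     forall s, K s -> Rabs (s - t) < d -> Cmod (Cminus (f s) (f t)) < e) ->
  continuous_on K f.
Proof.
  intros H t Ht. apply filterlim_locally. intros [e He].
  destruct (H t e Ht He) as [d [Hd Hs]].
  exists (mkposreal d Hd). intros s Hst HK. apply C_NormedModule_mixin_compat1.
  apply Hs; assumption.
Qed.

Lemma continuous_on_delta (K : R -> Prop) (f : R -> C) (t e : R) : continuous_on K f -> K t -> 0 < e ->
  exists d, 0 < d /\ forall s, K s -> Rabs (s - t) < d -> Cmod (Cminus (f s) (f t)) < e.
Proof.
  intros Hf Ht He.
  assert (He2 : 0 < e / sqrt 2).
  { apply Rdiv_lt_0_compat; [exact He|apply sqrt_lt_R0; lra]. }
  pose proof (proj1 (filterlim_locally f (f t)) (Hf t Ht) (mkposreal _ He2)) as [d Hd].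
  exists d. split; [apply cond_pos|]. intros s Hs Hst.
  pose proof (C_NormedModule_mixin_compat2 _ _ _ (Hd s Hst Hs)) as H.
  simpl in H. replace (sqrt 2 * (e / sqrt 2)) with e in H; [exact H|].
  field. apply Rgt_not_eq, sqrt_lt_R0; lra.
Qed.

Lemma continuous_data_plus (K : R -> Prop) (f g : R -> C) : continuous_data K f -> continuous_data K g ->
  continuous_data K (fun t => Cplus (f t) (g t)).
Proof.
  intros [Hf1 Hf2] [Hg1 Hg2]. split.
  - intros t. rewrite Hf1, Hg1. reflexivity.
  - apply continuous_on_eps. intros t e Ht He.
    destruct (continuous_on_delta K f t (e / 2) Hf2 Ht) as [d1 [Hd1 H1]]; [lra|].
    destruct (continuous_on_delta K g t (e / 2) Hg2 Ht) as [d2 [Hd2 H2]]; [lra|].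
    exists (Rmin d1 d2). split; [apply Rmin_glb_lt; assumption|]. intros s Hs Hst.
    pose proof (Rmin_l d1 d2). pose proof (Rmin_r d1 d2).
    specialize (H1 s Hs ltac:(lra)). specialize (H2 s Hs ltac:(lra)).
    replace (Cminus (Cplus (f s) (g s)) (Cplus (f t) (g t))) with
      (Cplus (Cminus (f s) (f t)) (Cminus (g s) (g t))) by ring.
    eapply Rle_lt_trans; [apply Cmod_triangle|]. lra.
Qed.

Lemma continuous_data_scal (K : R -> Prop) (c : C) (f : R -> C) : continuous_data K f ->
  continuous_data K (fun t => Cmult c (f t)).
Proof.
  intros [Hf1 Hf2]. split.
  - intros t. rewrite Hf1. reflexivity.
  - apply continuous_on_eps. intros t e Ht He.
    assert (Hc : 0 <= Cmod c) by apply Cmod_ge_0.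
    destruct (continuous_on_delta K f t (e / (Cmod c + 1)) Hf2 Ht) as [d1 [Hd1 H1]].
    { apply Rdiv_lt_0_compat; lra. }
    exists d1. split; [assumption|]. intros s Hs Hst. specialize (H1 s Hs Hst).
    replace (Cminus (Cmult c (f s)) (Cmult c (f t))) with (Cmult c (Cminus (f s) (f t))) by ring.
    rewrite Cmod_mult.
    assert (Hd : 0 < e / (Cmod c + 1)) by (apply Rdiv_lt_0_compat; lra).
    apply Rle_lt_trans with (Cmod c * (e / (Cmod c + 1))).
    { apply Rmult_le_compat_l; lra. }
    assert (E : (Cmod c + 1) * (e / (Cmod c + 1)) = e) by (field; lra). lra.
Qed.

Lemma continuous_data_lim (K : R -> Prop) (f : R -> C) :
  (forall e, 0 < e -> exists g, continuous_data K g /\ (forall t, Cmod (Cminus (f t) (g t)) <= e)) ->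
  continuous_data K f.
Proof.
  intros H. split.
  - apply periodic_lim. intros e He. destruct (H e He) as [g [[Hg _] Hd]]. exists g. auto.
  - apply continuous_on_eps. intros t e Ht He.
    destruct (H (e / 4)) as [g [[_ Hg] Hfg]]; [lra|].
    destruct (continuous_on_delta K g t (e / 4) Hg Ht) as [d [Hd Hs]]; [lra|].
    exists d. split; [exact Hd|]. intros s HKs Hst.
    pose proof (Cmod_tri3 (f s) (g s) (f t)). pose proof (Cmod_tri3 (g s) (g t) (f t)).
    rewrite (Cmod_sub_sym (g t) (f t)) in *.
    pose proof (Hfg s). pose proof (Hfg t). pose proof (Hs s HKs Hst). lra.
Qed.

(** Setting the data to zero off [K] turns bounds on [K] into global ones, as the uniform limits of
    the Baire argument require. *)
Lemma continuous_data_restrict (K : R -> Prop) (f : R -> C) : periodic_set K -> continuous_data K f ->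
  exists g, continuous_data K g /\ (forall t, K t -> g t = f t) /\ (forall t, ~ K t -> g t = 0%C).
Proof.
  intros HK [Hf1 Hf2].
  set (g := fun t => if excluded_middle_informative (K t) then f t else 0%C).
  assert (Hg1 : forall t, K t -> g t = f t).
  { intros t Ht. unfold g. destruct excluded_middle_informative; [reflexivity|contradiction]. }
  assert (Hg2 : forall t, ~ K t -> g t = 0%C).
  { intros t Ht. unfold g. destruct excluded_middle_informative; [contradiction|reflexivity]. }
  exists g. split; [|split; assumption]. split.
  - intros t. destruct (classic (K t)) as [Ht|Ht].
    + rewrite !Hg1; [apply Hf1|exact Ht|apply HK, Ht].
    + rewrite !Hg2; [reflexivity|exact Ht|]. intros Hc. apply Ht, HK, Hc.
  - apply (continuous_on_ext K f); [|exact Hf2]. intros t Ht. symmetry. apply Hg1, Ht.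
Qed.

Lemma Aball_continuous_data (K : R -> Prop) (f : R -> C) (B : R) : Aball f B -> continuous_data K f.
Proof.
  intros [Hp [Hc _]]. split; [exact Hp|]. apply continuous_on_forall. intros t _. apply Hc.
Qed.

(* Baire's theorem in [C(K)]: otherwise one can build a continuous function at positive distance
   from every ball of [A]. *)
Lemma helson_dense_ball (K : R -> Prop) : Helson_set K ->
  exists (n : nat) (r : R), 0 < r /\
    forall psi, continuous_data K psi -> (forall t, K t -> Cmod (psi t) <= r) ->
    forall d, 0 < d -> exists b, Aball b (INR n) /\ forall t, K t -> Cmod (Cminus (psi t) (b t)) <= d.
Proof.
  intros [HKp [_ Hext]]. apply NNPP. intros Hcon.
  assert (Hbad : forall (n : nat) (r : R), 0 < r -> exists psi, continuous_data K psi /\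
     (forall t, Cmod (psi t) <= r) /\ exists d, 0 < d /\
     forall b, Aball b (INR n) -> exists t, K t /\ d < Cmod (Cminus (psi t) (b t))).
  { intros n r Hr. apply NNPP. intros H1. apply Hcon. exists n, r. split; [exact Hr|].
    intros psi Hpsi Hb d Hd. apply NNPP. intros H2. apply H1.
    destruct (continuous_data_restrict K psi HKp Hpsi) as [g [Hg [Hg1 Hg2]]].
    exists g. split; [exact Hg|split].
    - intros t. destruct (classic (K t)) as [Ht|Ht].
      + rewrite Hg1 by exact Ht. apply Hb, Ht.
      + rewrite Hg2, Cmod_0 by exact Ht. lra.
    - exists d. split; [exact Hd|]. intros b HbA. apply NNPP. intros H3. apply H2.
      exists b. split; [exact HbA|]. intros t Ht. apply Rnot_lt_le. intros H4. apply H3.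
      exists t. split; [exact Ht|]. rewrite Hg1 by exact Ht. exact H4. }
  assert (HA : forall phi, continuous_data K phi -> exists n b, Aball b (INR n) /\ forall t, K t -> b t = phi t).
  { intros phi [Hp Hc]. destruct (Hext phi Hp Hc) as [f [Hf Hfk]].
    destruct (in_A_Aball f Hf) as [B HB]. destruct (INR_unbounded B) as [n Hn].
    exists n, f. split; [|exact Hfk]. apply (Aball_le f B); [lra|exact HB]. }
  (* Nested balls with centre [fst s] and radius [snd s]: the ball of stage k + 1 lies in that of
     stage k and avoids, on [K], all of [Aball] of radius k. *)
  destruct (dependent_choice
    (fun k (s : (R -> C) * R) => continuous_data K (fst s) /\ 0 < snd s <= (1 / 2) ^ k)
    (fun k s s' => (forall t, Cmod (Cminus (fst s' t) (fst s t)) <= snd s - snd s') /\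
       forall b, Aball b (INR k) -> exists t, K t /\ snd s' < Cmod (Cminus (fst s' t) (b t)))
    ((fun _ => RtoC 0), 1)) as [s [_ Hs]].
  - simpl. split; [|lra]. apply (Aball_continuous_data K _ (Cmod (RtoC 0))), Aball_const.
  - intros k [phi r] [Hphi Hr]; simpl in Hphi, Hr.
    (* The failure is known only near the origin. Subtracting the extension [b0] of the centre moves
       it there and enlarges the radius from k to k + n. *)
    destruct (HA phi Hphi) as [n [b0 [Hb0 Hb0K]]].
    destruct (Hbad (k + n)%nat (r / 2)) as [psi [Hpsi [Hpr [d [Hd Hfar]]]]]; [lra|].
    exists ((fun t => Cplus (phi t) (psi t)), Rmin d (r / 2)). simpl.
    pose proof (Rmin_l d (r / 2)). pose proof (Rmin_r d (r / 2)).
    assert (0 < Rmin d (r / 2)) by (apply Rmin_glb_lt; lra).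
    split; [split; [apply continuous_data_plus; assumption|lra]|].
    split.
    + intros t. replace (Cminus (Cplus (phi t) (psi t)) (phi t)) with (psi t) by ring.
      specialize (Hpr t). lra.
    + intros b Hb. destruct (Hfar (fun t => Cminus (b t) (b0 t))) as [t [Ht1 Ht2]].
      { rewrite plus_INR. apply Aball_minus; assumption. }
      exists t. split; [exact Ht1|]. rewrite (Hb0K t Ht1) in Ht2.
      replace (Cminus (Cplus (phi t) (psi t)) (b t)) with (Cminus (psi t) (Cminus (b t) (phi t))) by ring.
      lra.
  - destruct (unif_telescope (fun k => fst (s k)) (fun k => snd (s k))) as [f Hf].
    + intros j. destruct (Hs j) as [[_ Hj] _]. lra.
    + intros e He. destruct (half_pow_small 1 e He) as [j Hj]. exists j.
      destruct (Hs j) as [[_ Hj'] _]. lra.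
    + intros j t. apply Hs.
    + assert (Hfd : continuous_data K f).
      { apply continuous_data_lim. intros e He. destruct (half_pow_small 1 e He) as [j Hj].
        exists (fst (s j)). destruct (Hs j) as [[Hu Hj'] _]. split; [exact Hu|].
        intros t. specialize (Hf j t). lra. }
      (* The limit has an extension of some radius n, although it lies in the ball of stage n +
         1. *)
      destruct (HA f Hfd) as [n [b [Hb HbK]]].
      destruct (Hs n) as [_ [_ Hfar]]. destruct (Hfar b Hb) as [t [Ht1 Ht2]].
      rewrite (HbK t Ht1), Cmod_sub_sym in Ht2. specialize (Hf (S n) t). lra.
Qed.

(** The iteration of the open mapping theorem: the error is rescaled, approximated again and thereby
    halved, and the corrections form a geometric series, which accounts for the factor 2 in the
    constant. *)
Lemma helson_extension (K : R -> Prop) : Helson_set K ->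
  exists B, 0 < B /\ forall phi, continuous_data K phi -> (forall t, K t -> Cmod (phi t) <= 1) ->
    exists f, Aball f B /\ forall t, K t -> f t = phi t.
Proof.
  intros HK. destruct (helson_dense_ball K HK) as [n [r [Hr Hn]]].
  exists (2 * (INR n + 1) / r). pose proof (pos_INR n) as Hn0.
  split; [apply Rdiv_lt_0_compat; lra|].
  intros phi Hphi Hb.
  set (h := fun j : nat => (1 / 2) ^ j).
  assert (Hh : forall j, 0 < h j) by (intros; apply pow_lt; lra).
  assert (HhS : forall j, h (S j) = h j / 2) by (intros; unfold h; simpl; field).
  assert (Hsc : forall c g, continuous_data K g -> continuous_data K (fun t => Cmult (RtoC c) (g t))).
  { intros; apply continuous_data_scal; assumption. }
  (* The added 1 keeps the constant positive when [n] is 0. *)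
  set (nr := (INR n + 1) / r).
  assert (Hnr : 0 < nr) by (apply Rdiv_lt_0_compat; lra).
  destruct (dependent_choice
    (fun j (F : R -> C) => Aball F (2 * nr * (1 - h j)) /\
        forall t, K t -> Cmod (Cminus (phi t) (F t)) <= h j)
    (fun j F F' => forall t, Cmod (Cminus (F' t) (F t)) <= nr * h j)
    (fun _ => RtoC 0)) as [s [_ Hs]].
  - split.
    + apply (Aball_le _ (Cmod (RtoC 0))); [|apply Aball_const]. rewrite Cmod_0. unfold h; simpl. lra.
    + intros t Ht. replace (Cminus (phi t) 0) with (phi t) by ring. apply Hb, Ht.
  - intros j F [HF HFK]. pose proof (Hh j) as Hj.
    (* The error is at most [h j] on [K]; blown up to size [r] it is approximated within r/2, and
       scaling back leaves an error [h j] / 2. *)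
    destruct (Hn (fun t => Cmult (RtoC (r / h j)) (Cminus (phi t) (F t)))) with (d := r / 2) as [b [HbA HbK]].
    + apply Hsc.
      assert (Hu : continuous_data K (fun t => Cplus (phi t) (Cmult (RtoC (-1)) (F t)))).
      { apply continuous_data_plus; [exact Hphi|]. apply Hsc, (Aball_continuous_data K _ _ HF). }
      replace (fun t => Cminus (phi t) (F t)) with (fun t => Cplus (phi t) (Cmult (RtoC (-1)) (F t))).
      * exact Hu.
      * apply functional_extensionality. intros t. ring.
    + intros t Ht. rewrite Cmod_mult, Cmod_R, Rabs_pos_eq by (left; apply Rdiv_lt_0_compat; lra).
      specialize (HFK t Ht). apply Rle_trans with (r / h j * h j); [|right; field; lra].
      apply Rmult_le_compat_l; [left; apply Rdiv_lt_0_compat; lra|exact HFK].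
    + lra.
    + assert (Hbs : Aball (fun t => Cmult (RtoC (h j / r)) (b t)) (nr * h j)).
      { apply (Aball_le _ (Cmod (RtoC (h j / r)) * INR n)); [|apply Aball_scal, HbA].
        rewrite Cmod_R, Rabs_pos_eq by (left; apply Rdiv_lt_0_compat; lra).
        unfold nr. replace ((INR n + 1) / r * h j) with (h j / r * (INR n + 1)) by (field; lra).
        apply Rmult_le_compat_l; [left; apply Rdiv_lt_0_compat; lra|lra]. }
      exists (fun t => Cplus (F t) (Cmult (RtoC (h j / r)) (b t))). split; [split|].
      * apply (Aball_le _ (2 * nr * (1 - h j) + nr * h j)); [rewrite HhS; right; field|].
        apply Aball_plus; assumption.
      * intros t Ht. specialize (HbK t Ht).
        replace (Cminus (phi t) (Cplus (F t) (Cmult (RtoC (h j / r)) (b t)))) with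
          (Cmult (RtoC (h j / r)) (Cminus (Cmult (RtoC (r / h j)) (Cminus (phi t) (F t))) (b t))).
        -- rewrite Cmod_mult, Cmod_R, Rabs_pos_eq by (left; apply Rdiv_lt_0_compat; lra).
           rewrite HhS. apply Rle_trans with (h j / r * (r / 2)); [|right; field; lra].
           apply Rmult_le_compat_l; [left; apply Rdiv_lt_0_compat; lra|exact HbK].
        -- assert (E : Cmult (RtoC (h j / r)) (RtoC (r / h j)) = RtoC 1).
           { rewrite <- RtoC_mult. f_equal. field. lra. }
           replace (Cmult (RtoC (h j / r)) (Cminus (Cmult (RtoC (r / h j)) (Cminus (phi t) (F t))) (b t)))
             with (Cminus (Cmult (Cmult (RtoC (h j / r)) (RtoC (r / h j))) (Cminus (phi t) (F t)))
                (Cmult (RtoC (h j / r)) (b t))) by ring.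
           rewrite E. ring.
      * intros t. replace (Cminus (Cplus (F t) (Cmult (RtoC (h j / r)) (b t))) (F t)) with
          (Cmult (RtoC (h j / r)) (b t)) by ring. apply (Aball_sup _ _ Hbs).
  - destruct (unif_telescope s (fun j => 2 * nr * h j)) as [f Hf].
    + intros j. specialize (Hh j). assert (0 <= nr * h j) by (apply Rmult_le_pos; lra). lra.
    + intros e He. apply (half_pow_small (2 * nr) e He).
    + intros j t. rewrite HhS. destruct (Hs j) as [_ H]. specialize (H t). lra.
    + assert (HfA : Aball f (2 * (INR n + 1) / r)).
      { replace (2 * (INR n + 1) / r) with (2 * nr) by (unfold nr; field; lra).
        apply Aball_lim. intros e He. destruct (half_pow_small (2 * nr) e He) as [j Hj].
        exists (s j). split.
        - destruct (Hs j) as [[HA _] _]. apply (Aball_le _ _ _) with (2 := HA).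
          specialize (Hh j). assert (0 <= nr * h j) by (apply Rmult_le_pos; lra). lra.
        - intros t. specialize (Hf j t). unfold h in Hf. lra. }
      exists f. split; [exact HfA|]. intros t Ht. apply NNPP. intros Hne.
      assert (Hpos : 0 < Cmod (Cminus (f t) (phi t))).
      { apply Cmod_gt_0. intros E. apply Hne.
        replace (f t) with (Cplus (Cminus (f t) (phi t)) (phi t)) by ring. rewrite E. ring. }
      destruct (half_pow_small (2 * nr + 1) (Cmod (Cminus (f t) (phi t)) / 2)) as [j Hj]; [lra|].
      destruct (Hs j) as [[_ HK'] _]. specialize (HK' t Ht). specialize (Hf j t).
      pose proof (Cmod_tri3 (f t) (s j t) (phi t)). rewrite (Cmod_sub_sym (s j t)) in H.
      fold (h j) in Hj. lra.
Qed.

(** * Random signs *)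

(** Expectation over independent fair signs; the recursion conditions on the first sign, as the
    moment computation does. *)
Fixpoint signs_mean (m : nat) (F : list bool -> R) : R :=
  match m with
  | O => F nil
  | S m => (signs_mean m (fun w => F (true :: w)%list) + signs_mean m (fun w => F (false :: w)%list)) / 2
  end.

Lemma signs_mean_le (m : nat) (F G : list bool -> R) :
  (forall w, length w = m -> F w <= G w) -> signs_mean m F <= signs_mean m G.
Proof.
  revert F G. induction m as [|m IH]; intros F G H; simpl.
  - apply H. reflexivity.
  - pose proof (IH (fun w => F (true :: w)%list) (fun w => G (true :: w)%list)) as H1.
    pose proof (IH (fun w => F (false :: w)%list) (fun w => G (false :: w)%list)) as H2.
    assert (forall b w, length w = m -> F (b :: w)%list <= G (b :: w)%list).
    { intros b w Hw. apply H. simpl. congruence. }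
    specialize (H1 (H0 true)). specialize (H2 (H0 false)). lra.
Qed.

Lemma signs_mean_lin (m : nat) (a b : R) (F G : list bool -> R) :
  signs_mean m (fun w => a * F w + b * G w) = a * signs_mean m F + b * signs_mean m G.
Proof.
  revert F G. induction m as [|m IH]; intros F G; simpl; [reflexivity|].
  rewrite (IH (fun w => F (true :: w)%list) (fun w => G (true :: w)%list)).
  rewrite (IH (fun w => F (false :: w)%list) (fun w => G (false :: w)%list)). field.
Qed.

Lemma signs_mean_const (m : nat) (c : R) : signs_mean m (fun _ => c) = c.
Proof. induction m as [|m IH]; simpl; [reflexivity|]. rewrite IH. field. Qed.

Lemma signs_mean_continuous (m : nat) (F : list bool -> R -> R) (t : R) :
  (forall w, continuous (F w) t) -> continuous (fun s => signs_mean m (fun w => F w s)) t.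
Proof.
  revert F. induction m as [|m IH]; intros F H; simpl; [apply H|].
  apply (continuous_mult (K := R_AbsRing)
    (fun s => signs_mean m (fun w => F (true :: w)%list s) + signs_mean m (fun w => F (false :: w)%list s)) (fun _ => / 2)).
  - apply (continuous_plus (V := R_NormedModule) (fun s => signs_mean m (fun w => F (true :: w)%list s))
      (fun s => signs_mean m (fun w => F (false :: w)%list s))).
    + apply (IH (fun w => F (true :: w)%list)). intros; apply H.
    + apply (IH (fun w => F (false :: w)%list)). intros; apply H.
  - apply continuous_const.
Qed.

Definition sgn (b : bool) : R := if b then 1 else -1.

(** The frequency is read off the length of the tail, so prefixing a sign adds a new top frequency
    and leaves the others in place. *)
Fixpoint signed_sum (s : Z) (w : list bool) (t : R) : C :=
  match w with
  | nil => RtoC 0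
  | cons b w => Cplus (Cmult (RtoC (sgn b)) (expi (Z.of_nat (length w) * s) t)) (signed_sum s w t)
  end.

Lemma Cmod2_plus (x y : C) :
  Cmod (Cplus x y) ^ 2 = Cmod x ^ 2 + Cmod y ^ 2 + 2 * (Re x * Re y + Im x * Im y).
Proof. rewrite !Cmod2_alt. destruct x, y; simpl; unfold Re, Im; simpl. ring. Qed.

(** Adding a signed unit term changes |X|^2 into |X|^2 + 1 plus a signed cross term. Averaging over
    the sign removes the cross term from the second moment. In the fourth its square remains, at
    most 4 |X|^2 by Cauchy-Schwarz, so the step adds at most 6 m + 1, which 3 (m + 1)^2 absorbs. *)
Lemma signed_sum_moments (s : Z) (m : nat) (t : R) :
  signs_mean m (fun w => Cmod (signed_sum s w t) ^ 2) = INR m /\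
  signs_mean m (fun w => (Cmod (signed_sum s w t) ^ 2) ^ 2) <= 3 * INR m ^ 2.
Proof.
  induction m as [|m [IH2 IH4]].
  - simpl. rewrite Cmod_0. split; ring_simplify; lra.
  - set (S2 := fun w => Cmod (signed_sum s w t) ^ 2) in *.
    assert (Hz : forall k, Re (expi k t) ^ 2 + Im (expi k t) ^ 2 = 1).
    { intros k. rewrite <- Cmod2_alt, Cmod_expi. ring. }
    assert (Hb : forall (b : bool) w, length w = m ->
      S2 (b :: w)%list = S2 w + 1 + sgn b * (2 * (Re (expi (Z.of_nat m * s) t) * Re (signed_sum s w t) + Im (expi (Z.of_nat m * s) t) * Im (signed_sum s w t)))).
    { intros b w Hw. unfold S2 at 1. simpl signed_sum. rewrite Hw, Cmod2_plus.
      fold (S2 w). rewrite Cmod_mult, Cmod_expi, Cmod_R.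
      rewrite re_scal_l, im_scal_l.
      replace ((Rabs (sgn b) * 1) ^ 2) with 1; [ring|].
      destruct b; simpl; [rewrite Rabs_R1|rewrite (Rabs_left (-1)) by lra]; ring. }
    assert (Hcs : forall k x, (Re (expi k t) * Re x + Im (expi k t) * Im x) ^ 2 <= Cmod x ^ 2).
    { intros k x. rewrite Cmod2_alt. rewrite <- (Rmult_1_l (Re x ^ 2 + Im x ^ 2)), <- (Hz k).
      pose proof (pow2_ge_0 (Re (expi k t) * Im x - Im (expi k t) * Re x)). nra. }
    rewrite S_INR. split.
    + change (signs_mean (S m) (fun w => S2 w) = INR m + 1). simpl.
      set (D := fun w => 2 * (Re (expi (Z.of_nat m * s) t) * Re (signed_sum s w t) + Im (expi (Z.of_nat m * s) t) * Im (signed_sum s w t))) in *.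
      assert (E : forall b, signs_mean m (fun w => S2 (b :: w)%list) = INR m + 1 + sgn b * signs_mean m D).
      { intros b.
        replace (INR m + 1 + sgn b * signs_mean m D) with
          (1 * signs_mean m (fun w => 1 * S2 w + 1 * 1) + sgn b * signs_mean m D).
        - rewrite <- (signs_mean_lin m 1 (sgn b) (fun w => 1 * S2 w + 1 * 1) D).
          apply Rle_antisym; apply signs_mean_le; intros w Hw; rewrite (Hb b w Hw); right; unfold D; ring.
        - rewrite (signs_mean_lin m 1 1 S2 (fun _ => 1)), signs_mean_const, IH2. ring. }
      rewrite !E. unfold sgn. field.
    + change (signs_mean (S m) (fun w => S2 w ^ 2) <= 3 * (INR m + 1) ^ 2).
      change ((signs_mean m (fun w => S2 (true :: w)%list ^ 2) + signs_mean m (fun w => S2 (false :: w)%list ^ 2)) / 2 <= 3 * (INR m + 1) ^ 2).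
      replace ((signs_mean m (fun w => S2 (true :: w)%list ^ 2) + signs_mean m (fun w => S2 (false :: w)%list ^ 2)) / 2)
       with (/ 2 * signs_mean m (fun w => S2 (true :: w)%list ^ 2) + / 2 * signs_mean m (fun w => S2 (false :: w)%list ^ 2)) by field.
      rewrite <- (signs_mean_lin m (/ 2) (/ 2) (fun w => S2 (true :: w)%list ^ 2) (fun w => S2 (false :: w)%list ^ 2)).
      apply Rle_trans with (signs_mean m (fun w => 1 * (S2 w ^ 2) + 1 * (6 * S2 w + 1 * 1))).
      * apply signs_mean_le. intros w Hw. rewrite !Hb by exact Hw. unfold sgn.
        specialize (Hcs (Z.of_nat m * s)%Z (signed_sum s w t)). fold (S2 w) in Hcs.
        set (D := Re (expi (Z.of_nat m * s) t) * Re (signed_sum s w t) + Im (expi (Z.of_nat m * s) t) * Im (signed_sum s w t)) in *.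
        nra.
      * rewrite (signs_mean_lin m 1 1 (fun w => S2 w ^ 2) (fun w => 6 * S2 w + 1 * 1)).
        rewrite (signs_mean_lin m 6 1 S2 (fun _ => 1)), signs_mean_const, IH2.
        change (signs_mean m (fun w => S2 w ^ 2) <= 3 * INR m ^ 2) in IH4.
        pose proof (pos_INR m). nra.
Qed.

(** For x >= 0 one has x / (1 + x) >= x/2 - x^2/8, a combination of moments; their values 1 and at
    most 3 give 1/2 - 3/8 = 1/8. *)
Lemma signed_sum_mean_lower (s : Z) (m : nat) (t : R) : (0 < m)%nat ->
  1 / 8 <= signs_mean m (fun w => (Cmod (signed_sum s w t) ^ 2 / INR m) / (1 + Cmod (signed_sum s w t) ^ 2 / INR m)).
Proof.
  intros Hm. apply lt_INR in Hm. simpl in Hm.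
  destruct (signed_sum_moments s m t) as [H2 H4].
  set (S2 := fun w => Cmod (signed_sum s w t) ^ 2) in *.
  apply Rle_trans with (signs_mean m (fun w => (/ (2 * INR m)) * S2 w + (- / (8 * INR m ^ 2)) * (S2 w ^ 2))).
  - rewrite (signs_mean_lin m _ _ S2 (fun w => S2 w ^ 2)), H2.
    apply Rle_trans with (/ (2 * INR m) * INR m + - / (8 * INR m ^ 2) * (3 * INR m ^ 2)).
    + right. field. lra.
    + apply Rplus_le_compat_l. rewrite <- !Ropp_mult_distr_l. apply Ropp_le_contravar.
      apply Rmult_le_compat_l; [|exact H4]. left. apply Rinv_0_lt_compat. nra.
  - apply signs_mean_le. intros w _. fold (S2 w).
    set (x := S2 w / INR m).
    assert (Hx : 0 <= x) by (apply Rmult_le_pos; [apply pow2_ge_0|left; apply Rinv_0_lt_compat, Hm]).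
    replace (/ (2 * INR m) * S2 w + - / (8 * INR m ^ 2) * S2 w ^ 2) with (x / 2 - x ^ 2 / 8) by (unfold x; field; lra).
    apply Rmult_le_reg_r with (1 + x); [lra|].
    replace (x / (1 + x) * (1 + x)) with x by (field; lra).
    assert (0 <= x * (4 - 3 * x + x ^ 2)); [|lra].
    apply Rmult_le_pos; [exact Hx|]. pose proof (pow2_ge_0 (x - 3 / 2)). lra.
Qed.

Lemma Aball_expi (k : Z) : Aball (expi k) 1.
Proof.
  split; [apply periodic_expi|split; [apply cont_expi|]]. intros N.
  replace (zsumR (fun n => Cmod (hat (expi k) n)) N) with (Re (zsumC (fun n => RtoC (Cmod (hat (expi k) n))) N)).
  - rewrite (zsumC_single _ k).
    + destruct Z_le_dec; [|simpl; lra]. rewrite hat_expi. destruct Z.eq_dec; [|lia]. rewrite Cmod_1. simpl. lra.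
    + intros j Hj. rewrite hat_expi. destruct Z.eq_dec; [contradiction|]. rewrite Cmod_0. reflexivity.
  - unfold zsum. generalize (2 * N)%nat as q. induction q as [|q IHq]; [rewrite !sum_O; reflexivity|].
    rewrite !sum_Sn, <- IHq. reflexivity.
Qed.

Lemma Aball_signed_sum (s : Z) (w : list bool) : Aball (signed_sum s w) (INR (length w)).
Proof.
  induction w as [|b w IH].
  - simpl. apply (Aball_le _ (Cmod (RtoC 0))); [rewrite Cmod_0; lra|]. apply (Aball_const (RtoC 0)).
  - cbn [length]. rewrite S_INR, Rplus_comm.
    apply (Aball_plus (fun t => Cmult (RtoC (sgn b)) (expi (Z.of_nat (length w) * s) t)) (signed_sum s w)); [|exact IH].
    replace 1 with (Cmod (RtoC (sgn b)) * 1).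
    + apply Aball_scal, Aball_expi.
    + rewrite Cmod_R. destruct b; simpl; [rewrite Rabs_R1|rewrite (Rabs_left (-1)) by lra]; ring.
Qed.

(* The windows [[-N, N] + j (2N + 1)] are disjoint, so the coefficients of [g] are counted once. *)
Lemma signed_sum_window (g : R -> C) (N : nat) (w : list bool) : cont g ->
  zsumR (fun n => Cmod (hat (fun t => Cmult (g t) (Cconj (signed_sum (2 * Z.of_nat N + 1) w t))) n)) N <=
  rsum (fun n => Cmod (hat g n)) (- Z.of_nat N) (length w * S (2 * N)).
Proof.
  intros Hg. set (s := (2 * Z.of_nat N + 1)%Z).
  induction w as [|b w IH].
  - simpl. right. rewrite (zsum_ext _ (fun _ => 0)).
    + rewrite zsumR_const. ring.
    + intros n _. rewrite (hat_ext _ (fun _ => RtoC 0)).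
      * rewrite hat_const. destruct Z.eq_dec; apply Cmod_0.
      * intros t. apply injective_projections; simpl; ring.
  - cbn [length]. rewrite Nat.mul_succ_l, rsum_app.
    set (k := (Z.of_nat (length w) * s)%Z).
    assert (Hc : cont (fun t => Cmult (g t) (Cconj (signed_sum s w t)))).
    { apply cont_mult; [exact Hg|]. apply cont_conj, (Aball_cont _ _ (Aball_signed_sum s w)). }
    assert (Hc2 : cont (fun t => Cmult (expi (- k) t) (g t))).
    { apply cont_mult; [apply cont_expi|exact Hg]. }
    eapply Rle_trans; [|apply Rplus_le_compat_r, IH].
    rewrite <- (rsum_shift _ (Z.of_nat (length w * S (2 * N)))).
    replace (Z.of_nat (length w * S (2 * N))) with k by (unfold k, s; rewrite Nat2Z.inj_mul; f_equal; lia).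
    rewrite <- (zsum_rsum (fun j => Cmod (hat g (j + k)))), <- zsumR_plus.
    apply zsumR_le. intros n _.
    rewrite (hat_ext _ (fun t => Cplus (Cmult (g t) (Cconj (signed_sum s w t)))
        (Cmult (RtoC (sgn b)) (Cmult (expi (- k) t) (g t))))).
    + rewrite hat_plus, hat_scal, hat_shift by first [assumption|apply cont_mult; [apply cont_const|assumption]].
      eapply Rle_trans; [apply Cmod_triangle|]. apply Rplus_le_compat_l.
      rewrite Cmod_mult, Cmod_R. replace (n - - k)%Z with (n + k)%Z by ring.
      right. destruct b; simpl; [rewrite Rabs_R1|rewrite (Rabs_left (-1)) by lra]; ring.
    + intros t. cbn [signed_sum]. fold k. rewrite Cplus_conj, Cmult_conj, expi_opp.
      replace (Cconj (RtoC (sgn b))) with (RtoC (sgn b)) by (apply injective_projections; simpl; ring).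
      ring.
Qed.

(** Balls and window bounds are convex, so an average over the signs inherits them, while the values
    on [K] are averaged as real numbers. *)
Lemma signs_mean_function (K : R -> Prop) (m : nat) (H : list bool -> R -> C) (p : list bool -> R -> R)
  (B eta : R) (N : nat) :
  (forall w, length w = m -> Aball (H w) B /\ zsumR (fun n => Cmod (hat (H w) n)) N <= eta /\
     forall t, K t -> H w t = RtoC (p w t)) ->
  exists h, Aball h B /\ zsumR (fun n => Cmod (hat h n)) N <= eta /\
     forall t, K t -> h t = RtoC (signs_mean m (fun w => p w t)).
Proof.
  revert H p. induction m as [|m IH]; intros H p HH.
  - exists (H nil). apply HH. reflexivity.
  - assert (Hb : forall b, exists h, Aball h B /\ zsumR (fun n => Cmod (hat h n)) N <= eta /\
       forall t, K t -> h t = RtoC (signs_mean m (fun w => p (b :: w)%list t))).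
    { intros b. apply (IH (fun w => H (b :: w)%list) (fun w => p (b :: w)%list)).
      intros w Hw. apply HH. simpl. congruence. }
    destruct (Hb true) as [h1 [H1 [H1' H1'']]]. destruct (Hb false) as [h2 [H2 [H2' H2'']]].
    exists (fun t => Cplus (Cmult (RtoC (/ 2)) (h1 t)) (Cmult (RtoC (/ 2)) (h2 t))).
    assert (Hm : Cmod (RtoC (/ 2)) = / 2) by (rewrite Cmod_R, Rabs_pos_eq; lra).
    split; [|split].
    + replace B with (Cmod (RtoC (/ 2)) * B + Cmod (RtoC (/ 2)) * B) by (rewrite Hm; field).
      apply Aball_plus; apply Aball_scal; assumption.
    + apply Rle_trans with (zsumR (fun n => / 2 * Cmod (hat h1 n) + / 2 * Cmod (hat h2 n)) N).
      * apply zsumR_le. intros n _.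
        rewrite hat_plus, !hat_scal.
        -- eapply Rle_trans; [apply Cmod_triangle|]. rewrite !Cmod_mult, Hm. lra.
        -- apply (Aball_cont _ _ H2).
        -- apply (Aball_cont _ _ H1).
        -- apply cont_mult; [apply cont_const|apply (Aball_cont _ _ H1)].
        -- apply cont_mult; [apply cont_const|apply (Aball_cont _ _ H2)].
      * rewrite zsumR_plus, !zsumR_scal. lra.
    + intros t Ht. rewrite H1'', H2'' by exact Ht. simpl.
      rewrite <- !RtoC_mult, <- RtoC_plus. f_equal. field.
Qed.

(** With m = M^2 frequencies each product has norm at most (4/M) B m = 4 B M, but mass at most 4 B /
    M on the window. The first bound is independent of [N], and the second is below 1/2 once M
    exceeds 8 B. *)
Lemma helson_window_half (K : R -> Prop) : Helson_set K ->
  exists B, 1 <= B /\ forall N, exists h, Aball h B /\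
    zsumR (fun n => Cmod (hat h n)) N <= 1 / 2 /\ forall t, K t -> h t = RtoC 1.
Proof.
  intros HK. destruct (helson_extension K HK) as [B [HB Hext]].
  destruct (INR_unbounded (8 * B + 1)) as [M HM].
  assert (HM0 : (0 < M)%nat) by (apply INR_lt; simpl; lra).
  set (m := (M * M)%nat).
  assert (Hm0 : (0 < m)%nat) by (unfold m; lia).
  assert (HmM : INR m = INR M * INR M) by (unfold m; apply mult_INR).
  exists (4 * B * INR M + 1).
  assert (HBM : 0 <= B * INR M) by (apply Rmult_le_pos; lra).
  split; [lra|]. intros N.
  set (s := (2 * Z.of_nat N + 1)%Z).
  set (x := fun w t => Cmod (signed_sum s w t) ^ 2 / INR m).
  assert (Hx : forall w t, 0 <= x w t).
  { intros w t. apply Rmult_le_pos; [apply pow2_ge_0|]. left. apply Rinv_0_lt_compat. nra. }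
  assert (Hxc : forall w t, continuous (x w) t).
  { intros w t. apply (continuous_mult (K := R_AbsRing) (fun s0 => Cmod (signed_sum s w s0) ^ 2) (fun _ => / INR m)).
    - apply continuous_Cmod2, (Aball_cont _ _ (Aball_signed_sum s w)).
    - apply continuous_const. }
  assert (Hinv : forall (u : R -> R) t, continuous u t -> 0 < u t -> continuous (fun s0 => / u s0) t).
  { intros u t Hu Hp. apply (continuous_comp u Rinv); [exact Hu|].
    apply continuity_pt_filterlim. apply (derivable_continuous_pt Rinv), derivable_pt_inv; [lra|apply derivable_pt_id]. }
  set (y := fun w t => x w t / (1 + x w t)).
  assert (Hic : forall w t, continuous (fun s0 => / (1 + x w s0)) t).
  { intros w t. apply (Hinv (fun s0 => 1 + x w s0)).
    - apply (continuous_plus (V := R_NormedModule) (fun _ => 1) (x w)); [apply continuous_const|apply Hxc].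
    - specialize (Hx w t). lra. }
  set (kap := fun t => signs_mean m (fun w => y w t)).
  assert (Hkap : forall t, 1 / 8 <= kap t) by (intros t; apply signed_sum_mean_lower, Hm0).
  assert (Hkc : forall t, continuous (fun s0 => / kap s0) t).
  { intros t. apply (Hinv kap).
    - apply (signs_mean_continuous m y). intros w.
      apply (continuous_mult (K := R_AbsRing)); [apply Hxc|apply Hic].
    - specialize (Hkap t). lra. }
  (* With X the signed sum divided by M, [rho] times the signed sum is X / (4 (1 + |X|^2) kap). The
     1/4 brings the bound 1/2 for X / (1 + |X|^2) times the bound 8 for 1/kap down to 1. *)
  set (rho := fun w t => / (4 * INR M) * (/ (1 + x w t) * / kap t)).
  assert (Hrc : forall w t, continuous (rho w) t).
  { intros w t. apply (continuous_mult (K := R_AbsRing) (fun _ => / (4 * INR M))); [apply continuous_const|].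
    apply (continuous_mult (K := R_AbsRing)); [apply Hic|apply Hkc]. }
  assert (HG : forall w, exists g, Aball g B /\ forall t, K t -> g t = Cmult (RtoC (rho w t)) (signed_sum s w t)).
  { intros w. apply Hext.
    - split.
      + assert (Hp : periodic (signed_sum s w)) by apply (Aball_signed_sum s w).
        assert (Hpx : forall w t, x w (t + 2 * PI) = x w t).
        { intros w' t. unfold x. rewrite (proj1 (Aball_signed_sum s w')). reflexivity. }
        intros t. rewrite Hp. f_equal. f_equal. unfold rho, kap, y. rewrite Hpx.
        do 4 f_equal. apply functional_extensionality. intros w'. rewrite Hpx. reflexivity.
      + apply continuous_on_forall. intros t _. apply (cont_mult (fun t => RtoC (rho w t)) (signed_sum s w)).
        * apply cont_RtoC. apply Hrc.
        * apply (Aball_cont _ _ (Aball_signed_sum s w)).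
    - intros t _. rewrite Cmod_mult, Cmod_R.
      specialize (Hkap t). specialize (Hx w t).
      set (a := Cmod (signed_sum s w t) / INR M).
      assert (Ha : 0 <= a) by (apply Rmult_le_pos; [apply Cmod_ge_0|left; apply Rinv_0_lt_compat; lra]).
      assert (Hxa : x w t = a ^ 2) by (unfold x, a; rewrite HmM; field; lra).
      rewrite Rabs_pos_eq.
      + replace (rho w t * Cmod (signed_sum s w t)) with (/ 4 * (a / (1 + a ^ 2) * / kap t))
          by (unfold rho; rewrite Hxa; unfold a; field; repeat split; try lra; rewrite <- ?Hxa; nra).
        assert (H1 : a / (1 + a ^ 2) <= 1 / 2).
        { apply Rmult_le_reg_r with (1 + a ^ 2); [nra|].
          replace (a / (1 + a ^ 2) * (1 + a ^ 2)) with a by (field; nra).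
          pose proof (pow2_ge_0 (a - 1)). lra. }
        assert (H2 : / kap t <= 8).
        { replace 8 with (/ (1 / 8)) by field. apply Rinv_le_contravar; lra. }
        assert (H3 : 0 < / kap t) by (apply Rinv_0_lt_compat; lra).
        assert (H4 : 0 <= a / (1 + a ^ 2)) by (apply Rmult_le_pos; [lra|left; apply Rinv_0_lt_compat; nra]).
        nra.
      + unfold rho. repeat apply Rmult_le_pos; left; apply Rinv_0_lt_compat; lra. }
  assert (HC : exists G : list bool -> R -> C, forall w, Aball (G w) B /\
     forall t, K t -> G w t = Cmult (RtoC (rho w t)) (signed_sum s w t)).
  { exists (fun w => proj1_sig (constructive_indefinite_description _ (HG w))).
    intros w. destruct constructive_indefinite_description as [g Hg]. exact Hg. }
  destruct HC as [G HGw].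
  assert (H4M : Cmod (RtoC (4 / INR M)) = 4 / INR M).
  { rewrite Cmod_R. apply Rabs_pos_eq. left. apply Rdiv_lt_0_compat; lra. }
  (* The scalar 4/M undoes the 1/4 in [rho] and normalises the conjugate sum. The summand with
     coefficient 0 gives the values the shape expected by [signs_mean_lin]. *)
  destruct (signs_mean_function K m
    (fun w t => Cmult (RtoC (4 / INR M)) (Cmult (G w t) (Cconj (signed_sum s w t))))
    (fun w t => / kap t * y w t + 0 * y w t) (4 * B * INR M + 1) (1 / 2) N) as [h [Hh1 [Hh2 Hh3]]].
  - intros w Hw. destruct (HGw w) as [HGA HGK].
    assert (HcT : Aball (fun t => Cconj (signed_sum s w t)) (INR m)).
    { rewrite <- Hw. apply Aball_conj, Aball_signed_sum. }
    split; [|split].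
    + apply (Aball_le _ (Cmod (RtoC (4 / INR M)) * (B * INR m))).
      * rewrite H4M, HmM.
        replace (4 / INR M * (B * (INR M * INR M))) with (4 * B * INR M) by (field; lra). lra.
      * apply Aball_scal, Aball_mult; assumption.
    + apply Rle_trans with (4 / INR M * zsumR (fun n => Cmod (hat (fun t => Cmult (G w t) (Cconj (signed_sum s w t))) n)) N).
      * rewrite <- zsumR_scal. apply zsumR_le. intros n _. right.
        rewrite hat_scal by (apply cont_mult; [apply (Aball_cont _ _ HGA)|apply (Aball_cont _ _ HcT)]).
        rewrite Cmod_mult, H4M. reflexivity.
      * apply Rle_trans with (4 / INR M * B).
        -- apply Rmult_le_compat_l; [left; apply Rdiv_lt_0_compat; lra|].
           eapply Rle_trans; [apply (signed_sum_window (G w) N w), (Aball_cont _ _ HGA)|].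
           apply l1_rsum, HGA.
        -- apply Rmult_le_reg_r with (INR M); [lra|].
           replace (4 / INR M * B * INR M) with (4 * B) by (field; lra). lra.
    + intros t Ht. rewrite HGK by exact Ht.
      replace (Cmult (RtoC (4 / INR M)) (Cmult (Cmult (RtoC (rho w t)) (signed_sum s w t)) (Cconj (signed_sum s w t))))
        with (Cmult (Cmult (RtoC (4 / INR M)) (RtoC (rho w t))) (Cmult (signed_sum s w t) (Cconj (signed_sum s w t)))) by ring.
      rewrite <- Cmod2_conj, <- !RtoC_mult. f_equal.
      specialize (Hkap t). pose proof (Hx w t) as Hx0.
      assert (E : Cmod (signed_sum s w t) ^ 2 = x w t * (INR M * INR M)).
      { unfold x. rewrite HmM. field. lra. }
      rewrite E. unfold rho, y. field. repeat split; lra.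
  - exists h. split; [exact Hh1|split; [exact Hh2|]].
    intros t Ht. rewrite Hh3 by exact Ht. f_equal.
    rewrite (signs_mean_lin m (/ kap t) 0 (fun w => y w t) (fun w => y w t)). fold (kap t).
    specialize (Hkap t). field. lra.
Qed.

(** * Flat functions equal to 1 on a Helson set *)

Lemma Aball_minus_trig (f : R -> C) (B : R) (N : nat) : Aball f B ->
  Aball (fun t => Cminus (f t) (trig_poly N (hat f) t)) B.
Proof.
  intros [Hp [Hc Hl]]. split; [|split].
  - intros t. rewrite Hp, periodic_trig. reflexivity.
  - apply (cont_ext (fun t => Cplus (f t) (Cmult (RtoC (-1)) (trig_poly N (hat f) t)))); [intros; ring|].
    apply cont_plus; [exact Hc|]. apply cont_mult; [apply cont_const|apply cont_trig].
  - apply (l1_dom (hat f)); [|exact Hl]. intros n.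
    rewrite hat_minus, hat_trig by (assumption || apply cont_trig). unfold cut.
    destruct Z_le_dec.
    + replace (Cminus (hat f n) (hat f n)) with (RtoC 0) by ring. rewrite Cmod_0. apply Cmod_ge_0.
    + change (Cmod (Cminus (hat f n) (RtoC 0)) <= Cmod (hat f n)).
      replace (Cminus (hat f n) (RtoC 0)) with (hat f n) by ring. apply Rle_refl.
Qed.

Lemma hat_minus_trig_in (f : R -> C) (N : nat) (n : Z) : cont f -> (Z.abs n <= Z.of_nat N)%Z ->
  hat (fun t => Cminus (f t) (trig_poly N (hat f) t)) n = RtoC 0.
Proof.
  intros Hf Hn. rewrite hat_minus, hat_trig, cut_in by (assumption || apply cont_trig). ring.
Qed.

Lemma hat_minus_trig_out (f : R -> C) (N : nat) (n : Z) : cont f -> (Z.of_nat N < Z.abs n)%Z ->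
  hat (fun t => Cminus (f t) (trig_poly N (hat f) t)) n = hat f n.
Proof.
  intros Hf Hn. rewrite hat_minus, hat_trig, cut_out by (assumption || apply cont_trig).
  change (Cminus (hat f n) (RtoC 0) = hat f n). ring.
Qed.

(* The part of [h] carried by the window is multiplied by another function equal to 1 on [K]
   and with small mass on a larger window. *)
Lemma helson_window_small (K : R -> Prop) : Helson_set K ->
  exists B, 1 <= B /\ forall N eta, 0 < eta -> exists h, Aball h B /\
    zsumR (fun n => Cmod (hat h n)) N <= eta /\ forall t, K t -> h t = RtoC 1.
Proof.
  intros HK. destruct (helson_window_half K HK) as [B [HB Hhalf]].
  exists (3 * B). split; [lra|]. intros N eta Heta.
  (* Round r moves mass at most 2^{-r} through a factor of norm [B], so the norms grow by [B] 2^{-r}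
     and stay below 3 [B]. *)
  assert (Hr : forall r : nat, exists h, Aball h (B * (3 - 2 * (1 / 2) ^ r)) /\
     zsumR (fun n => Cmod (hat h n)) N <= (1 / 2) ^ r /\ forall t, K t -> h t = RtoC 1).
  { intros r. induction r as [|r [h [Hh1 [Hh2 Hh3]]]].
    - exists (fun _ => RtoC 1). split; [|split].
      + apply (Aball_le _ (Cmod (RtoC 1))); [rewrite Cmod_1; simpl; lra|apply Aball_const].
      + pose proof (proj2 (proj2 (Aball_const (RtoC 1))) N) as H1. rewrite Cmod_1 in H1. exact H1.
      + reflexivity.
    - destruct (Hhalf (2 * N)%nat) as [h' [Hh1' [Hh2' Hh3']]].
      pose proof (Aball_cont _ _ Hh1) as Hc. pose proof (Aball_cont _ _ Hh1') as Hc'.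
      exists (fun t => Cplus (Cminus (h t) (trig_poly N (hat h) t)) (Cmult (trig_poly N (hat h) t) (h' t))).
      split; [|split].
      + apply (Aball_le _ (B * (3 - 2 * (1 / 2) ^ r) + (1 / 2) ^ r * B)); [simpl; right; field|].
        apply Aball_plus; [apply Aball_minus_trig, Hh1|].
        apply Aball_mult; [|exact Hh1'].
        apply (Aball_le _ (zsumR (fun n => Cmod (hat h n)) N)); [exact Hh2|apply Aball_trig].
      + apply Rle_trans with (zsumR (fun n => Cmod (conv N (hat h) (hat h') n)) N).
        * apply zsumR_le. intros n Hn. right. f_equal.
          rewrite hat_plus.
          -- rewrite hat_minus_trig_in, hat_trig_mult by assumption. unfold conv. ring.
          -- apply (Aball_cont _ _ (Aball_minus_trig _ _ N Hh1)).
          -- apply cont_mult; [apply cont_trig|exact Hc'].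
        * eapply Rle_trans; [apply (conv_l1 N N _ _ (1 / 2))|].
          -- intros k Hk. apply Rle_trans with (2 := Hh2'). rewrite !zsum_rsum.
             rewrite (rsum_shift (fun j => Cmod (hat h' j)) (- k)).
             apply rsum_sub; [intros; apply Cmod_ge_0|lia|lia].
          -- simpl. lra.
      + intros t Ht. rewrite Hh3, Hh3' by exact Ht. ring. }
  destruct (half_pow_small 1 eta Heta) as [r Hrr].
  destruct (Hr r) as [h [H1 [H2 H3]]]. exists h. split; [|split; [lra|exact H3]].
  apply (Aball_le _ _ _) with (2 := H1).
  assert (0 < (1 / 2) ^ r) by (apply pow_lt; lra). nra.
Qed.

(** Average many functions equal to 1 on [K], each nearly zero on the window that carries the sum of
    the earlier ones. As their spectra hardly overlap, the coefficients of the sum stay near [B]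
    while its value on [K] grows to [M]. *)
Lemma helson_flat (K : R -> Prop) : Helson_set K ->
  exists B, 1 <= B /\ forall eps, 0 < eps -> exists h, Aball h B /\
    (forall n, Cmod (hat h n) <= eps) /\ forall t, K t -> h t = RtoC 1.
Proof.
  intros HK. destruct (helson_window_small K HK) as [B [HB Hsmall]].
  exists B. split; [exact HB|]. intros eps Heps.
  destruct (INR_unbounded ((B + 1) / eps + 1)) as [M HM].
  assert (Hd : 0 < (B + 1) / eps) by (apply Rdiv_lt_0_compat; lra).
  (* The leakage of all [M] rounds then adds up to at most 1, which explains [B] + 1 in the choice
     of [M]. *)
  set (eta := / (INR M + 1)).
  assert (Heta : 0 < eta) by (apply Rinv_0_lt_compat; lra).
  assert (Hm : forall m : nat, exists S, Aball S (INR m * B) /\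
    (forall n, Cmod (hat S n) <= B + eta * (INR m + 1)) /\ forall t, K t -> S t = RtoC (INR m)).
  { intros m. induction m as [|m [S [HS1 [HS2 HS3]]]].
    - exists (fun _ => RtoC 0). simpl INR. split; [|split].
      + apply (Aball_le _ (Cmod (RtoC 0))); [rewrite Cmod_0; lra|apply Aball_const].
      + intros n. rewrite hat_const. destruct Z.eq_dec; rewrite Cmod_0; nra.
      + reflexivity.
    - destruct (Aball_close_trig S _ eta HS1 Heta) as [N HN].
      destruct (Hsmall N eta Heta) as [h [Hh1 [Hh2 Hh3]]].
      exists (fun t => Cplus (S t) (h t)). rewrite S_INR. split; [|split].
      + rewrite Rmult_plus_distr_r, Rmult_1_l. apply Aball_plus; assumption.
      + intros n. rewrite hat_plus by (apply (Aball_cont _ _ HS1) || apply (Aball_cont _ _ Hh1)).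
        eapply Rle_trans; [apply Cmod_triangle|].
        (* Inside the window the new function contributes at most [eta]; outside, the old sum
           does. *)
        destruct (Z_le_dec (Z.abs n) (Z.of_nat N)) as [Hn|Hn].
        * specialize (HS2 n).
          assert (Cmod (hat h n) <= eta); [|lra].
          apply Rle_trans with (2 := Hh2). rewrite zsum_rsum.
          replace (Cmod (hat h n)) with (rsum (fun j => Cmod (hat h j)) n 1) by (simpl; rewrite Z.add_0_r; ring).
          apply rsum_sub; [intros; apply Cmod_ge_0|lia|lia].
        * rewrite <- (hat_minus_trig_out S N n) by (lia || apply (Aball_cont _ _ HS1)).
          pose proof (l1_coef _ _ n (proj2 (proj2 HN))) as H1.
          pose proof (l1_coef _ _ n (proj2 (proj2 Hh1))) as H2.
          pose proof (pos_INR m). nra.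
      + intros t Ht. rewrite HS3, Hh3 by exact Ht. rewrite RtoC_plus. reflexivity. }
  destruct (Hm M) as [S [HS1 [HS2 HS3]]].
  assert (HMp : 0 < INR M) by lra.
  assert (Hmod : Cmod (RtoC (/ INR M)) = / INR M).
  { rewrite Cmod_R. apply Rabs_pos_eq. left. apply Rinv_0_lt_compat, HMp. }
  exists (fun t => Cmult (RtoC (/ INR M)) (S t)). split; [|split].
  - replace B with (Cmod (RtoC (/ INR M)) * (INR M * B)) by (rewrite Hmod; field; lra).
    apply Aball_scal, HS1.
  - intros n. rewrite hat_scal, Cmod_mult, Hmod by apply (Aball_cont _ _ HS1).
    apply Rmult_le_reg_l with (INR M); [exact HMp|].
    rewrite <- Rmult_assoc, Rinv_r, Rmult_1_l by lra.
    eapply Rle_trans; [apply HS2|]. unfold eta. rewrite Rinv_l by lra.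
    replace (B + 1) with ((B + 1) / eps * eps) by (field; lra). apply Rmult_le_compat_r; lra.
  - intros t Ht. rewrite HS3 by exact Ht. rewrite <- RtoC_mult. f_equal. field. lra.
Qed.

(** * Approximate inverses *)

(** Write s = r^2: by Bernoulli's inequality n r^n is bounded, and the second factor r^n tends to
    zero. *)
Lemma linear_times_pow_small (A s e : R) : 0 <= A -> 0 < s < 1 -> 0 < e ->
  exists n, (A * INR n + 1) * s ^ n <= e.
Proof.
  intros HA Hs He. set (r := sqrt s).
  assert (Hr : 0 < r < 1).
  { unfold r. split; [apply sqrt_lt_R0; lra|]. rewrite <- sqrt_1. apply sqrt_lt_1; lra. }
  assert (Hrs : r * r = s) by (apply sqrt_sqrt; lra).
  set (x := / r - 1).
  assert (Hx : 0 < x).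
  { unfold x. assert (1 < / r); [|lra]. rewrite <- Rinv_1 at 1. apply Rinv_lt_contravar; lra. }
  assert (Hn : forall n, INR n * r ^ n <= / x).
  { intros n. pose proof (poly n x Hx) as Hp.
    replace (1 + x) with (/ r) in Hp by (unfold x; ring).
    rewrite pow_inv in Hp. pose proof (pow_lt r n (proj1 Hr)) as Hrn.
    apply Rmult_le_compat_r with (r := r ^ n) in Hp; [|lra].
    rewrite Rinv_l in Hp by lra.
    apply Rmult_le_reg_r with x; [exact Hx|]. rewrite Rinv_l by lra. lra. }
  destruct (pow_lt_1_zero r) with (y := e / (A * / x + 1)) as [n Hsm].
  - rewrite Rabs_pos_eq; lra.
  - apply Rdiv_lt_0_compat; [exact He|]. assert (0 <= A * / x); [|lra].
    apply Rmult_le_pos; [exact HA|]. left. apply Rinv_0_lt_compat, Hx.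
  - exists n. specialize (Hsm n (le_n n)). specialize (Hn n).
    pose proof (pow_lt r n (proj1 Hr)) as Hrn. rewrite Rabs_pos_eq in Hsm by lra.
    assert (Hrn1 : r ^ n <= 1) by (rewrite <- (pow1 n); apply pow_incr; lra).
    rewrite <- Hrs, Rpow_mult_distr.
    assert (HAx : 0 <= A * / x) by (apply Rmult_le_pos; [exact HA|left; apply Rinv_0_lt_compat, Hx]).
    apply Rle_trans with ((A * / x + 1) * r ^ n).
    + replace ((A * INR n + 1) * (r ^ n * r ^ n)) with ((A * (INR n * r ^ n) + r ^ n) * r ^ n) by ring.
      apply Rmult_le_compat_r; [lra|]. apply Rplus_le_compat; [|exact Hrn1].
      apply Rmult_le_compat_l; assumption.
    + apply Rle_trans with ((A * / x + 1) * (e / (A * / x + 1))); [|right; field; lra].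
      apply Rmult_le_compat_l; lra.
Qed.

(* The coefficients of [q^k] are bounded by the supremum of [q^k] and vanish beyond [k N]. *)
Lemma Aball_trig_pow (N : nat) (a : Z -> C) (s : R) (k : nat) :
  (forall t, Cmod (trig_poly N a t) <= s) ->
  Aball (fun t => Cpow (trig_poly N a t) k) ((2 * INR N * INR k + 1) * s ^ k).
Proof.
  intros Hs.
  assert (Hs0 : 0 <= s) by (apply Rle_trans with (2 := Hs 0); apply Cmod_ge_0).
  assert (Hc : forall k, cont (fun t => Cpow (trig_poly N a t) k)) by (intros; apply cont_pow, cont_trig).
  assert (Hsup : forall n, (Z.of_nat (k * N) < Z.abs n)%Z -> hat (fun t => Cpow (trig_poly N a t) k) n = RtoC 0).
  { induction k as [|k IH]; intros n Hn.
    - change (hat (fun _ => RtoC 1) n = RtoC 0). rewrite hat_const. destruct Z.eq_dec; [lia|reflexivity].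
    - change (hat (fun t => Cmult (trig_poly N a t) (Cpow (trig_poly N a t) k)) n = RtoC 0).
      rewrite hat_trig_mult by apply Hc. apply zsumC_0. intros j Hj. rewrite IH by lia. ring. }
  split; [|split; [apply Hc|]].
  - intros t. rewrite periodic_trig. reflexivity.
  - intros M. apply Rle_trans with (zsumR (cut (G := R_AbelianMonoid) (k * N) (fun _ => s ^ k)) (max M (k * N))).
    + apply Rle_trans with (zsumR (cut (G := R_AbelianMonoid) (k * N) (fun _ => s ^ k)) M).
      * apply zsumR_le. intros n _. unfold cut. destruct Z_le_dec.
        -- apply hat_bound; [apply Hc|]. intros t. rewrite Cmod_pow. apply pow_incr.
           split; [apply Cmod_ge_0|apply Hs].
        -- rewrite Hsup by lia. rewrite Cmod_0. apply Rle_refl.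
      * apply zsumR_mono; [|lia]. intros n. unfold cut. destruct Z_le_dec; [apply pow_le, Hs0|apply Rle_refl].
    + rewrite (zsum_cut (fun _ => s ^ k)), zsumR_const, mult_INR by lia. right. ring.
Qed.

(* Spectral radius: if [w = q + e] with [q] a trigonometric polynomial and [e] small in [A], then
   the norm of [w^n] grows no faster than [n] times the [n]-th power of a bound slightly above
   the supremum of [w]. *)
Lemma Aball_pow_small (w : R -> C) (B rho eps : R) : Aball w B -> 0 <= rho < 1 ->
  (forall t, Cmod (w t) <= rho) -> 0 < eps -> exists n, Aball (fun t => Cpow (w t) n) eps.
Proof.
  intros Hw Hrho Hsup Heps. set (d := (1 - rho) / 4).
  destruct (Aball_close_trig w B d Hw) as [N HN]; [unfold d; lra|].
  set (q := trig_poly N (hat w)) in *.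
  assert (Hq : forall t, Cmod (q t) <= rho + d).
  { intros t. pose proof (Aball_sup _ _ HN t) as H. cbv beta in H. specialize (Hsup t).
    replace (q t) with (Cminus (w t) (Cminus (w t) (q t))) by ring.
    eapply Rle_trans; [apply Cmod_triangle|]. rewrite Cmod_opp. lra. }
  set (A := 2 * INR N).
  assert (HA : 0 <= A) by (unfold A; pose proof (pos_INR N); lra).
  (* Induction on the number of factors [w]: each is split as q + (w - q), and either raises the
     power of [q] or costs a factor [d] in A(T). The mixed products make the induction close. *)
  assert (Hqw : forall n k, Aball (fun t => Cmult (Cpow (q t) k) (Cpow (w t) n))
     ((A * INR (k + n) + 1) * ((rho + d) ^ k * (rho + 2 * d) ^ n))).
  { intros n. induction n as [|n IH]; intros k.
    - rewrite Nat.add_0_r. simpl. rewrite Rmult_1_r.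
      apply (Aball_ext (fun t => Cpow (q t) k)); [intros; ring|]. apply Aball_trig_pow, Hq.
    - assert (Hx : 0 <= (rho + d) ^ k * (rho + 2 * d) ^ n).
      { apply Rmult_le_pos; apply pow_le; unfold d; lra. }
      apply (Aball_ext (fun t => Cplus (Cmult (Cpow (q t) (S k)) (Cpow (w t) n))
          (Cmult (Cminus (w t) (q t)) (Cmult (Cpow (q t) k) (Cpow (w t) n))))).
      { intros t. simpl. ring. }
      apply (Aball_le _ ((A * INR (S k + n) + 1) * ((rho + d) ^ S k * (rho + 2 * d) ^ n) +
          d * ((A * INR (k + n) + 1) * ((rho + d) ^ k * (rho + 2 * d) ^ n)))).
      + replace (k + S n)%nat with (S k + n)%nat by lia.
        change (S k + n)%nat with (S (k + n)). rewrite S_INR.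
        set (X := (rho + d) ^ k * (rho + 2 * d) ^ n) in *.
        replace ((rho + d) ^ S k * (rho + 2 * d) ^ n) with ((rho + d) * X) by (unfold X; simpl; ring).
        replace ((rho + d) ^ k * (rho + 2 * d) ^ S n) with ((rho + 2 * d) * X) by (unfold X; simpl; ring).
        assert (0 <= d) by (unfold d; lra).
        clearbody X. assert (0 <= A * (d * X)) by (apply Rmult_le_pos; [exact HA|apply Rmult_le_pos; assumption]). nra.
      + apply Aball_plus; [apply IH|]. apply Aball_mult; [exact HN|apply IH]. }
  destruct (linear_times_pow_small A (rho + 2 * d) eps HA) as [n Hn]; [unfold d; lra|exact Heps|].
  exists n. apply (Aball_le _ _ _ Hn). specialize (Hqw n O). simpl in Hqw. rewrite Rmult_1_l in Hqw.
  apply (Aball_ext (fun t => Cmult 1 (Cpow (w t) n))); [intros; ring|exact Hqw].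
Qed.

(** Since c <= v <= B, the function w = 1 - v/B has supremum below 1, so a power w^n is small in
    A(T). The truncated Neumann series P = (1 + w + ... + w^{n-1}) / B satisfies P v - 1 = -w^n. *)
Lemma Aball_inverse (v : R -> C) (u : R -> R) (B c eps : R) : Aball v B -> 0 < c ->
  (forall t, v t = RtoC (u t)) -> (forall t, c <= u t) -> 0 < eps ->
  exists P D, Aball P D /\ Aball (fun t => Cminus (Cmult (P t) (v t)) 1) eps.
Proof.
  intros Hv Hc Hu Hcu Heps.
  assert (HuB : forall t, u t <= B).
  { intros t. pose proof (Aball_sup _ _ Hv t) as H. rewrite Hu, Cmod_R in H. pose proof (Rle_abs (u t)). lra. }
  assert (HcB : c <= B) by (apply Rle_trans with (u 0); auto).
  assert (HB : 0 < B) by lra.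
  set (w := fun t => Cminus 1 (Cmult (RtoC (/ B)) (v t))).
  assert (Hw : Aball w (Cmod (RtoC 1) + Cmod (RtoC (/ B)) * B)).
  { apply (Aball_minus (fun _ => RtoC 1)); [apply Aball_const|apply Aball_scal, Hv]. }
  assert (Hws : forall t, Cmod (w t) <= 1 - c / B).
  { intros t. unfold w. rewrite Hu, <- RtoC_mult, <- RtoC_minus, Cmod_R.
    assert (H1 : / B * u t <= 1).
    { apply Rmult_le_reg_l with B; [exact HB|]. rewrite <- Rmult_assoc, Rinv_r by lra. specialize (HuB t). lra. }
    assert (H2 : c / B <= / B * u t).
    { unfold Rdiv. rewrite Rmult_comm. apply Rmult_le_compat_l; [left; apply Rinv_0_lt_compat, HB|apply Hcu]. }
    rewrite Rabs_pos_eq; lra. }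
  destruct (Aball_pow_small w _ (1 - c / B) eps Hw) as [n Hn]; [|exact Hws|exact Heps|].
  { assert (0 < c / B) by (apply Rdiv_lt_0_compat; lra).
    assert (c / B <= 1); [|lra]. apply Rmult_le_reg_r with B; [exact HB|].
    replace (c / B * B) with c by (field; lra). lra. }
  assert (Hpow : forall k, exists D, Aball (fun t => Cpow (w t) k) D).
  { intros k. induction k as [|k [D HD]].
    - exists (Cmod (RtoC 1)). apply (Aball_const (RtoC 1)).
    - exists ((Cmod (RtoC 1) + Cmod (RtoC (/ B)) * B) * D). apply (Aball_mult w _ _ _ Hw HD). }
  assert (Hgeom : forall k, exists G D, Aball G D /\ forall t, Cmult (G t) (Cminus 1 (w t)) = Cminus 1 (Cpow (w t) k)).
  { intros k. induction k as [|k [G [D [HG1 HG2]]]].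
    - exists (fun _ => RtoC 0), (Cmod (RtoC 0)). split; [apply Aball_const|]. intros t. simpl. ring.
    - destruct (Hpow k) as [E HE]. exists (fun t => Cplus (G t) (Cpow (w t) k)), (D + E).
      split; [apply Aball_plus; assumption|]. intros t. rewrite Cmult_plus_distr_r, HG2. simpl. ring. }
  destruct (Hgeom n) as [G [D [HG1 HG2]]].
  exists (fun t => Cmult (RtoC (/ B)) (G t)), (Cmod (RtoC (/ B)) * D). split; [apply Aball_scal, HG1|].
  replace eps with (Cmod (RtoC (-1)) * eps) by (rewrite Cmod_R, Rabs_left by lra; ring).
  apply (Aball_ext (fun t => Cmult (RtoC (-1)) (Cpow (w t) n))); [|apply Aball_scal, Hn].
  intros t. specialize (HG2 t).
  replace (Cminus 1 (w t)) with (Cmult (RtoC (/ B)) (v t)) in HG2 by (unfold w; ring).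
  replace (Cmult (Cmult (RtoC (/ B)) (G t)) (v t)) with (Cmult (G t) (Cmult (RtoC (/ B)) (v t))) by ring.
  rewrite HG2. ring.
Qed.

(** * Construction of the generator *)

(* [1 - |1 - h|^2 = h + conj h - |h|^2] inherits the flatness of [h]. *)
Lemma flat_square (h : R -> C) (B eps : R) : 1 <= B -> Aball h B -> (forall n, Cmod (hat h n) <= eps) ->
  let k := fun t => Cminus (Cmult (h t) (Cconj (h t))) (Cplus (h t) (Cconj (h t))) in
  Aball k (B * B + 2 * B) /\ forall n, Cmod (hat k n) <= (B * B + 2 * B) * eps.
Proof.
  intros HB Hh Heps k. pose proof (Aball_conj _ _ Hh) as Hh'.
  assert (He : 0 <= eps) by (apply Rle_trans with (2 := Heps 0%Z); apply Cmod_ge_0).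
  assert (Heps' : forall n, Cmod (hat (fun t => Cconj (h t)) n) <= eps).
  { intros n. rewrite hat_conj, Cmod_conj by apply (Aball_cont _ _ Hh). apply Heps. }
  split.
  - replace (B * B + 2 * B) with (B * B + (B + B)) by ring.
    apply Aball_minus; [apply Aball_mult|apply Aball_plus]; assumption.
  - intros n. unfold k. pose proof (Aball_cont _ _ Hh). pose proof (Aball_cont _ _ Hh').
    rewrite hat_minus, (hat_plus h) by (assumption || (apply cont_mult; assumption) || (apply cont_plus; assumption)).
    unfold Cminus. eapply Rle_trans; [apply Cmod_triangle|]. rewrite Cmod_opp.
    pose proof (hat_mult_sup _ _ _ _ eps n Hh Hh' Heps') as H1.
    pose proof (Cmod_triangle (hat h n) (hat (fun t => Cconj (h t)) n)) as H2.
    specialize (Heps n). specialize (Heps' n). 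
    assert (0 <= (B * B + B + (B - 1)) * eps) by (apply Rmult_le_pos; nra). nra.
Qed.

Lemma pow_half_le_1 (n : nat) : (1 / 2) ^ n <= 1.
Proof. rewrite <- (pow1 n) at 2. apply pow_incr. lra. Qed.

Lemma pow_half_S (n : nat) : (1 / 2) ^ S n = (1 / 2) ^ n / 2.
Proof. simpl. field. Qed.

(* [v_n = 2^{-n} + sum_(j<n) 2^{-j-1} |1 - h_j|^2], where [h_j = 1] on [K] and the coefficients of
   [h_j] are small compared with the norm [L] of an approximate inverse of [v_j]. *)
Lemma helson_sequence (K : R -> Prop) : Helson_set K ->
  exists (D : R) (v : nat -> R -> C) (e : nat -> R), 1 <= D /\
    (exists B, Aball (v O) B) /\
    (forall n t, K t -> v n t = RtoC ((1 / 2) ^ n)) /\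
    (forall n, Aball (fun t => Cminus (v (S n) t) (v n t)) ((1 / 2) ^ S n * D)) /\
    (forall n k, Cmod (hat (fun t => Cminus (v (S n) t) (v n t)) k) <= (1 / 2) ^ S n * (D * e n)) /\
    (forall n, e (S n) <= e n) /\
    forall n, exists P L, Aball P L /\ 2 <= L /\
      Aball (fun t => Cminus (Cmult (P t) (v n t)) 1) ((1 / 2) ^ n) /\ e n <= / L ^ S n.
Proof.
  intros HK. destruct (helson_flat K HK) as [B [HB Hflat]].
  set (D := B * B + 2 * B).
  assert (HD : 1 <= D) by (unfold D; nra).
  assert (Hhalf : forall n, 0 < (1 / 2) ^ n) by (intros; apply pow_lt; lra).
  (* The second component records the flatness of the function used last; the real representative
     [u] carries the lower bound needed for inversion. *)
  destruct (dependent_choice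
    (fun n (s : (R -> C) * R) => 0 < snd s /\ (exists A, Aball (fst s) A) /\
       (forall t, K t -> fst s t = RtoC ((1 / 2) ^ n)) /\
       exists u : R -> R, forall t, fst s t = RtoC (u t) /\ (1 / 2) ^ n <= u t)
    (fun n s s' => snd s' <= snd s /\
       Aball (fun t => Cminus (fst s' t) (fst s t)) ((1 / 2) ^ S n * D) /\
       (forall k, Cmod (hat (fun t => Cminus (fst s' t) (fst s t)) k) <= (1 / 2) ^ S n * (D * snd s')) /\
       exists P L, Aball P L /\ 2 <= L /\
         Aball (fun t => Cminus (Cmult (P t) (fst s t)) 1) ((1 / 2) ^ n) /\ snd s' <= / L ^ S n)
    ((fun _ => RtoC 1), 1)) as [s [Hs0 Hs]].
  - simpl. split; [lra|split; [|split]].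
    + exists (Cmod (RtoC 1)). apply Aball_const.
    + reflexivity.
    + exists (fun _ => 1). intros t. split; [reflexivity|lra].
  - intros n [v e] [He [[A HA] [HvK [u Hu]]]]; cbn [fst snd] in *.
    destruct (Aball_inverse v u A ((1 / 2) ^ n) ((1 / 2) ^ n) HA (Hhalf n)) as [P [L0 [HP1 HP2]]].
    { intros t; apply Hu. } { intros t; apply Hu. } { apply Hhalf. }
    (* Keeping [L] at least 2 makes its powers grow geometrically, uniformly over the stages. *)
    set (L := L0 + 2).
    assert (HL0 : 0 <= L0) by apply (Aball_ge0 _ _ HP1).
    assert (HLp : 0 < / L ^ S n) by (apply Rinv_0_lt_compat, pow_lt; unfold L; lra).
    set (e' := Rmin e (/ L ^ S n)).
    assert (He' : 0 < e') by (apply Rmin_glb_lt; assumption).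
    destruct (Hflat e' He') as [h [Hh1 [Hh2 Hh3]]].
    destruct (flat_square h B e' HB Hh1 Hh2) as [Hk1 Hk2].
    set (k := fun t => Cminus (Cmult (h t) (Cconj (h t))) (Cplus (h t) (Cconj (h t)))) in *.
    assert (Hhalf' : Cmod (RtoC ((1 / 2) ^ S n)) = (1 / 2) ^ S n).
    { rewrite Cmod_R. apply Rabs_pos_eq. left. apply Hhalf. }
    (* Here k = |1 - h|^2 - 1: besides adding the new square, this lowers the constant term from
       2^{-n} to 2^{-n-1}. *)
    set (v' := fun t => Cplus (v t) (Cmult (RtoC ((1 / 2) ^ S n)) (k t))).
    assert (Hdiff : forall t, Cmult (RtoC ((1 / 2) ^ S n)) (k t) = Cminus (v' t) (v t)).
    { intros t. unfold v'. ring. }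
    assert (Hkr : forall t, k t = RtoC (Cmod (Cminus 1 (h t)) ^ 2 - 1)).
    { intros t. unfold k. rewrite RtoC_minus, Cmod2_conj, Cminus_conj.
      replace (Cconj (RtoC 1)) with (RtoC 1) by (apply injective_projections; simpl; ring). ring. }
    exists (v', e'). cbn [fst snd]. split; [split; [exact He'|split; [|split]]|split; [|split; [|split]]].
    + exists (A + Cmod (RtoC ((1 / 2) ^ S n)) * D). apply Aball_plus; [exact HA|]. apply Aball_scal, Hk1.
    + intros t Ht. unfold v'. rewrite HvK, Hkr, Hh3 by exact Ht.
      replace (Cminus 1 (RtoC 1)) with (RtoC 0) by ring. rewrite Cmod_0.
      rewrite <- RtoC_mult, <- RtoC_plus. f_equal. simpl. field.
    + exists (fun t => u t + (1 / 2) ^ S n * (Cmod (Cminus 1 (h t)) ^ 2 - 1)). intros t. split.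
      * unfold v'. rewrite (proj1 (Hu t)), Hkr, <- RtoC_mult, <- RtoC_plus. reflexivity.
      * pose proof (proj2 (Hu t)) as H1. pose proof (Hhalf (S n)) as H2. rewrite pow_half_S in *.
        pose proof (pow2_ge_0 (Cmod (Cminus 1 (h t)))). nra.
    + apply Rmin_l.
    + apply (Aball_ext _ _ _ Hdiff). 
      apply (Aball_le _ (Cmod (RtoC ((1 / 2) ^ S n)) * D)); [rewrite Hhalf'; apply Rle_refl|].
      apply Aball_scal, Hk1.
    + intros j. rewrite <- (hat_ext _ _ j Hdiff).
      rewrite hat_scal, Cmod_mult, Hhalf' by apply (Aball_cont _ _ Hk1).
      apply Rmult_le_compat_l; [left; apply Hhalf|apply Hk2].
    + exists P, L. split; [apply (Aball_le _ L0); [unfold L; lra|exact HP1]|].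
      split; [unfold L; lra|]. split; [exact HP2|]. apply Rmin_r.
  (* The flatness used between stages n and n + 1 is stored at stage n + 1, hence the shift. *)
  - exists D, (fun n => fst (s n)), (fun n => snd (s (S n))).
    split; [exact HD|split; [apply (Hs O)|split; [intros n; apply (Hs n)|]]].
    split; [intros n; apply (Hs n)|split; [intros n; apply (Hs n)|split; [intros n; apply (Hs (S n))|]]].
    intros n. apply (Hs n).
Qed.

(** Split P g = P v_n + P (g - v_n). The first term is 1 + y by approximate inversion; the second is
    z, of norm at most L D, with coefficients at most L D e_n <= D / L^n. *)
Lemma helson_generator (K : R -> Prop) : Helson_set K ->
  exists (g : R -> C) (B D : R), Aball g B /\ (forall t, K t -> g t = RtoC 0) /\ 1 <= D /\
    forall n, exists (P y z : R -> C) (L : R), Aball P L /\ 2 <= L /\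
      (forall t, Cmult (P t) (g t) = Cplus 1 (Cplus (y t) (z t))) /\
      Aball y ((1 / 2) ^ n) /\ Aball z (L * D) /\ forall k, Cmod (hat z k) <= D / L ^ n.
Proof.
  intros HK. destruct (helson_sequence K HK) as [D [v [e [HD [[B0 Hv0] [HvK [Hd [Hdh [He HP]]]]]]]]].
  assert (Hhalf : forall n, 0 < (1 / 2) ^ n) by (intros; apply pow_lt; lra).
  destruct (unif_telescope v (fun n => D * (1 / 2) ^ n)) as [g Hg].
  - intros j. apply Rmult_le_pos; [lra|left; apply Hhalf].
  - intros e0 He0. apply half_pow_small, He0.
  - intros j t. rewrite pow_half_S. pose proof (Aball_sup _ _ (Hd j) t) as H. cbv beta in H.
    rewrite pow_half_S in H. lra.
  - assert (He0 : forall n, 0 <= e n).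
    { intros n. pose proof (Hdh n 0%Z) as H. pose proof (Hhalf (S n)).
      assert (H1 : 0 <= (1 / 2) ^ S n * (D * e n)) by (apply Rle_trans with (2 := H); apply Cmod_ge_0).
      apply Rmult_le_reg_l with ((1 / 2) ^ S n * D); [apply Rmult_lt_0_compat; lra|]. lra. }
    assert (Hemono : forall n j, e (n + j)%nat <= e n).
    { intros n j. induction j as [|j IH]; [rewrite Nat.add_0_r; apply Rle_refl|].
      rewrite Nat.add_succ_r. eapply Rle_trans; [apply He|exact IH]. }
    (* The increments from stage n on have summable norms, and as [e] decreases the single value
       [e n] controls all their coefficients. *)
    assert (Htel : forall n j,
      Aball (fun t => Cminus (v (n + j)%nat t) (v n t)) (D * (1 / 2) ^ n - D * (1 / 2) ^ (n + j)) /\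
      forall k, Cmod (hat (fun t => Cminus (v (n + j)%nat t) (v n t)) k) <=
        (D * (1 / 2) ^ n - D * (1 / 2) ^ (n + j)) * e n).
    { intros n j. induction j as [|j [IH1 IH2]].
      - rewrite Nat.add_0_r.
        assert (E : forall t, RtoC 0 = Cminus (v n t) (v n t)) by (intros; ring).
        split.
        + apply (Aball_ext _ _ _ E). replace (D * (1 / 2) ^ n - D * (1 / 2) ^ n) with (Cmod (RtoC 0)).
          * apply Aball_const.
          * rewrite Cmod_0. ring.
        + intros k. rewrite <- (hat_ext _ _ k E), hat_const. destruct Z.eq_dec; rewrite Cmod_0; lra.
      - rewrite Nat.add_succ_r.
        assert (E : forall t, Cplus (Cminus (v (S (n + j)) t) (v (n + j)%nat t)) (Cminus (v (n + j)%nat t) (v n t)) =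
           Cminus (v (S (n + j)) t) (v n t)) by (intros; ring).
        pose proof (Hd (n + j)%nat) as Hdj. split.
        + apply (Aball_ext _ _ _ E).
          replace (D * (1 / 2) ^ n - D * (1 / 2) ^ S (n + j)) with
            ((1 / 2) ^ S (n + j) * D + (D * (1 / 2) ^ n - D * (1 / 2) ^ (n + j))) by (rewrite pow_half_S; field).
          apply Aball_plus; assumption.
        + intros k. rewrite <- (hat_ext _ _ k E).
          rewrite hat_plus by (apply (Aball_cont _ _ Hdj) || apply (Aball_cont _ _ IH1)).
          eapply Rle_trans; [apply Cmod_triangle|].
          specialize (IH2 k). pose proof (Hdh (n + j)%nat k) as H1. specialize (Hemono n j).
          assert (H2 : (1 / 2) ^ S (n + j) * (D * e (n + j)%nat) <= (1 / 2) ^ S (n + j) * (D * e n)).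
          { apply Rmult_le_compat_l; [left; apply Hhalf|]. apply Rmult_le_compat_l; lra. }
          replace (D * (1 / 2) ^ S (n + j)) with (D * (1 / 2) ^ (n + j) - (1 / 2) ^ S (n + j) * D)
            by (rewrite pow_half_S; field). lra. }
    assert (Hclose : forall n eps, 0 < eps -> exists j, forall t,
       Cmod (Cminus (Cminus (g t) (v n t)) (Cminus (v (n + j)%nat t) (v n t))) <= eps).
    { intros n eps Heps. destruct (half_pow_small D eps Heps) as [j Hj]. exists j. intros t.
      replace (Cminus (Cminus (g t) (v n t)) (Cminus (v (n + j)%nat t) (v n t))) with (Cminus (g t) (v (n + j)%nat t)) by ring.
      specialize (Hg (n + j)%nat t). 
      assert ((1 / 2) ^ (n + j) <= (1 / 2) ^ j).
      { rewrite pow_add. rewrite <- (Rmult_1_l ((1 / 2) ^ j)) at 2. apply Rmult_le_compat_r; [left; apply Hhalf|].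
        apply pow_half_le_1. }
      apply Rle_trans with (1 := Hg). apply Rle_trans with (2 := Hj). apply Rmult_le_compat_l; lra. }
    assert (Hgv : forall n, Aball (fun t => Cminus (g t) (v n t)) (D * (1 / 2) ^ n)).
    { intros n. apply Aball_lim. intros eps Heps. destruct (Hclose n eps Heps) as [j Hj].
      exists (fun t => Cminus (v (n + j)%nat t) (v n t)). split; [|exact Hj].
      apply (Aball_le _ _ _) with (2 := proj1 (Htel n j)). pose proof (Hhalf (n + j)%nat).
      assert (0 <= D * (1 / 2) ^ (n + j)) by (apply Rmult_le_pos; lra). lra. }
    assert (Hgh : forall n k, Cmod (hat (fun t => Cminus (g t) (v n t)) k) <= D * e n).
    { intros n k. apply Rle_eps. intros eps Heps. destruct (Hclose n eps Heps) as [j Hj].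
      destruct (Htel n j) as [H1 H2]. specialize (H2 k).
      pose proof (hat_close _ _ eps k (Aball_cont _ _ (Hgv n)) (Aball_cont _ _ H1) Hj) as H3.
      set (x := hat (fun t => Cminus (g t) (v n t)) k) in *.
      set (x' := hat (fun t => Cminus (v (n + j)%nat t) (v n t)) k) in *.
      replace x with (Cplus (Cminus x x') x') by ring.
      eapply Rle_trans; [apply Cmod_triangle|].
      assert ((D * (1 / 2) ^ n - D * (1 / 2) ^ (n + j)) * e n <= D * e n); [|lra].
      apply Rmult_le_compat_r; [apply He0|].
      pose proof (pow_half_le_1 n) as H4.
      pose proof (Hhalf (n + j)%nat). nra. }
    exists g, (B0 + D * (1 / 2) ^ 0), D. split; [|split; [|split; [exact HD|]]].
    + apply (Aball_ext (fun t => Cplus (v O t) (Cminus (g t) (v O t)))); [intros; ring|].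
      apply Aball_plus; [exact Hv0|apply Hgv].
    + intros t Ht. apply NNPP. intros Hne. apply Cmod_gt_0 in Hne.
      destruct (half_pow_small (D + 1) (Cmod (g t) / 2)) as [j Hj]; [lra|].
      specialize (Hg j t). rewrite (HvK j t Ht) in Hg.
      assert (H : Cmod (g t) <= Cmod (Cminus (g t) (RtoC ((1 / 2) ^ j))) + Cmod (RtoC ((1 / 2) ^ j))).
      { replace (g t) with (Cplus (Cminus (g t) (RtoC ((1 / 2) ^ j))) (RtoC ((1 / 2) ^ j))) at 1 by ring.
        apply Cmod_triangle. }
      rewrite Cmod_R, Rabs_pos_eq in H by (left; apply Hhalf). lra.
    + intros n. destruct (HP n) as [P [L [HP1 [HL [HP2 HP3]]]]].
      exists P, (fun t => Cminus (Cmult (P t) (v n t)) 1), (fun t => Cmult (P t) (Cminus (g t) (v n t))), L.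
      split; [exact HP1|split; [exact HL|split; [intros t; ring|split; [exact HP2|split]]]].
      * apply (Aball_le _ (L * (D * (1 / 2) ^ n))); [|apply Aball_mult; [exact HP1|apply Hgv]].
        apply Rmult_le_compat_l; [lra|]. rewrite <- (Rmult_1_r D) at 2. apply Rmult_le_compat_l; [lra|].
        apply pow_half_le_1.
      * intros k. apply Rle_trans with (L * (D * e n)).
        -- apply (hat_mult_sup _ _ _ _ _ k HP1 (Hgv n)). apply Hgh.
        -- assert (HLn : 0 < L ^ n) by (apply pow_lt; lra).
           replace (D / L ^ n) with (L * (D * / L ^ S n)) by (simpl; field; lra).
           apply Rmult_le_compat_l; [lra|]. apply Rmult_le_compat_l; [lra|exact HP3].
Qed.

(** * Cyclicity *)

Lemma rpow_pos (x p : R) : 0 < x -> rpow x p = Rpower x p.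
Proof. intros H. unfold rpow. destruct Req_EM_T; [lra|reflexivity]. Qed.

Lemma rpow_0 (p : R) : rpow 0 p = 0.
Proof. unfold rpow. destruct Req_EM_T; [reflexivity|lra]. Qed.

Lemma rpow_le (x y p : R) : 0 <= x <= y -> 0 < p -> rpow x p <= rpow y p.
Proof.
  intros [Hx Hxy] Hp. destruct (Req_EM_T x 0) as [->|Hn].
  - rewrite rpow_0. apply rpow_nonneg.
  - rewrite !rpow_pos by lra. apply Rle_Rpower_l; lra.
Qed.

Lemma rpow_interpolate (x s p : R) : 0 <= x <= s -> 1 < p -> rpow x p <= rpow s (p - 1) * x.
Proof.
  intros [Hx Hxs] Hp. destruct (Req_EM_T x 0) as [->|Hn].
  - rewrite rpow_0. lra.
  - apply Rle_trans with (rpow x (p - 1) * x).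
    + rewrite !rpow_pos by lra. rewrite <- (Rpower_1 x) at 3 by lra. rewrite <- Rpower_plus.
      replace (p - 1 + 1) with p by ring. apply Rle_refl.
    + apply Rmult_le_compat_r; [exact Hx|]. apply rpow_le; lra.
Qed.

(** The sum is at most three times its largest term; this takes the place of Minkowski's
    inequality. *)
Lemma rpow_add3 (x y z p : R) : 0 <= x -> 0 <= y -> 0 <= z -> 1 < p ->
  rpow (x + y + z) p <= Rpower 3 p * (rpow x p + rpow y p + rpow z p).
Proof.
  intros Hx Hy Hz Hp.
  assert (Hm : forall m, 0 <= m -> x <= m -> y <= m -> z <= m -> rpow (x + y + z) p <= Rpower 3 p * rpow m p).
  { intros m Hm0 H1 H2 H3. destruct (Req_EM_T m 0) as [->|Hn].
    - replace (x + y + z) with 0 by lra. rewrite rpow_0. lra.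
    - apply Rle_trans with (rpow (3 * m) p); [apply rpow_le; lra|].
      rewrite !rpow_pos by lra. rewrite Rpower_mult_distr by lra. apply Rle_refl. }
  assert (H3 : 0 < Rpower 3 p) by apply exp_pos.
  pose proof (rpow_nonneg x p). pose proof (rpow_nonneg y p). pose proof (rpow_nonneg z p).
  destruct (Rle_dec x y), (Rle_dec y z), (Rle_dec x z).
  all: try (eapply Rle_trans; [apply (Hm z); lra|]; apply Rmult_le_compat_l; lra).
  all: try (eapply Rle_trans; [apply (Hm y); lra|]; apply Rmult_le_compat_l; lra).
  all: eapply Rle_trans; [apply (Hm x); lra|]; apply Rmult_le_compat_l; lra.
Qed.

Lemma lp_partial_interpolate (a : Z -> C) (B s p : R) (N : nat) : 1 < p -> l1 a B ->
  (forall n, Cmod (a n) <= s) -> lp_partial p a N <= rpow s (p - 1) * B.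
Proof.
  intros Hp Hl Hs.
  apply Rle_trans with (rpow s (p - 1) * zsumR (fun n => Cmod (a n)) N).
  - rewrite <- zsumR_scal. apply zsumR_le. intros n _. apply rpow_interpolate; [|exact Hp].
    split; [apply Cmod_ge_0|apply Hs].
  - apply Rmult_le_compat_l; [apply rpow_nonneg|apply Hl].
Qed.

(** * Passage to distributions and A_p norms *)

Lemma test_function_cont (phi : R -> C) : test_function phi -> cont phi.
Proof.
  intros [_ Hs]. apply cont_pair; intros t; destruct (Hs 1%nat t) as [H1 H2].
  - apply (ex_derive_continuous (V := R_NormedModule)). exact H1.
  - apply (ex_derive_continuous (V := R_NormedModule)). exact H2.
Qed.

Lemma distr_of_distribution (f : R -> C) (B : R) : Aball f B -> is_distribution (distr_of f).
Proof.
  intros Hf. pose proof (Aball_cont _ _ Hf) as Hc. split; [|split].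
  - intros phi psi Hphi Hpsi. apply test_function_cont in Hphi. apply test_function_cont in Hpsi.
    change (mean (fun t => Cmult (f t) (Cplus (phi t) (psi t))) =
      Cplus (mean (fun t => Cmult (f t) (phi t))) (mean (fun t => Cmult (f t) (psi t)))).
    rewrite <- mean_plus by (apply cont_mult; assumption). apply mean_ext. intros t. ring.
  - intros a phi Hphi. apply test_function_cont in Hphi.
    change (mean (fun t => Cmult (f t) (Cmult a (phi t))) = Cmult a (mean (fun t => Cmult (f t) (phi t)))).
    rewrite <- mean_scal by (apply cont_mult; assumption). apply mean_ext. intros t. ring.
  (* The functional has order zero: the supremum of the test function controls it. *)
  - exists B, O. intros phi M Hphi HM. apply test_function_cont in Hphi.
    apply (mean_bound (fun t => Cmult (f t) (phi t))); [apply cont_mult; assumption|].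
    intros t. rewrite Cmod_mult. apply Rmult_le_compat; [apply Cmod_ge_0|apply Cmod_ge_0|apply (Aball_sup _ _ Hf)|].
    specialize (HM O t (le_n O)). destruct (phi t) as [x y] eqn:E.
    unfold CDerive_n in HM. simpl in HM. rewrite E in HM. exact HM.
Qed.

Lemma Aball_in_A (f : R -> C) (B : R) : Aball f B -> in_A f.
Proof.
  intros Hf. split; [apply Hf|split; [apply Hf|split]].
  - apply (distr_of_distribution f B Hf).
  - apply (in_lp_bounded _ _ B). intros N. rewrite lp_partial_1. apply Hf.
Qed.

Lemma Aball_in_Ap (f : R -> C) (B p : R) : 1 < p -> Aball f B -> in_Ap p (distr_of f).
Proof.
  intros Hp Hf. split; [apply (distr_of_distribution f B Hf)|].
  apply (in_lp_bounded _ _ (rpow B (p - 1) * B)). intros N.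
  apply lp_partial_interpolate; [exact Hp|apply Hf|].
  intros n. apply l1_coef, Hf.
Qed.

Lemma fourier_distr_mul (P g : R -> C) (n : Z) :
  fourier (distr_mul P (distr_of g)) n = hat (fun t => Cmult (P t) (g t)) n.
Proof.
  change (mean (fun t => Cmult (g t) (Cmult (P t) (expi (- n) t))) = hat (fun t => Cmult (P t) (g t)) n).
  apply mean_ext. intros t. ring.
Qed.

Lemma lp_tail (p : R) (c : Z -> C) (eps : R) : 0 < p -> in_lp p c -> 0 < eps ->
  exists M, forall N, lp_partial p (fun n => Cminus (cut (G := C_AbelianMonoid) M c n) (c n)) N <= eps.
Proof.
  intros Hp Hc Heps.
  pose proof (Lim_seq_correct' _ Hc) as Hl. apply is_lim_seq_spec in Hl.
  destruct (Hl (mkposreal eps Heps)) as [M HM]. specialize (HM M (le_n M)). simpl in HM.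
  exists M. intros N. set (K := max M N).
  set (r := fun n => rpow (Cmod (c n)) p).
  apply Rle_trans with (zsumR (fun n => r n + (-1) * cut (G := R_AbelianMonoid) M r n) K).
  - apply Rle_trans with (zsumR (fun n => r n + (-1) * cut (G := R_AbelianMonoid) M r n) N).
    + apply zsumR_le. intros n _. unfold cut. destruct Z_le_dec.
      * replace (Cminus (c n) (c n)) with (RtoC 0) by ring. rewrite Cmod_0, rpow_0. lra.
      * change (rpow (Cmod (Cminus (RtoC 0) (c n))) p <= r n + (-1) * 0).
        replace (Cminus (RtoC 0) (c n)) with (Copp (c n)) by ring. rewrite Cmod_opp. unfold r. lra.
    + apply zsumR_mono; [|unfold K; lia]. intros n. unfold cut. destruct Z_le_dec; [lra|].
      change (0 <= r n + (-1) * 0). pose proof (rpow_nonneg (Cmod (c n)) p). unfold r. lra.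
  - rewrite zsumR_plus, zsumR_scal, (zsum_cut r) by (unfold K; lia).
    change (zsumR r K) with (lp_partial p c K). change (zsumR r M) with (lp_partial p c M).
    pose proof (lp_partial_bound p c K Hc) as H. apply Rabs_def2 in HM. lra.
Qed.

(** A limit preserves weak inequalities only; aiming at eps/2 restores the strict one. *)
Lemma lp_norm_lt (p : R) (c : Z -> C) (eps : R) : 0 < p -> 0 < eps ->
  (forall N, lp_partial p c N <= Rpower (eps / 2) p) -> lp_norm p c < eps.
Proof.
  intros Hp He H. unfold lp_norm.
  set (l := real (Lim_seq (lp_partial p c))).
  assert (Hin : in_lp p c) by (apply (in_lp_bounded _ _ _ H)).
  assert (Hl : l <= Rpower (eps / 2) p).
  { apply (is_lim_seq_le (lp_partial p c) (fun _ => Rpower (eps / 2) p) l (Rpower (eps / 2) p) H).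
    - apply Lim_seq_correct', Hin.
    - apply is_lim_seq_const. }
  assert (Hl0 : 0 <= l).
  { apply Rle_trans with (2 := lp_partial_bound p c O Hin). apply zsumR_nonneg. intros; apply rpow_nonneg. }
  apply Rle_lt_trans with (rpow (Rpower (eps / 2) p) (/ p)).
  - apply rpow_le; [lra|apply Rinv_0_lt_compat, Hp].
  - rewrite rpow_pos by apply exp_pos. rewrite Rpower_mult, Rinv_r, Rpower_1; lra.
Qed.

(** The quantity equals A^p L^{1 - n (p - 1)}. Once n (p - 1) >= j + 1 it is at most A^p 2^{-j},
    whatever L >= 2 is; uniformity matters because L depends on n without control. *)
Lemma interpolation_constant_small (A p eps : R) : 0 < A -> 1 < p -> 0 < eps ->
  exists n0, forall n L, (n0 <= n)%nat -> 2 <= L -> rpow (A / L ^ n) (p - 1) * (A * L) <= eps.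
Proof.
  intros HA Hp Heps.
  set (c := Rpower A (p - 1) * A).
  assert (Hc : 0 < c) by (apply Rmult_lt_0_compat; [apply exp_pos|exact HA]).
  destruct (half_pow_small c eps Heps) as [j Hj].
  destruct (INR_unbounded ((INR j + 1) / (p - 1))) as [n0 Hn0].
  exists n0. intros n L Hn HL.
  assert (Hnj : INR j + 1 <= INR n * (p - 1)).
  { apply le_INR in Hn. apply Rle_trans with ((INR j + 1) / (p - 1) * (p - 1)).
    - right. field. lra.
    - apply Rmult_le_compat_r; lra. }
  assert (HLn : 0 < L ^ n) by (apply pow_lt; lra).
  rewrite rpow_pos by (apply Rdiv_lt_0_compat; lra).
  replace (A / L ^ n) with (A * Rpower L (- INR n)) by (rewrite Rpower_Ropp, Rpower_pow by lra; reflexivity).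
  rewrite <- Rpower_mult_distr by (lra || apply exp_pos).
  rewrite Rpower_mult.
  replace (Rpower A (p - 1) * Rpower L (- INR n * (p - 1)) * (A * L)) with
    (c * (Rpower L (- INR n * (p - 1)) * Rpower L 1)) by (rewrite Rpower_1 by lra; unfold c; ring).
  rewrite <- Rpower_plus.
  apply Rle_trans with (2 := Hj). apply Rmult_le_compat_l; [lra|].
  apply Rle_trans with (Rpower L (- INR j)).
  - apply Rle_Rpower; lra.
  - rewrite Rpower_Ropp, Rpower_pow by lra.
    replace ((1 / 2) ^ j) with (/ 2 ^ j) by (rewrite <- pow_inv; f_equal; field).
    apply Rinv_le_contravar; [apply pow_lt; lra|]. apply pow_incr. lra.
Qed.

(** Truncate the target to a trigonometric polynomial T, and use as multiplier a truncation Q of T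
    P. Then Q g - T = T y - (T P - Q) g + T z: the first two terms are small in A(T), the last one
    only through interpolation. *)
Lemma generator_cyclic (g : R -> C) (B D p : R) : Aball g B -> 1 <= D -> 1 < p ->
  (forall n, exists (P y z : R -> C) (L : R), Aball P L /\ 2 <= L /\
      (forall t, Cmult (P t) (g t) = Cplus 1 (Cplus (y t) (z t))) /\
      Aball y ((1 / 2) ^ n) /\ Aball z (L * D) /\ forall k, Cmod (hat z k) <= D / L ^ n) ->
  cyclic_vector p (distr_of g).
Proof.
  intros Hg HD Hp HP. split; [apply (Aball_in_Ap g B); assumption|].
  intros S [_ HS] eps Heps.
  set (c := fourier S) in *.
  assert (H3 : 0 < Rpower 3 p) by apply exp_pos.
  (* A third of the allowed p-th power, after paying the constant of [rpow_add3]. *)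
  set (tgt := Rpower (eps / 2) p / (3 * Rpower 3 p)).
  assert (Htgt : 0 < tgt) by (apply Rdiv_lt_0_compat; [apply exp_pos|lra]).
  destruct (lp_tail p c tgt) as [M HM]; [lra|exact HS|exact Htgt|].
  set (T := trig_poly M c).
  set (tau := zsumR (fun n => Cmod (c n)) M + 1).
  assert (Hc0 : 0 <= zsumR (fun n => Cmod (c n)) M) by (apply zsumR_nonneg; intros; apply Cmod_ge_0).
  assert (HT : Aball T tau).
  { apply (Aball_le _ (zsumR (fun n => Cmod (c n)) M)); [unfold tau; lra|apply Aball_trig]. }
  (* Coefficients bounded by 1 have p-th powers below themselves, so an A(T) bound by [alpha] bounds
     the p-th power sum by [tgt]. *)
  set (alpha := Rmin 1 tgt).
  assert (Ha : 0 < alpha) by (apply Rmin_glb_lt; lra).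
  assert (Ha1 : alpha <= 1) by apply Rmin_l. assert (Ha2 : alpha <= tgt) by apply Rmin_r.
  destruct (half_pow_small tau (alpha / 2)) as [n1 Hn1]; [lra|].
  assert (HtD : 0 < tau * D) by (apply Rmult_lt_0_compat; unfold tau; lra).
  destruct (interpolation_constant_small (tau * D) p tgt HtD Hp Htgt) as [n2 Hn2].
  set (n := max n1 n2).
  destruct (HP n) as [P [y [z [L [HPL [HL [HPg [Hy [Hz Hzk]]]]]]]]].
  pose proof (Aball_mult _ _ _ _ HT HPL) as HTP.
  assert (HB : 0 <= B) by apply (Aball_ge0 _ _ Hg).
  destruct (Aball_close_trig _ _ (alpha / 2 / (B + 1)) HTP) as [N HN].
  { apply Rdiv_lt_0_compat; lra. }
  set (a := hat (fun t => Cmult (T t) (P t))) in *.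
  exists N, a. apply lp_norm_lt; [lra|exact Heps|]. intros N'.
  set (E := fun t => Cminus (Cmult (T t) (y t)) (Cmult (Cminus (Cmult (T t) (P t)) (trig_poly N a t)) (g t))).
  assert (HE : Aball E alpha).
  { apply (Aball_le _ (tau * (1 / 2) ^ n + alpha / 2 / (B + 1) * B)).
    - assert (H1 : tau * (1 / 2) ^ n <= alpha / 2).
      { apply Rle_trans with (2 := Hn1). apply Rmult_le_compat_l; [unfold tau; lra|].
        unfold n. replace (max n1 n2) with (n1 + (max n1 n2 - n1))%nat by lia. rewrite pow_add.
        rewrite <- (Rmult_1_r ((1 / 2) ^ n1)) at 2. apply Rmult_le_compat_l; [apply pow_le; lra|apply pow_half_le_1]. }
      assert (H2 : alpha / 2 / (B + 1) * B <= alpha / 2).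
      { apply Rmult_le_reg_r with (B + 1); [lra|].
        replace (alpha / 2 / (B + 1) * B * (B + 1)) with (alpha / 2 * B) by (field; lra). nra. }
      lra.
    - apply Aball_minus; apply Aball_mult; assumption. }
  set (F := fun t => Cmult (T t) (z t)).
  assert (HF : Aball F (tau * (L * D))) by (apply Aball_mult; assumption).
  assert (HFk : forall k, Cmod (hat F k) <= tau * D / L ^ n).
  { intros k. unfold Rdiv. rewrite Rmult_assoc. apply (hat_mult_sup _ _ _ _ _ k HT Hz). exact Hzk. }
  assert (Hsplit : forall k, fourier (distr_sub (distr_mul (trig_poly N a) (distr_of g)) S) k =
    Cplus (Cplus (hat E k) (hat F k)) (Cminus (cut (G := C_AbelianMonoid) M c k) (c k))).
  { intros k.
    change (Cminus (fourier (distr_mul (trig_poly N a) (distr_of g)) k) (c k) =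
      Cplus (Cplus (hat E k) (hat F k)) (Cminus (cut (G := C_AbelianMonoid) M c k) (c k))).
    rewrite fourier_distr_mul.
    rewrite (hat_ext _ (fun t => Cplus (Cplus (E t) (F t)) (T t))).
    - rewrite hat_plus, hat_plus.
      + unfold T. rewrite hat_trig. ring.
      + apply (Aball_cont _ _ HE).
      + apply (Aball_cont _ _ HF).
      + apply cont_plus; [apply (Aball_cont _ _ HE)|apply (Aball_cont _ _ HF)].
      + apply cont_trig.
    - intros t. unfold E, F.
      replace (Cmult (Cminus (Cmult (T t) (P t)) (trig_poly N a t)) (g t)) with
        (Cminus (Cmult (T t) (Cmult (P t) (g t))) (Cmult (trig_poly N a t) (g t))) by ring.
      rewrite HPg. ring. }
  apply Rle_trans with (Rpower 3 p * (lp_partial p (hat E) N' + lp_partial p (hat F) N' +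
     lp_partial p (fun k => Cminus (cut (G := C_AbelianMonoid) M c k) (c k)) N')).
  - unfold lp_partial. rewrite <- !zsumR_plus, <- zsumR_scal. apply zsumR_le. intros k _.
    rewrite Hsplit.
    eapply Rle_trans; [|apply rpow_add3; try apply Cmod_ge_0; exact Hp].
    apply rpow_le; [|lra]. split; [apply Cmod_ge_0|].
    eapply Rle_trans; [apply Cmod_triangle|]. apply Rplus_le_compat_r, Cmod_triangle.
  - assert (I1 : lp_partial p (hat E) N' <= tgt).
    { eapply Rle_trans; [apply (lp_partial_interpolate _ alpha 1 p N' Hp)|].
      - apply HE.
      - intros k. apply Rle_trans with (2 := Ha1). apply l1_coef, HE.
      - rewrite rpow_pos by lra. unfold Rpower. rewrite ln_1, Rmult_0_r, exp_0. lra. }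
    assert (I2 : lp_partial p (hat F) N' <= tgt).
    { eapply Rle_trans; [apply (lp_partial_interpolate _ (tau * (L * D)) (tau * D / L ^ n) p N' Hp)|].
      - apply HF.
      - exact HFk.
      - replace (tau * (L * D)) with (tau * D * L) by ring. apply Hn2; [unfold n; lia|exact HL]. }
    specialize (HM N').
    replace (Rpower (eps / 2) p) with (Rpower 3 p * (tgt + tgt + tgt)) by (unfold tgt; field; lra).
    apply Rmult_le_compat_l; lra.
Qed.

Theorem lemma9 (K : R -> Prop) (hK : Helson_set K) :
  exists g : R -> C,
    in_A g /\
    (forall t : R, K t -> g t = RtoC 0) /\
    (forall p : R, 1 < p -> cyclic_vector p (distr_of g)).
Proof.
  destruct (helson_generator K hK) as [g [B [D [HgA [HgK [HD HP]]]]]].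
  exists g. split; [apply (Aball_in_A g B HgA)|split; [exact HgK|]].
  intros p Hp. apply (generator_cyclic g B D p HgA HD Hp HP).
Qed.
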